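(* $\mathrm{MC}(/)$ is $\mathrm{NL}$-hard under logarithmic-space many-one reductions.
   Context: Natural numbers include $0$. For $A,B\subseteq\mathbb N$: $A\cup B$, $A\cap B$ are the usual operations, $\overline{A}=\mathbb N\setminus A$, $A+B=\{a+b: a\in A, b\in B\}$, $A\times B=\{a\cdot b: a\in A, b\in B\}$, and $A/B=\{c\in\mathbb N:\exists a\in A\ \exists b\in B\setminus\{0\}: a=c\cdot b\}$ (exact integer division without remainder or rounding). For $\emptyset\ne\mathcal O\subseteq\{\cup,\cap,\overline{\phantom{c}},+,\times,/\}$, an $\mathcal O$-circuit $C=(V,E,g_C,\alpha)$ is a finite acyclic directed multigraph with gate set $V\subseteq\mathbb N$, every gate having indegree $0$, $1$ or $2$, a designated output gate $g_C\in V$, and a labeling $\alpha$: gates of indegree $0$ (input gates) are labeled by natural numbers, gates of indegree $1$ are labeled $\overline{\phantom{c}}$ (allowed only if $\overline{\phantom{c}}\in\mathcal O$), and gates of indegree $2$ are labeled by an operation in $\mathcal O\setminus\{\overline{\phantom{c}}\}$. The result set $I(g)\subseteq\mathbb N$ is defined inductively: $I(g)=\{\alpha(g)\}$ for an input gate; $I(g)=\mathbb N\setminus I(p)$ for a complement gate with predecessor $p$; $I(g)=I(g_1)\,\sigma\,I(g_2)$ for a gate labeled $\sigma$ with predecessors $g_1\le g_2$ (a double edge from one gate gives $g_1=g_2$). $I(C)=I(g_C)$. A circuit is encoded as a bit string listing its gates in reverse topological order, each gate as the triple (gate name, label, list of predecessors), with all numbers (including input labels) in binary; $|C|$ denotes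 the length of this encoding. The membership problem is $\mathrm{MC}(\mathcal O)=\{(C,b): C \text{ is an } \mathcal O\text{-circuit},\ b\in\mathbb N,\ b\in I(C)\}$, with $b$ given in binary; $\mathrm{MC}(\sigma_1,\dots,\sigma_n)$ abbreviates $\mathrm{MC}(\{\sigma_1,\dots,\sigma_n\})$. *)

(* Defs.v *)
From mathcomp Require Import all_boot.
From Stdlib Require List.
Set Implicit Arguments. Unset Strict Implicit. Unset Printing Implicit Defensive.

Inductive op := OUnion | OInter | OCompl | OPlus | OTimes | ODiv.

Inductive label := LIn of nat | LOp of op.

Record gate := Gate { gname : nat; glab : label; gpreds : seq nat }.

(* A circuit: designated output gate name, and the list of gates in
   reverse topological order (predecessors of a gate occur later). *)
Record circuit := Circuit { gout : nat; ggates : seq gate }.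

Definition sem_op (o : op) (A B : nat -> Prop) : nat -> Prop :=
  match o with
  | OUnion => fun x => A x \/ B x
  | OInter => fun x => A x /\ B x
  | OCompl => fun x => ~ A x
  | OPlus  => fun x => exists a b, A a /\ B b /\ x = a + b
  | OTimes => fun x => exists a b, A a /\ B b /\ x = a * b
  | ODiv   => fun x => exists a b, A a /\ B b /\ b <> 0 /\ a = x * b
  end.

(* Value of a gate given the values of the gates after it.  For a binary
   gate with predecessors p, q, the first operand is the smaller gate name
   (g1 <= g2), as in the paper. *)
Definition gate_val (g : gate) (e : nat -> nat -> Prop) : nat -> Prop :=
  match glab g with
  | LIn a => fun x => x = a
  | LOp o =>
      let p := nth 0 (gpreds g) 0 in
      let q := nth 0 (gpreds g) 1 in
      match o with
      | OCompl => fun x => ~ e p x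
      | _ => sem_op o (e (minn p q)) (e (maxn p q))
      end
  end.

Fixpoint gate_env (gs : seq gate) : nat -> nat -> Prop :=
  match gs with
  | [::] => fun _ _ => False
  | g :: gs' => let e := gate_env gs' in
      fun n => if n == gname g then gate_val g e else e n
  end.

Definition circ_val (C : circuit) : nat -> Prop := gate_env (ggates C) (gout C).

Definition arity_ok (O : op -> Prop) (g : gate) : Prop :=
  match glab g with
  | LIn _ => gpreds g = [::]
  | LOp o => O o /\ size (gpreds g) = (if o is OCompl then 1 else 2)
  end.

(* distinct gate names, predecessors listed later (=> acyclic),
   labels/indegrees consistent with O *)
Fixpoint valid_gates (O : op -> Prop) (gs : seq gate) : Prop :=
  match gs with
  | [::] => True
  | g :: gs' =>
      gname g \notin map gname gs' /\
      all (fun p => p \in map gname gs') (gpreds g) /\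
      arity_ok O g /\ valid_gates O gs'
  end.

Definition valid_circuit (O : op -> Prop) (C : circuit) : Prop :=
  valid_gates O (ggates C) /\ gout C \in map gname (ggates C).

Fixpoint lsb_bits (fuel n : nat) : seq bool :=
  match fuel with
  | 0 => [::]
  | f.+1 => if n == 0 then [::] else odd n :: lsb_bits f n./2
  end.

Definition binary (n : nat) : seq bool :=
  if n == 0 then [:: false] else rev (lsb_bits n n).

Inductive sym := S0 | S1 | SComma | SLpar | SRpar | SOp of op.

Definition sym_index (s : sym) : nat :=
  match s with
  | S0 => 0 | S1 => 1 | SComma => 2 | SLpar => 3 | SRpar => 4
  | SOp OUnion => 5 | SOp OInter => 6 | SOp OCompl => 7
  | SOp OPlus => 8 | SOp OTimes => 9 | SOp ODiv => 10
  end.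

Definition sym_code (s : sym) : seq bool :=
  let k := sym_index s in [:: odd (k %/ 8); odd (k %/ 4); odd (k %/ 2); odd k].

Definition enc_num (n : nat) : seq sym := map (fun b => if b then S1 else S0) (binary n).

Fixpoint sepby (l : seq (seq sym)) : seq sym :=
  match l with
  | [::] => [::]
  | [:: a] => a
  | a :: l' => a ++ SComma :: sepby l'
  end.

Definition enc_label (l : label) : seq sym :=
  match l with LIn a => enc_num a | LOp o => [:: SOp o] end.

Definition enc_gate (g : gate) : seq sym :=
  SLpar :: enc_num (gname g) ++ SComma :: enc_label (glab g) ++
  SComma :: SLpar :: sepby (map enc_num (gpreds g)) ++ [:: SRpar; SRpar].

Definition enc_instance (C : circuit) (b : nat) : seq sym :=
  SLpar :: enc_num (gout C) ++ SComma :: SLpar ::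
  sepby (map enc_gate (ggates C)) ++ SRpar :: SComma :: enc_num b ++ [:: SRpar].

Definition to_bits (s : seq sym) : seq bool := flatten (map sym_code s).

Definition language := seq bool -> Prop.

Definition MC (O : op -> Prop) : language :=
  fun w => exists (C : circuit) (b : nat),
    valid_circuit O C /\ w = to_bits (enc_instance C b) /\ circ_val C b.

Inductive mv := MvL | MvS | MvR.

(* read-only input tape with end markers: positions 0 .. n+1,
   position i in 1..n holds x_i, positions 0 and n+1 hold end markers *)
Definition in_sym (x : seq bool) (i : nat) : option bool :=
  if (0 < i) && (i <= size x) then Some (nth false x i.-1) else None.

Definition move_in (x : seq bool) (m : mv) (i : nat) : nat :=
  match m with MvL => i.-1 | MvS => i | MvR => minn i.+1 (size x).+1 end.

Definition move_w (m : mv) (i : nat) : nat :=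
  match m with MvL => i.-1 | MvS => i | MvR => i.+1 end.

Definition logbound (c n : nat) : nat := c * (trunc_log 2 n).+1.

Record NTM := {
  nQ : finType; nG : finType; nblank : nG; nstart : nQ; nacc : pred nQ;
  ndelta : nQ -> option bool -> nG -> seq (nQ * nG * mv * mv) }.

(* configuration: state, input head, work tape, work head *)
Definition ncfg (M : NTM) := (nQ M * nat * seq (nG M) * nat)%type.

Definition ninit (M : NTM) : ncfg M := (nstart M, 1, [::], 0).

Definition nstep (M : NTM) (x : seq bool) (c c' : ncfg M) : Prop :=
  let: (q, ih, wt, wh) := c in
  exists q' g mi mw,
    List.In (q', g, mi, mw) (ndelta q (in_sym x ih) (nth (nblank M) wt wh)) /\
    c' = (q', move_in x mi ih, set_nth (nblank M) wt wh g, move_w mw wh).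

Inductive nreach (M : NTM) (x : seq bool) : ncfg M -> Prop :=
  | nreach0 : nreach x (ninit M)
  | nreachS c c' : nreach x c -> nstep x c c' -> nreach x c'.

Definition inNL (L : language) : Prop :=
  exists (M : NTM) (c : nat),
    (forall x (k : ncfg M), nreach x k -> k.2 <= logbound c (size x)) /\
    (forall x, L x <-> exists k : ncfg M, nreach x k /\ nacc k.1.1.1).

(* Deterministic transducer: read-only input tape, one work tape,
   write-only one-way output tape (optionally appends a bit per step).
   It halts when the transition function is undefined. *)
Record DTM := {
  dQ : finType; dG : finType; dblank : dG; dstart : dQ;
  ddelta : dQ -> option bool -> dG -> option (dQ * dG * mv * mv * option bool) }.

Definition dcfg (M : DTM) := (dQ M * nat * seq (dG M) * nat * seq bool)%type.

Definition dinit (M : DTM) : dcfg M := (dstart M, 1, [::], 0, [::]).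

Definition dstep (M : DTM) (x : seq bool) (c : dcfg M) : option (dcfg M) :=
  let: (q, ih, wt, wh, out) := c in
  match ddelta q (in_sym x ih) (nth (dblank M) wt wh) with
  | None => None
  | Some (q', g, mi, mw, ob) =>
      Some (q', move_in x mi ih, set_nth (dblank M) wt wh g, move_w mw wh,
            match ob with None => out | Some b => rcons out b end)
  end.

Fixpoint drun (M : DTM) (x : seq bool) (t : nat) : option (dcfg M) :=
  match t with
  | 0 => Some (dinit M)
  | t'.+1 => obind (@dstep M x) (drun M x t')
  end.

Definition logspace_computable (f : seq bool -> seq bool) : Prop :=
  exists (M : DTM) (c : nat), forall x,
    (forall t (k : dcfg M), @drun M x t = Some k -> k.1.2 <= logbound c (size x)) /\
    (exists t (k : dcfg M), @drun M x t = Some k /\ @dstep M x k = None /\ k.2 = f x).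

Definition logspace_reducible (L L' : language) : Prop :=
  exists f, logspace_computable f /\ forall x, L x <-> L' (f x).

Definition NL_hard (L : language) : Prop :=
  forall L', inNL L' -> logspace_reducible L' L.

(* Main.v *)
(* A {/}-circuit cannot express "or" over gates that may be empty, but it computes "and" for free:
   if every gate has value {1} or the empty set, then p / q is {1} exactly when both p and q are.
   So a gate of a layered graph whose bad nodes are realised as 0 / 0 has value {1} iff no bad node is
   reachable from it, and MC(/) expresses non-reachability.  Hardness for NL rather than coNL
   therefore needs the theorem of Immerman and Szelepcsenyi, which is built into the graph: its
   nodes are the states of the inductive counting procedure run on the configuration graph of a
   given machine M on input x, the bad node being "x is certified to be rejected".  A node consists
   of a label of a fixed flowchart and ten registers, each a string of logarithmic length that is
   read both as a configuration of M and as a counter.  One step of the flowchart is a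
   right-to-left pass of a finite transducer after a left-to-right one, and so is the successor
   function of an enumeration of all nodes; hence a logarithmic-space machine prints the circuit by
   sweeping over a tape that holds the current node, its time stamp and one successor. *)
Require Import Defs.
From mathcomp Require Import all_boot.
From mathcomp Require Import zify.
From HB Require Import structures.
From Stdlib Require List.
Set Implicit Arguments. Unset Strict Implicit. Unset Printing Implicit Defensive.

(** * Injectivity of the encoding *)

(** The graph of counting states has cycles and a circuit has none, so the graph is unrolled into
    layers indexed by time stamps. A shortest path to a bad node has fewer steps than there are
    nodes, so as many layers as nodes suffice. Every node has one successor per guessed bit, which
    makes each gate binary; among several transitions of M one is selected by a unary sequence of
    bits. Vertices and counters are strings of the same length numbered by an odometer, so a single
    bound P is the number of vertices, the number of levels and the modulus of the counters. The
    enumeration of all strings contains some that encode no configuration; they get gates as well,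
    and do no harm because only nodes reachable from the output gate matter. The delicate part of
    the printing machine is the input symbol seen by a configuration in a register: its own input
    head has to be driven to a position that is stored in binary. Finally, [MC] is a set of bit
    strings, so the encoding must be shown injective. *)

Definition lsb_val (l : seq bool) : nat := foldr (fun (b : bool) a => b + a.*2) 0 l.
Definition bits_val (l : seq bool) : nat := lsb_val (rev l).

Lemma lsb_bitsK f n : n <= f -> lsb_val (lsb_bits f n) = n.
Proof.
elim: f n => [|f IH] n; first by rewrite leqn0 => /eqP ->.
move=> /= le_nf; case: eqP => [-> //|n0] /=.
by rewrite IH ?odd_double_half //; lia.
Qed.

Lemma lsb_valK f l : last true l -> lsb_val l <= f -> lsb_bits f (lsb_val l) = l.
Proof.
elim: l f => [|b l IH] f; first by case: f.
move=> /= last_l le_f.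
have pos : 0 < b + (lsb_val l).*2.
  elim: l b last_l {IH le_f} => [|b' l IH] b /=; first by move=> ->.
  by move=> h; have := IH _ h; lia.
case: f le_f => [|f] le_f /=; first by lia.
rewrite -[_ == 0]negbK -lt0n pos /=; congr cons.
  by rewrite oddD odd_double addbF; case: b {last_l le_f pos}.
rewrite halfD odd_double andbF add0n.
have -> : b./2 = 0 by case: (b).
rewrite add0n doubleK; apply: IH; last by lia.
by case: l last_l {le_f pos}.
Qed.

Lemma binaryK n : bits_val (binary n) = n.
Proof.
rewrite /bits_val /binary; case: eqP => [-> //|_].
by rewrite revK lsb_bitsK.
Qed.

(** A bit string with leading 1 is its own canonical binary notation, so gate names can be designed
    as bit strings and printed verbatim. *)
Lemma binary_bits_val l : binary (bits_val (true :: l)) = true :: l.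
Proof.
rewrite /binary /bits_val rev_cons.
have h : last true (rcons (rev l) true) by rewrite last_rcons.
have := lsb_valK h (leqnn _).
case: eqP => [-> | _ ->]; last by rewrite rev_rcons revK.
by case: (rev l).
Qed.

Lemma binary_inj : injective binary.
Proof. exact: can_inj binaryK. Qed.

Lemma binary_neq_nil n : binary n <> [::].
Proof.
rewrite /binary; case: eqP => // n0 /(congr1 (fun l => lsb_val (rev l))).
by rewrite revK lsb_bitsK.
Qed.

Definition isdig (s : sym) : bool := match s with S0 | S1 => true | _ => false end.

Lemma cat_dig_inj u u' s s' r r' : all isdig u -> all isdig u' ->
  ~~ isdig s -> ~~ isdig s' -> u ++ s :: r = u' ++ s' :: r' ->
  u = u' /\ s :: r = s' :: r'.
Proof.
elim: u u' => [|a u IH] [|a' u'] //=.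
- by move=> _ /andP[da _] ns _ [e]; rewrite e da in ns.
- by move=> /andP[da _] _ _ ns [e]; rewrite -e da in ns.
move=> /andP[_ du] /andP[_ du'] ns ns' [<- e].
by have [-> ->] := IH u' du du' ns ns' e.
Qed.

Lemma enc_num_dig n : all isdig (enc_num n).
Proof. by rewrite /enc_num all_map; apply/allP => -[]. Qed.

Lemma enc_num_inj : injective enc_num.
Proof.
move=> m n /inj_map e; apply: binary_inj; apply: e.
by case=> -[].
Qed.

Lemma enc_num_cat_inj m n s s' r r' : ~~ isdig s -> ~~ isdig s' ->
  enc_num m ++ s :: r = enc_num n ++ s' :: r' -> m = n /\ s :: r = s' :: r'.
Proof.
move=> ns ns' e.
by have [/enc_num_inj -> ->] := cat_dig_inj (enc_num_dig m) (enc_num_dig n) ns ns' e.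
Qed.

Lemma enc_num_head n : exists s r, enc_num n = s :: r /\ isdig s.
Proof.
have := enc_num_dig n; rewrite /enc_num.
case E: (binary n) => [|b l] /=; first by case: (binary_neq_nil E).
by case/andP => db _; do 2 eexists; split; first by [].
Qed.

Lemma sepby_cons a l : l <> [::] -> sepby (a :: l) = a ++ SComma :: sepby l.
Proof. by case: l. Qed.

Lemma sepby_rcat l r t : r <> [::] ->
  sepby (l ++ r) ++ t = flatten [seq a ++ [:: SComma] | a <- l] ++ sepby r ++ t.
Proof.
move=> r0; elim: l => [//|a l IH].
rewrite cat_cons sepby_cons; last by case: l {IH}.
by rewrite /= -!catA /= IH.
Qed.

(** The two hypotheses make the list parse uniquely: no item starts with the closing [SRpar], which
    separates the empty list from all others, and an item is determined as soon as a non-digit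
    follows it, as a comma or [SRpar] does. *)
Lemma sepby_cat_inj (T : Type) (enc : T -> seq sym) :
  (forall x, exists s r, enc x = s :: r /\ s <> SRpar) ->
  (forall x y s s' r r', ~~ isdig s -> ~~ isdig s' ->
     enc x ++ s :: r = enc y ++ s' :: r' -> x = y /\ s :: r = s' :: r') ->
  forall l l' r r', sepby (map enc l) ++ SRpar :: r = sepby (map enc l') ++ SRpar :: r' ->
  l = l' /\ r = r'.
Proof.
move=> enc_hd enc_inj; elim=> [|x l IH] [|y l'] r r'.
- by case.
- have [s [q [e ns]]] := enc_hd y.
  by case: l' => [|z l'] /=; rewrite e /= => -[] /esym.
- have [s [q [e ns]]] := enc_hd x.
  by case: l {IH} => [|z l] /=; rewrite e /= => -[].
case: l IH => [|x1 l] IH; case: l' => [|y1 l'].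
- by rewrite /= => /enc_inj [] // -> [->].
- by rewrite /= -catA cat_cons => /enc_inj [] // _ [].
- by rewrite /= -catA cat_cons => /enc_inj [] // _ [].
have sc z z1 k : sepby (map enc (z :: z1 :: k)) = enc z ++ SComma :: sepby (map enc (z1 :: k))
  by [].
rewrite !sc -!catA !cat_cons.
case/enc_inj => // -> []. move=> e; by have [-> ->] := IH (y1 :: l') _ _ e.
Qed.

Lemma enc_label_cat_inj l l' r r' :
  enc_label l ++ SComma :: r = enc_label l' ++ SComma :: r' -> l = l' /\ r = r'.
Proof.
case: l l' => [a|o] [a'|o'] /=.
- by case/enc_num_cat_inj => // -> [->].
- by have [s [q [-> ds]]] := enc_num_head a; move=> /= [e]; rewrite e in ds.
- by have [s [q [-> ds]]] := enc_num_head a'; move=> /= [e]; rewrite -e in ds.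
- by case=> -> ->.
Qed.

Lemma enc_gate_cat_inj g g' r r' :
  enc_gate g ++ r = enc_gate g' ++ r' -> g = g' /\ r = r'.
Proof.
case: g g' => [n l p] [n' l' p']; rewrite /enc_gate /=.
rewrite -!(catA, cat_cons) => -[].
case/enc_num_cat_inj => // -> [] /enc_label_cat_inj [->] [].
case/sepby_cat_inj => //.
- by move=> x; have [s [q [-> ds]]] := enc_num_head x; exists s, q; split => //; case: s ds.
- by move=> x y s s' t t'; apply: enc_num_cat_inj.
by move=> -> [->].
Qed.

(** Membership in [MC] only asserts that some circuit has the given code; injectivity turns it into
    a statement about the circuit that was printed. *)
Lemma enc_instance_inj C C' b b' :
  enc_instance C b = enc_instance C' b' -> C = C' /\ b = b'.
Proof.
case: C C' => [o gs] [o' gs']; rewrite /enc_instance /= => -[].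
case/enc_num_cat_inj => // -> [].
case/sepby_cat_inj => //.
- by move=> g; rewrite /enc_gate; do 2 eexists; split.
- by move=> g g' s s' r r' _ _; apply: enc_gate_cat_inj.
move=> -> [] e; have [] // := @enc_num_cat_inj b b' SRpar SRpar [::] [::] _ _ e.
Qed.

Lemma sym_code_cat_inj a a' r r' :
  sym_code a ++ r = sym_code a' ++ r' -> a = a' /\ r = r'.
Proof. by case: a => [|||||[]]; case: a' => [|||||[]] => [] [] *; split. Qed.

Lemma to_bits_inj : injective to_bits.
Proof.
elim=> [|a s IH] [|a' s'] //.
by case/sym_code_cat_inj => -> /IH ->.
Qed.

Lemma to_bits_cat s t : to_bits (s ++ t) = to_bits s ++ to_bits t.
Proof. by rewrite /to_bits map_cat flatten_cat. Qed.

(** * Layered division circuits *)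

(** [arity_ok] fixes the number of predecessors, so only genuine predecessors are looked up and
    never the [nth] defaults. *)
Lemma gate_val_preds O g (e e' : nat -> nat -> Prop) : arity_ok O g ->
  (forall p, p \in gpreds g -> forall x, e p x <-> e' p x) ->
  forall x, gate_val g e x <-> gate_val g e' x.
Proof.
rewrite /arity_ok /gate_val; case: (glab g) => [//|o] [_].
case: (gpreds g) => [|p [|q [|r l]]] sz eqe x.
1,4: by case: o sz.
  by case: o sz => // _ /=; rewrite eqe ?mem_head.
have Ep := eqe p (mem_head _ _).
have Eq : forall x, e q x <-> e' q x by apply: eqe; rewrite !inE eqxx orbT.
have E1 : forall x, e (minn p q) x <-> e' (minn p q) x by rewrite /minn; case: ifP.
have E2 : forall x, e (maxn p q) x <-> e' (maxn p q) x by rewrite /maxn; case: ifP.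
case: o sz => //= _; rewrite ?E1 ?E2 //.
- by split=> -[a [b [/E1 ? [/E2 ? ?]]]]; exists a, b.
- by split=> -[a [b [/E1 ? [/E2 ? ?]]]]; exists a, b.
- by split=> -[a [b [/E1 ? [/E2 ? ?]]]]; exists a, b.
Qed.

(** [gate_env] evaluates a gate among the later gates only. Predecessors come later and names are
    distinct, so no earlier gate shadows them, and the recursion becomes an equation over the whole
    list. *)
Lemma gate_env_in O gs g : valid_gates O gs -> List.In g gs ->
  forall x, gate_env gs (gname g) x <-> gate_val g (gate_env gs) x.
Proof.
elim: gs => [//|h gs IH] /= [nh [ph [ah vgs]]] ing x.
have later p : p \in map gname gs ->
    forall y, (if p == gname h then gate_val h (gate_env gs) else gate_env gs p) y
              <-> gate_env gs p y.
  by case: eqP => // -> pin; rewrite pin in nh.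
case: ing => [<-|ing].
  rewrite eqxx; apply: (gate_val_preds ah) => p pin y.
  by apply: iff_sym; apply: later; apply: (allP ph).
have [vg gin] : (arity_ok O g /\ {subset gpreds g <= map gname gs}) /\ gname g \in map gname gs.
  elim: gs vgs ing {IH nh ph later} => [//|k gs IHgs] /= [_ [pk [ak vk]]] [<-|/(IHgs vk)].
    by rewrite mem_head; split=> //; split=> // p /(allP pk); rewrite inE orbC => ->.
  case=> -[? sub] ?; split; last by rewrite inE orbC; apply/orP; left.
  by split=> // p /sub; rewrite inE orbC => ->.
rewrite (later _ gin) (IH vgs ing); case: vg => ag sub.
apply: (gate_val_preds ag) => p /sub pin y; apply: iff_sym; exact: later.
Qed.

Definition run_from (St : Type) (F : bool -> St -> St) (s : St) (bs : seq bool) : St :=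
  foldl (fun s b => F b s) s bs.

Section LayeredCircuit.
Variables (St Tm : eqType) (F : bool -> St -> St) (bad : pred St).
Variables (Sl : seq St) (nextT : Tm -> option Tm) (name : Tm -> St -> nat).

(** 0 and 1 are the names of the constant gates. At the last time stamp a good node becomes 1 / 1,
    that is {1}: the unrolling just stops there. *)
Definition layer_gate (t : Tm) (s : St) : gate :=
  Gate (name t s) (LOp ODiv)
    (if bad s then [:: 0; 0]
     else if nextT t is Some t' then [:: name t' (F true s); name t' (F false s)]
     else [:: 1; 1]).

Definition const_gates : seq gate := [:: Gate 0 (LIn 0) [::]; Gate 1 (LIn 1) [::]].

Definition layer_gates (Tl : seq Tm) : seq gate :=
  [seq layer_gate t s | t <- Tl, s <- Sl] ++ const_gates.

(** Enumerations are specified by a successor function, since this is all that a machine holding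
    only the current item can compute. *)
Definition chain (Tl : seq Tm) : bool :=
  if Tl is t :: p then path (fun a b => nextT a == Some b) t p && (nextT (last t p) == None)
  else false.

Hypothesis Sl_uniq : uniq Sl.
Hypothesis F_closed : forall b s, s \in Sl -> F b s \in Sl.

Definition name_inj (Tl : seq Tm) : Prop :=
  forall t t' s s', t \in Tl -> t' \in Tl -> s \in Sl -> s' \in Sl ->
    name t s = name t' s' -> t = t' /\ s = s'.
Definition name_gt1 (Tl : seq Tm) : Prop :=
  forall t s, t \in Tl -> s \in Sl -> 1 < name t s.

Let isdiv := (fun o => o = ODiv).

Lemma layer_names Tl : map gname (layer_gates Tl) = [seq name t s | t <- Tl, s <- Sl] ++ [:: 0; 1].
Proof. by rewrite map_cat map_allpairs. Qed.

(** Gates of one layer refer only to [rest], so the induction may run over any duplicate-free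
    sublist of [Sl]. *)
Lemma layer_valid t rest : valid_gates isdiv rest ->
  (forall s s', s \in Sl -> s' \in Sl -> name t s = name t s' -> s = s') ->
  0 \in map gname rest -> 1 \in map gname rest ->
  (forall t' b s, nextT t = Some t' -> s \in Sl -> name t' (F b s) \in map gname rest) ->
  (forall s, s \in Sl -> name t s \notin map gname rest) ->
  valid_gates isdiv (map (layer_gate t) Sl ++ rest).
Proof.
move=> vrest inj z1 z2 nx nin.
suff valid S' : uniq S' -> {subset S' <= Sl} ->
    valid_gates isdiv (map (layer_gate t) S' ++ rest) by exact: valid.
elim: S' => [//|s S' IHS] /andP[sS uS] sub /=.
have sSl : s \in Sl by apply: sub; rewrite mem_head.
have subS : {subset S' <= Sl} by move=> a aS; apply: sub; rewrite inE aS orbT.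
split; [|split; [|split; [|exact: IHS]]].
- rewrite map_cat mem_cat (negPf (nin _ sSl)) orbF -map_comp.
  apply/mapP => -[s' s'S] /= e.
  by move: sS; rewrite (inj _ _ sSl (subS _ s'S) e) s'S.
- rewrite map_cat; case: (bad s) => /=; first by rewrite !mem_cat z1 !orbT.
  case E: (nextT t) => [t1|] /=; last by rewrite !mem_cat z2 !orbT.
  by rewrite !mem_cat !(nx t1) ?orbT.
- by rewrite /arity_ok /=; split=> //; case: (bad s); case: (nextT t).
Qed.

Lemma layer_gates_valid Tl : chain Tl -> uniq Tl -> name_inj Tl -> name_gt1 Tl ->
  valid_gates isdiv (layer_gates Tl).
Proof.
case: Tl => [//|t p]; elim: p t => [|t' p IH] t ch un inj gt1.
- rewrite /layer_gates /= cats0; apply: layer_valid => //.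
  + by move=> s s' sS s'S e; have [] := inj t t s s' (mem_head _ _) (mem_head _ _) sS s'S e.
  + by move=> t' b s; case/andP: ch => _ /eqP ->.
  + by move=> s sS; have := gt1 t s (mem_head _ _) sS; rewrite /= !inE; case: (name t s) => [|[|]].
- have sub : {subset t' :: p <= [:: t, t' & p]} by move=> a; rewrite [in X in _ -> X]inE orbC => ->.
  rewrite /layer_gates allpairs_cons -catA -/(layer_gates (t' :: p)); apply: layer_valid.
  + move: ch => /= /andP[/andP[_ ch] lst]; move: un => /= /andP[_ un].
    apply: (IH t') => //; first by rewrite /= ch lst.
      by move=> a a' s s' aT a'T sS s'S; apply: (inj _ _ _ _ (sub _ aT) (sub _ a'T) sS s'S).
    by move=> a s aT; apply: (gt1 _ _ (sub _ aT)).
  + by move=> s s' sS s'S e; have [] := inj t t s s' (mem_head _ _) (mem_head _ _) sS s'S e.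
  + by rewrite layer_names mem_cat !inE !orbT.
  + by rewrite layer_names mem_cat !inE !orbT.
  + move=> t1 b s; move: ch => /= /andP[/andP[/eqP -> _] _] [<-] sS.
    rewrite layer_names mem_cat; apply/orP; left.
    by apply: allpairs_f; rewrite ?mem_head ?F_closed.
  + move=> s sS; rewrite layer_names mem_cat negb_or; apply/andP; split; last first.
      by have := gt1 t s (mem_head _ _) sS; rewrite /= !inE; case: (name t s) => [|[|]].
    apply/allpairsP => -[[a s'] /= [aT s'S e]].
    have [ea _] := inj t a s s' (mem_head _ _) (sub _ aT) sS s'S e.
    by move: un; rewrite ea /= -/(a \in t' :: p) aT.
Qed.

Lemma In_layer_gates Tl t s : t \in Tl -> s \in Sl -> List.In (layer_gate t s) (layer_gates Tl).
Proof.
rewrite /layer_gates => tT sS; apply/List.in_or_app; left.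
have inmap (A : eqType) (B : Type) (f : A -> B) (l : seq A) a : a \in l -> List.In (f a) (map f l).
  elim: l => [//|c l IH]; rewrite inE => /orP[/eqP -> | /IH]; by [left | right].
elim: Tl tT => [//|t1 Tl IH]; rewrite inE => /orP[/eqP <-|/IH h] /=; apply/List.in_or_app.
  by left; apply: inmap.
by right.
Qed.

(** A good gate divides the values of its two successors, giving {1} if both are {1} and the empty
    set otherwise. Each layer thus adds one bit to the runs that must avoid bad nodes. *)
Lemma layer_gates_val Tl : chain Tl -> uniq Tl -> name_inj Tl -> name_gt1 Tl ->
  forall t0 p, Tl = t0 :: p -> forall s, s \in Sl -> forall x,
  gate_env (layer_gates Tl) (name t0 s) x <->
  x = 1 /\ forall bs, size bs <= size p -> ~~ bad (run_from F s bs).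
Proof.
move=> ch un inj gt1 t0 p0 eTl.
have val := layer_gates_valid ch un inj gt1.
set e := gate_env _.
have e0 x : e 0 x <-> x = 0.
  rewrite /e (@gate_env_in isdiv _ (Gate 0 (LIn 0) [::])) //.
  by apply/List.in_or_app; right; left.
have e1 x : e 1 x <-> x = 1.
  rewrite /e (@gate_env_in isdiv _ (Gate 1 (LIn 1) [::])) //.
  by apply/List.in_or_app; right; right; left.
suff main : forall p t, {subset t :: p <= Tl} -> chain (t :: p) ->
    forall s, s \in Sl -> forall x, e (name t s) x <->
    x = 1 /\ forall bs, size bs <= size p -> ~~ bad (run_from F s bs).
  by move=> s sS x; apply: main => //; rewrite -eTl.
elim=> [|t' p IH] t sub cht s sS x.
all: have tT : t \in Tl by apply: sub; rewrite mem_head.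
all: rewrite /e (gate_env_in val (In_layer_gates tT sS)) -/e /gate_val /=.
all: case bs: (bad s) => /=.
- split; last by case=> _ /(_ [::] isT); rewrite /= bs.
  by case=> a [b [_ [/e0 ->]]] [].
- move: cht => /= /eqP ->; rewrite /= /minn /maxn ltnn; split.
    case=> a [b [/e1 -> [/e1 ->]]]; rewrite muln1 => -[_ ->]; split=> //.
    by case=> //; rewrite bs.
  by case=> -> _; exists 1, 1; rewrite !e1.
- split; last by case=> _ /(_ [::] isT); rewrite /= bs.
  by case=> a [b [_ [/e0 ->]]] [].
move: cht => /= /andP[/andP[/eqP -> cht] lst] /=.
have sub' : {subset t' :: p <= Tl} by move=> a aT; apply: sub; rewrite inE aT orbT.
have IHt b y : e (name t' (F b s)) y <->
    y = 1 /\ forall bs, size bs <= size p -> ~~ bad (run_from F (F b s) bs).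
  by apply: IH => //; [rewrite /= cht lst | exact: F_closed].
(* The operands are ordered by gate name and not by the guessed bit; as both are subsets of {1}, the
   order does not affect the quotient. *)
have -> : (exists a b, e (minn (name t' (F true s)) (name t' (F false s))) a /\
    e (maxn (name t' (F true s)) (name t' (F false s))) b /\ b <> 0 /\ a = x * b) <->
   (exists a b, e (name t' (F true s)) a /\
    e (name t' (F false s)) b /\ b <> 0 /\ a = x * b).
  rewrite /minn /maxn; case: ifP => _ //.
  by split=> -[a [b [/IHt[-> ?] [/IHt[-> ?] [_ ?]]]]]; exists 1, 1; do 2 (split; first exact/IHt).
split.
  case=> a [b [/IHt[-> ha] [/IHt[-> hb]]]]; rewrite muln1 => -[_ ->]; split=> //.
  by case=> [_|[] l sz]; [rewrite /= bs | apply: ha | apply: hb].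
case=> -> h; exists 1, 1; do 2 (split; first by apply/IHt; split=> // l sz; apply: (h (_ :: l))).
by [].
Qed.

End LayeredCircuit.

(** Cycles can be cut out of a run; without repetition it visits at most [size Sl] states, hence
    makes fewer steps. *)
Lemma run_from_short (St : eqType) (F : bool -> St -> St) (Sl : seq St) s bs :
  (forall b s, s \in Sl -> F b s \in Sl) -> s \in Sl ->
  exists bs', run_from F s bs' = run_from F s bs /\ size bs' < size Sl.
Proof.
move=> cl sS.
pose e a b := (b == F true a) || (b == F false a).
have pth : exists p, path e s p /\ last s p = run_from F s bs.
  elim: bs s {sS} => [|b bs IH] s /=; first by exists [::].
  have [p [pp lp]] := IH (F b s); exists (F b s :: p); rewrite /= pp lp; split=> //.
  by rewrite /e; case: b {pp lp}; rewrite eqxx ?orbT.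
case: pth => p [pp <-]; case/shortenP: pp => p' pp' up' _.
have sub : {subset s :: p' <= Sl}.
  elim: p' s sS pp' {up'} => [|a p' IH] s sS /=; first by move=> _ x; rewrite inE => /eqP ->.
  case/andP=> ea pa x; rewrite inE => /orP[/eqP -> //|]; apply: IH => //.
  by case/orP: ea => /eqP ->; apply: cl.
have := uniq_leq_size up' sub; move=> /= sz.
suff [bs' [e1 e2]] : exists bs', run_from F s bs' = last s p' /\ size bs' = size p'.
  by exists bs'; rewrite e2.
elim: p' s pp' {sS up' sub sz} => [|a p' IH] s /=; first by exists [::].
case/andP=> ea /IH[bs' [e1 e2]].
by case/orP: ea => /eqP ea; [exists (true :: bs') | exists (false :: bs')]; rewrite /= -ea e2.
Qed.

(** * Inductive counting *)

Inductive instr :=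
  | Fork of nat & nat
  | IfEq of nat & nat & nat & nat
  | Inc of nat & nat
  | Move of (nat -> nat) & nat
  | Step of bool & nat
  | Stuck.

(* [i] is the current level and [c] its cardinality; [d] counts the vertices below [v] found in
   level [i+1]; to refute membership of [v], [u] runs through the vertices and [e] counts those
   certified to be in level [i]; a certificate is a guessed walk of [j] steps ending in [w]. *)
Definition rg_i := 0. Definition rg_c := 1. Definition rg_d := 2. Definition rg_v := 3.
Definition rg_u := 4. Definition rg_e := 5. Definition rg_j := 6. Definition rg_w := 7.
Definition rg_0 := 8. Definition rg_max := 9.
Definition nregs := 10.

(** Pairs are (target, source), and all sources are read in the old state: this lets label 20
    perform c := d and d := 0 at once. *)
Definition par_move (l : seq (nat * nat)) (r : nat) : nat :=
  foldr (fun p s => if r == p.1 then p.2 else s) r l.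

Definition lab_bad := 36.
Definition lab_stuck := 37.
Definition nlabs := 38.

(* Line 1 guesses whether [v] is in level [i+1].  If so, lines 2-8 guess a walk of [i+1] steps to
   [v].  Otherwise lines 10-18 and 26-32 visit every [u], guess whether it is in level [i], and if
   so guess a walk of [i] steps to [u] and check that neither successor of [u] is [v]; line 19
   checks that no member of level [i] was skipped. *)
Definition prog (l : nat) : instr :=
  match l with
  | 0 => Inc rg_c 1
  | 1 => Fork 2 9
  | 2 => Move (par_move [:: (rg_w, rg_0); (rg_j, rg_0)]) 3
  | 3 => Fork 4 5
  | 4 => Step true 6
  | 5 => Step false 6
  | 6 => IfEq rg_j rg_i 8 7
  | 7 => Inc rg_j 3
  | 8 => IfEq rg_w rg_v 22 lab_stuck
  | 22 => Inc rg_d 23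
  | 23 => IfEq rg_v rg_max 24 21
  | 24 => IfEq rg_i rg_max lab_stuck 20
  | 9 => Move (par_move [:: (rg_u, rg_0); (rg_e, rg_0)]) 10
  | 10 => Fork 11 18
  | 11 => Move (par_move [:: (rg_w, rg_0); (rg_j, rg_0)]) 12
  | 12 => IfEq rg_j rg_i 14 13
  | 13 => Fork 26 27
  | 26 => Step true 28
  | 27 => Step false 28
  | 28 => Inc rg_j 12
  | 14 => IfEq rg_w rg_u 15 lab_stuck
  | 15 => Inc rg_e 16
  | 16 => Step true 17
  | 17 => IfEq rg_w rg_v lab_stuck 29
  | 29 => Move (par_move [:: (rg_w, rg_u)]) 30
  | 30 => Step false 31
  | 31 => IfEq rg_w rg_v lab_stuck 18
  | 18 => IfEq rg_u rg_max 19 32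
  | 32 => Inc rg_u 10
  | 19 => IfEq rg_e rg_c 33 lab_stuck
  | 33 => IfEq rg_v rg_max 34 21
  | 34 => IfEq rg_i rg_max lab_bad 20
  | 21 => Inc rg_v 1
  | 20 => Move (par_move [:: (rg_c, rg_d); (rg_d, rg_0); (rg_v, rg_0)]) 35
  | 35 => Inc rg_i 1
  | _ => Stuck
  end.

Section InductiveCounting.
Variables (P : nat) (f : bool -> nat -> nat).
Hypothesis P_gt1 : 1 < P.
Hypothesis f_lt : forall b v, v < P -> f b v < P.
Hypothesis f_max : forall b, f b P.-1 = P.-1.

Definition rstate := (nat * (nat -> nat))%type.

Definition set_reg (rho : nat -> nat) r a := fun s => if s == r then a else rho s.

Definition rexec (b : bool) (s : rstate) : rstate :=
  let: (l, rho) := s in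
  match prog l with
  | Fork l1 l2 => (if b then l1 else l2, rho)
  | IfEq r1 r2 l1 l2 => (if rho r1 == rho r2 then l1 else l2, rho)
  | Inc r l' => (l', set_reg rho r ((rho r).+1 %% P))
  | Move g l' => (l', fun r => rho (g r))
  | Step b' l' => (l', set_reg rho rg_w (f b' (rho rg_w)))
  | Stuck => s
  end.

(** Exactly [k] steps, not at most [k]: as P-1 is absorbing by [f_max], it is reachable iff it lies
    in level P. *)
Fixpoint level (k : nat) (v : nat) : bool :=
  if k is k'.+1 then
    has (fun u => level k' u && ((f true u == v) || (f false u == v))) (iota 0 P)
  else v == 0.

Lemma levelS k v : level k.+1 v =
  has (fun u => level k u && ((f true u == v) || (f false u == v))) (iota 0 P).
Proof. by []. Qed.

Hypothesis level0 : forall k, ~~ level k.+1 0.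

Definition cnt k u := count (level k) (iota 0 u).
Definition avoiding i v x := [&& level i x, f true x != v & f false x != v].
Definition cnt_avoiding i v u := count (avoiding i v) (iota 0 u).

Lemma level_lt k v : level k v -> v < P.
Proof.
case: k => [/eqP -> |k /hasP[u]]; first by lia.
by rewrite mem_iota /= => uP /andP[_ /orP[] /eqP <-]; apply: f_lt.
Qed.

Lemma level_step k b w : level k w -> level k.+1 (f b w).
Proof.
move=> lw; rewrite levelS; apply/hasP; exists w; first by rewrite mem_iota (level_lt lw).
by rewrite lw; case: b; rewrite eqxx ?orbT.
Qed.

Lemma iotaS_last p n : iota p n.+1 = rcons (iota p n) (p + n).
Proof. by rewrite -addn1 iotaD cats1. Qed.

Lemma cntS k u : cnt k u.+1 = cnt k u + level k u.
Proof. by rewrite /cnt iotaS_last -cats1 count_cat /= addn0. Qed.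

(** Each level misses some vertex: level 0 is {0}, and later levels omit 0 by [level0]. Hence
    cardinalities fit into registers that count modulo P. *)
Lemma cnt_lt k u : u <= P -> cnt k u < P.
Proof.
move=> uP; case: k => [|k].
  have c0 m : cnt 0 m <= (0 < m) by elim: m => [|m]; rewrite // cntS /=; case: m => //; lia.
  by have := c0 u; lia.
have c1 m : cnt k.+1 m <= m.-1.
  by elim: m => [|m IH] //; rewrite cntS; case: m IH => [|m] IH; rewrite ?(negPf (level0 k)) //;
     have := leq_b1 (level k.+1 m.+1); move: IH; rewrite /cnt /=; lia.
by have := c1 u; lia.
Qed.

Lemma cnt0P : cnt 0 P = 1.
Proof.
rewrite /cnt; case: P P_gt1 => // p _ /=.
by rewrite (@eq_in_count _ _ pred0) ?count_pred0 // => x; rewrite mem_iota /=; case: x.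
Qed.

Arguments level : simpl never.

(** Holds on every run, whatever is guessed. [c] and [d] are exact from label 1 on, because either
    guess about [v] must be certified before [v] advances. [e] is only bounded above: a run may omit
    members of level i, but each one it keeps has been checked to have no edge to [v]. In [U1] the
    vertex [u] is already counted while its successors are still being checked. *)
Definition counting_inv (l : nat) (rho : nat -> nat) : Prop :=
  let i := rho rg_i in let c := rho rg_c in let d := rho rg_d in let v := rho rg_v in
  let u := rho rg_u in let e := rho rg_e in let j := rho rg_j in let w := rho rg_w in
  let cavoid m := cnt_avoiding i v m in
  let base := [/\ i < P, c = cnt i P & v < P] in
  let V := base /\ d = cnt i.+1 v in
  let V' := base /\ d = cnt i.+1 v.+1 in
  let U := [/\ V, u < P & e <= cavoid u] in
  let U1 := [/\ V, u < P, e <= (cavoid u).+1 & level i u] in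
  [/\ rho rg_0 = 0, rho rg_max = P.-1 &
  match l with
  | 0 => [/\ i = 0, c = 0, d = 0 & v = 0]
  | 1 | 2 | 9 => V
  | 3 | 4 | 5 => [/\ V, j <= i & level j w]
  | 6 => [/\ V, j <= i & level j.+1 w]
  | 7 => [/\ V, j < i & level j.+1 w]
  | 8 => [/\ V & level i.+1 w]
  | 22 => V /\ level i.+1 v
  | 23 => V'
  | 24 => V' /\ v = P.-1
  | 21 => V' /\ v < P.-1
  | 20 => [/\ V', v = P.-1 & i < P.-1]
  | 10 | 11 => U
  | 12 => [/\ U, j <= i & level j w]
  | 13 | 26 | 27 => [/\ U, j < i & level j w]
  | 28 => [/\ U, j < i & level j.+1 w]
  | 14 => U /\ level i w
  | 15 => [/\ U, level i u & w = u]
  | 16 => U1 /\ w = u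
  | 17 => U1 /\ w = f true u
  | 29 => U1 /\ f true u != v
  | 30 => [/\ U1, f true u != v & w = u]
  | 31 => [/\ U1, f true u != v & w = f false u]
  | 18 => [/\ V, u < P & e <= cavoid u.+1]
  | 32 => [/\ V, u < P.-1 & e <= cavoid u.+1]
  | 19 => V /\ e <= cavoid P
  | 33 => V /\ ~~ level i.+1 v
  | 34 => [/\ V, ~~ level i.+1 v & v = P.-1]
  | 35 => [/\ i < P.-1, c = cnt i.+1 P, d = 0 & v = 0]
  | 36 => ~~ level P P.-1
  | _ => True
  end].

Lemma count_avoidS i v u :
  cnt_avoiding i v u.+1 = cnt_avoiding i v u + avoiding i v u.
Proof. by rewrite /cnt_avoiding iotaS_last -cats1 count_cat /= addn0. Qed.

(* Counting only vertices of level [i] without an edge to [v] already reaches |level i|, so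
   no vertex of level [i] has an edge to [v]. *)
Lemma count_avoid_full i v : cnt i P <= cnt_avoiding i v P -> ~~ level i.+1 v.
Proof.
move=> le_c; rewrite levelS; apply/hasPn => u; rewrite mem_iota /= add0n => uP.
apply/negP => /andP[lu ev].
have : cnt i P = cnt_avoiding i v P
     + count (fun x => level i x && ~~ avoiding i v x) (iota 0 P).
  rewrite /cnt /cnt_avoiding; elim: (iota 0 P) => //= x s ->.
  by rewrite /avoiding; case: (level i x) => //=; case: (_ && _); lia.
have : 0 < count (fun x => level i x && ~~ avoiding i v x) (iota 0 P).
  rewrite -has_count; apply/hasP; exists u; first by rewrite mem_iota.
  by rewrite /avoiding lu /= negb_and !negbK.
lia.
Qed.

Lemma counting_inv_step b l rho :
  counting_inv l rho -> let: (l', rho') := rexec b (l, rho) in counting_inv l' rho'.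
Proof.
do 38 (try (case: l => [|l])); try by case: b.
all: rewrite /counting_inv /rexec /= /set_reg /=.
all: rewrite /rg_i /rg_c /rg_d /rg_v /rg_u /rg_e /rg_j /rg_w /rg_0 /rg_max /=.
all: move=> [r0 rmax]; rewrite ?r0 ?rmax.
all: try match goal with
  | |- context [if ?x == ?y then _ else _] => case: (x =P y) => eqr /=
  | b : bool |- context [if ?b then _ else _] => case: b => /=
  end.
all: move=> H; repeat match goal with
  | H : and _ _ |- _ => destruct H
  | H : and3 _ _ _ |- _ => destruct H
  | H : and4 _ _ _ _ |- _ => destruct H
  end.
all: repeat split; try done; try lia.
all: try (rewrite modn_small; lia).
all: try exact: level_step.
all: try by congruence.
- by replace (rho 0) with 0 by lia; replace (rho 1) with 0 by lia; rewrite cnt0P modn_small.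
- by replace (rho 3) with 0 by lia; rewrite /cnt /=; lia.
- by rewrite count_avoidS; lia.
(* The increment of [e] is modulo P; a wrap-around only lowers [e], which the upper bound
   tolerates. *)
- by apply: leq_trans (leq_mod _ _) _.
- by replace P with (rho 4).+1 by lia.
- by apply: count_avoid_full; lia.
- by replace P with (rho 3).+1 by lia.
- have lv : level (rho 0).+1 (rho 3) by [].
  have := @cnt_lt (rho 0).+1 (rho 3).+1; rewrite cntS lv => cl.
  by rewrite modn_small; lia.
- rewrite count_avoidS; suff -> : avoiding (rho 0) (rho 3) (rho 4) by lia.
  by apply/and3P; split=> //; apply/eqP; congruence.
- have lv : ~~ level (rho 0).+1 (rho 3) by [].
  by rewrite cntS (negPf lv) addn0.
(* Exit to [lab_bad]: here i = v = P-1, so the certified absence of [v] from level i+1 is the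
   claim. *)
- have lv : ~~ level (rho 0).+1 (rho 3) by [].
  by replace P with (rho 0).+1 by lia; replace (rho 0) with (rho 3) in lv |- * by lia.
- have lv : ~~ level (rho 0).+1 (rho 3) by [].
  by rewrite cntS (negPf lv) addn0.
- by replace (rho 3) with 0 by lia; rewrite /cnt /=; lia.
Qed.

Lemma counting_sound rho bs :
  counting_inv 0 rho -> (run_from rexec (0, rho) bs).1 = lab_bad -> ~~ level P P.-1.
Proof.
move=> inv0.
have : counting_inv (run_from rexec (0, rho) bs).1 (run_from rexec (0, rho) bs).2.
  elim/last_ind: bs => [//|bs b IH].
  rewrite /run_from foldl_rcons -/(run_from rexec (0, rho) bs).
  case: (run_from _ _ _) IH => l r /(counting_inv_step b).
  by case: (rexec b (l, r)).
by case: (run_from _ _ _) => l r /= inv e; move: inv; rewrite e; case.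
Qed.

(** * Completeness of the counting: honest guesses reach the bad label *)

Definition leads (s s' : rstate) : Prop := exists bs, run_from rexec s bs = s'.

Lemma leads_refl s : leads s s.
Proof. by exists [::]. Qed.

Lemma leads_trans s1 s2 s3 : leads s1 s2 -> leads s2 s3 -> leads s1 s3.
Proof. by case=> b1 <- [b2 <-]; exists (b1 ++ b2); rewrite /run_from foldl_cat. Qed.

Lemma leads_step b s s' : leads (rexec b s) s' -> leads s s'.
Proof. by case=> bs <-; exists (b :: bs). Qed.

Lemma levelP k v : level k v <->
  exists bs, size bs = k /\ foldl (fun w b => f b w) 0 bs = v.
Proof.
split.
  elim: k v => [|k IH] v; first by move/eqP ->; exists [::].
  rewrite levelS => /hasP[u _ /andP[/IH[bs [sz e]]]].
  case/orP=> /eqP <-; [exists (rcons bs true) | exists (rcons bs false)];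
  by rewrite size_rcons sz foldl_rcons e.
case=> bs [<- <-]; elim/last_ind: bs => [//|bs b IH].
by rewrite size_rcons foldl_rcons; apply: level_step.
Qed.

Definition frame (rs : seq nat) (rho rho' : nat -> nat) : Prop :=
  forall r, r \notin rs -> rho' r = rho r.

(** At label 3 a step is taken before the test j = i, so the loop makes i + 1 - j steps; at label 12
    the test comes first and the loop makes i - j. *)
Lemma lead_yes_walk bs rho : rho rg_i < P -> size bs = (rho rg_i - rho rg_j).+1 ->
  rho rg_j <= rho rg_i -> foldl (fun w b => f b w) (rho rg_w) bs = rho rg_v ->
  exists rho', leads (3, rho) (22, rho') /\ frame [:: rg_j; rg_w] rho rho'.
Proof.
elim: bs rho => [//|b bs IH] rho iP /= sz ji e.
have [eji|nji] := eqVneq (rho rg_j) (rho rg_i).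
  move: sz; rewrite eji subnn; case: bs e {IH} => // /= e _.
  exists (set_reg rho rg_w (f b (rho rg_w))); split; last first.
    by move=> r; rewrite !inE negb_or /set_reg => /andP[_ /negPf ->].
  apply: (@leads_step b) => /=.
  case: b e => e; apply: (@leads_step true); rewrite /= -/rexec;
  apply: (@leads_step true); rewrite /= /set_reg /= eji eqxx;
  apply: (@leads_step true); rewrite /= -e eqxx; exact: leads_refl.
set rho1 := set_reg (set_reg rho rg_w (f b (rho rg_w))) rg_j (rho rg_j).+1.
have [||||rho' [l1 fr]] := IH rho1.
- by [].
- by rewrite /rho1 /set_reg /=; lia.
- by rewrite /rho1 /set_reg /=; lia.
- by rewrite /rho1 /set_reg /=.
exists rho'; split; last first.
  move=> r nr; rewrite fr // /rho1 /set_reg.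
  by move: nr; rewrite !inE negb_or => /andP[/negPf -> /negPf ->].
apply: (@leads_step b) => /=.
case: b {e} @rho1 l1 fr => rho1 l1 fr; apply: (@leads_step true); rewrite /= -/rexec;
  apply: (@leads_step true); rewrite /= /set_reg /= (negPf nji);
  apply: (@leads_step true); rewrite /= /set_reg /= modn_small //; lia.
Qed.
Lemma lead_no_walk bs rho : rho rg_i < P -> size bs = rho rg_i - rho rg_j ->
  rho rg_j <= rho rg_i ->
  exists rho', [/\ leads (12, rho) (14, rho'), frame [:: rg_j; rg_w] rho rho' &
    rho' rg_w = foldl (fun w b => f b w) (rho rg_w) bs].
Proof.
elim: bs rho => [|b bs IH] rho iP /= sz ji.
  exists rho; split=> //; apply: (@leads_step true) => /=.
  by have -> : (rho rg_j == rho rg_i) by [lia]; exact: leads_refl.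
set rho1 := set_reg (set_reg rho rg_w (f b (rho rg_w))) rg_j (rho rg_j).+1.
have [|||rho' [l1 fr e]] := IH rho1.
- by [].
- by rewrite /rho1 /set_reg /=; lia.
- by rewrite /rho1 /set_reg /=; lia.
exists rho'; split.
- apply: (@leads_step true) => /=.
  have -> : (rho rg_j == rho rg_i) = false by lia.
  apply: (@leads_step b) => /=.
  case: b @rho1 l1 {fr e} => rho1 l1; apply: (@leads_step true); rewrite /= -/rexec;
  by apply: (@leads_step true); rewrite /= /set_reg /= modn_small //; lia.
- move=> r nr; rewrite fr // /rho1 /set_reg.
  by move: nr; rewrite !inE negb_or => /andP[/negPf -> /negPf ->].
- by rewrite e /rho1 /set_reg.
Qed.

(** Honest guessing counts [u] iff it lies in level i. The checks at labels 17 and 31 then succeed,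
    since a successor equal to [v] would put [v] into level i+1. So [e] grows to the full
    cardinality and passes the test at label 19. *)
Lemma lead_no_vertex rho : rho rg_i < P -> rho rg_u < P -> rho rg_0 = 0 ->
  ~~ level (rho rg_i).+1 (rho rg_v) -> rho rg_e = cnt (rho rg_i) (rho rg_u) ->
  exists rho', [/\ leads (10, rho) (18, rho'),
    frame [:: rg_j; rg_w; rg_e] rho rho' & rho' rg_e = cnt (rho rg_i) (rho rg_u).+1].
Proof.
move=> iP uP e0 nl ee.
have [lu|lu] := boolP (level (rho rg_i) (rho rg_u)); last first.
  exists rho; split=> //; first by apply: (@leads_step false); exact: leads_refl.
  by rewrite cntS (negPf lu) addn0.
have [bs [sz ew]] := (levelP _ _).1 lu.
pose rho1 := fun r => rho (par_move [:: (rg_w, rg_0); (rg_j, rg_0)] r).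
have [|||rho2 [l2 fr2 ew2]] := @lead_no_walk bs rho1; rewrite /rho1 /= ?e0 ?subn0 //.
have g r : r \notin [:: rg_j; rg_w] -> rho2 r = rho r.
  move=> nr; rewrite fr2 // /rho1 /=.
  by move: nr; rewrite !inE negb_or => /andP[/negPf -> /negPf ->].
have {}ew2 : rho2 rg_w = rho rg_u by rewrite ew2 /rho1 /= e0.
pose rho3 := set_reg rho2 rg_e (cnt (rho rg_i) (rho rg_u).+1).
pose rho4 := set_reg rho3 rg_w (f true (rho rg_u)).
pose rho5 := fun r => rho4 (par_move [:: (rg_w, rg_u)] r).
pose rho6 := set_reg rho5 rg_w (f false (rho rg_u)).
have nav b : (f b (rho rg_u) == rho rg_v) = false.
  by apply: contraNF nl => /eqP <-; apply: level_step.
have w4 : rho4 rg_w = f true (rho rg_u) by [].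
have v4 : rho4 rg_v = rho rg_v by rewrite /rho4 /rho3 /set_reg /= g.
have w5 : rho5 rg_w = rho rg_u by rewrite /rho5 /rho4 /rho3 /set_reg /= g.
have w6 : rho6 rg_w = f false (rho rg_u) by [].
have v6 : rho6 rg_v = rho rg_v by rewrite /rho6 /rho5 /rho4 /rho3 /set_reg /= g.
exists rho6; split; last by [].
- apply: (@leads_step true); rewrite /= -/rexec; apply: (@leads_step true); rewrite /= -/rexec.
  apply: (leads_trans l2); apply: (@leads_step true); rewrite /= ew2 g // eqxx.
  apply: (@leads_step true); rewrite /= g // ee.
  have ec : (cnt (rho rg_i) (rho rg_u)).+1 %% P = cnt (rho rg_i) (rho rg_u).+1.
    by rewrite cntS lu addn1 modn_small // -addn1; have := cnt_lt (rho rg_i) uP; rewrite cntS lu.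
  rewrite ec; apply: (@leads_step true); rewrite /= -/rho3.
  rewrite {2}/rho3 /set_reg /= ew2 -/(set_reg rho3 rg_w (f true (rho rg_u))) -/rho4.
  apply: (@leads_step true); rewrite /= w4 v4 nav.
  apply: (@leads_step true); rewrite /= -/rho5.
  apply: (@leads_step true); rewrite /= w5 -/(set_reg rho5 rg_w (f false (rho rg_u))) -/rho6.
  apply: (@leads_step true); rewrite /= w6 v6 nav.
  exact: leads_refl.
- move=> r; rewrite !inE !negb_or => /and3P[/negPf h1 /negPf h2 /negPf h3].
  by rewrite /rho6 /rho5 /rho4 /rho3 /set_reg /= h2 h2 h3 g // !inE h1 h2.
Qed.

Lemma lead_no_loop m rho : rho rg_i < P -> rho rg_c = cnt (rho rg_i) P ->
  rho rg_0 = 0 -> rho rg_max = P.-1 -> ~~ level (rho rg_i).+1 (rho rg_v) ->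
  rho rg_u + m = P.-1 -> rho rg_e = cnt (rho rg_i) (rho rg_u) ->
  exists rho', leads (10, rho) (33, rho') /\ frame [:: rg_j; rg_w; rg_u; rg_e] rho rho'.
Proof.
elim: m rho => [|m IH] rho iP ec e0 emax nl eu ee.
all: have uP : rho rg_u < P by lia.
all: have [rho1 [l1 fr1 e1]] := lead_no_vertex iP uP e0 nl ee.
  exists rho1; split; last first.
    move=> r; rewrite !inE !negb_or => /and4P[h1 h2 _ h3].
    by apply: fr1; rewrite !inE !negb_or h1 h2.
  apply: (leads_trans l1); apply: (@leads_step true); rewrite /= !fr1 // emax -eu addn0 eqxx.
  apply: (@leads_step true); rewrite /= e1 fr1 // ec.
  have -> : (rho rg_u).+1 = P by lia.
  by rewrite eqxx; exact: leads_refl.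
pose rho2 := set_reg rho1 rg_u (rho rg_u).+1.
have g r : r \notin [:: rg_j; rg_w; rg_u; rg_e] -> rho2 r = rho r.
  rewrite /rho2 /set_reg !inE !negb_or => /and4P[h1 h2 /negPf -> h3].
  by apply: fr1; rewrite !inE !negb_or h1 h2.
have [|||||||rho3 [l3 fr3]] := IH rho2; rewrite ?(g rg_i, g rg_c, g rg_0, g rg_max, g rg_v) //.
- by rewrite /rho2 /set_reg /=; lia.
- exists rho3; split; last by move=> r nr; rewrite fr3 // g.
apply: (leads_trans l1); apply: (@leads_step true); rewrite /= !fr1 //.
have -> : (rho rg_u == rho rg_max) = false by lia.
apply: (@leads_step true); rewrite /= fr1 // modn_small //; lia.
Qed.
Definition outer_spec i v (rho : nat -> nat) : Prop :=
  [/\ rho rg_i = i, rho rg_c = cnt i P, rho rg_d = cnt i.+1 v, rho rg_v = v &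
      rho rg_0 = 0 /\ rho rg_max = P.-1].

Lemma lead_no rho i v : i < P -> v < P -> ~~ level i.+1 v -> outer_spec i v rho ->
  exists rho', leads (1, rho) (33, rho') /\ outer_spec i v rho'.
Proof.
move=> iP vP nl [ei ec ed ev [e0 em]].
pose rho1 := fun r => rho (par_move [:: (rg_u, rg_0); (rg_e, rg_0)] r).
have [|||||||rho2 [l2 fr2]] := @lead_no_loop P.-1 rho1; rewrite /rho1 /= ?ei ?ev ?e0 ?em //.
exists rho2; split; last by split; rewrite ?fr2.
apply: (@leads_step false); rewrite /= -/rexec; apply: (@leads_step true); exact: l2.
Qed.

Lemma lead_yes rho i v : i < P -> v < P -> level i.+1 v -> outer_spec i v rho ->
  exists rho', leads (1, rho) (23, rho') /\
    [/\ rho' rg_i = i, rho' rg_c = cnt i P, rho' rg_d = cnt i.+1 v.+1, rho' rg_v = v &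
      rho' rg_0 = 0 /\ rho' rg_max = P.-1].
Proof.
move=> iP vP lv [ei ec ed ev [e0 em]].
have [bs [sz ew]] := (levelP _ _).1 lv.
pose rho1 := fun r => rho (par_move [:: (rg_w, rg_0); (rg_j, rg_0)] r).
have [||||rho2 [l2 fr2]] := @lead_yes_walk bs rho1; rewrite /rho1 /= ?ei ?e0 ?subn0 ?ev //.
have el : (cnt i.+1 v).+1 %% P = cnt i.+1 v.+1.
  by rewrite cntS lv addn1 modn_small // -addn1; have := cnt_lt i.+1 vP; rewrite cntS lv.
exists (set_reg rho2 rg_d (cnt i.+1 v.+1)); split.
  apply: (@leads_step true); rewrite /= -/rexec; apply: (@leads_step true); rewrite /= -/rexec.
  apply: (leads_trans l2); apply: (@leads_step true); rewrite /= fr2 // /rho1 /= ed el.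
  exact: leads_refl.
by rewrite /set_reg; split; rewrite /= ?fr2.
Qed.

Lemma lead_vertex rho i v : i < P -> v < P.-1 -> outer_spec i v rho ->
  exists rho', leads (1, rho) (1, rho') /\ outer_spec i v.+1 rho'.
Proof.
move=> iP vP sp.
have [lv|lv] := boolP (level i.+1 v).
  have [|rho1 [l1 [ei ec ed ev [e0 em]]]] := lead_yes iP _ lv sp; first by lia.
  exists (set_reg rho1 rg_v v.+1); split; last by split.
  apply: (leads_trans l1); apply: (@leads_step true); rewrite /= ev em.
  have -> : (v == P.-1) = false by lia.
  apply: (@leads_step true); rewrite /= ev modn_small; last by lia.
  exact: leads_refl.
have [|rho1 [l1 [ei ec ed ev [e0 em]]]] := lead_no iP _ lv sp; first by lia.
exists (set_reg rho1 rg_v v.+1); split; last first.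
  by split; rewrite // cntS (negPf lv) addn0.
apply: (leads_trans l1); apply: (@leads_step true); rewrite /= ev em.
have -> : (v == P.-1) = false by lia.
apply: (@leads_step true); rewrite /= ev modn_small; last by lia.
exact: leads_refl.
Qed.

Lemma lead_vertices m rho i v : i < P -> v + m = P.-1 -> outer_spec i v rho ->
  exists rho', leads (1, rho) (1, rho') /\ outer_spec i P.-1 rho'.
Proof.
elim: m rho v => [|m IH] rho v iP ev sp.
  by exists rho; rewrite -ev addn0; split=> //; exact: leads_refl.
have [|rho1 [l1 sp1]] := lead_vertex iP _ sp; first by lia.
have [|rho2 [l2 sp2]] := IH rho1 v.+1 iP _ sp1; first by lia.
by exists rho2; split=> //; apply: leads_trans l1 l2.
Qed.

Lemma level_max_mono k k' : k <= k' -> level k P.-1 -> level k' P.-1.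
Proof.
move=> /subnK <-; elim: (k' - k) => [//|m IH] /IH.
by rewrite addSn => /(level_step true); rewrite f_max.
Qed.

(** P-1 is absorbing, so its absence from level P implies its absence from all earlier levels; at v
    = P-1 the run therefore always takes the negative branch, and in the last round this branch
    leads to [lab_bad]. *)
Lemma lead_levels m rho i : ~~ level P P.-1 -> i + m = P.-1 -> outer_spec i 0 rho ->
  exists rho', leads (1, rho) (lab_bad, rho').
Proof.
move=> nl; elim: m rho i => [|m IH] rho i ei sp.
all: have iP : i < P by lia.
all: have [rho1 [l1 sp1]] := @lead_vertices P.-1 rho i 0 iP (add0n _) sp.
all: have nli : ~~ level i.+1 P.-1 by apply: contra nl; apply: level_max_mono.
all: have [|rho2 [l2 [ei2 ec ed ev [e0 em]]]] := lead_no iP _ nli sp1; first by lia.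
all: have l12 := leads_trans l1 l2.
  exists rho2; apply: (leads_trans l12).
  apply: (@leads_step true); rewrite /= ev em eqxx.
  apply: (@leads_step true); rewrite /= ei2 em.
  by have -> : (i == P.-1) = true by [lia]; exact: leads_refl.
pose rho3 := fun r => rho2 (par_move [:: (rg_c, rg_d); (rg_d, rg_0); (rg_v, rg_0)] r).
pose rho4 := set_reg rho3 rg_i i.+1.
have [||rho5 l5] := IH rho4 i.+1; first by lia.
  split; rewrite /rho4 /rho3 /set_reg //= ed.
  have := cntS i.+1 P.-1; rewrite (negPf nli) addn0 => <-; congr cnt; lia.
exists rho5; apply: (leads_trans l12).
apply: (@leads_step true); rewrite /= ev em eqxx.
apply: (@leads_step true); rewrite /= ei2 em.
have -> : (i == P.-1) = false by lia.
apply: (@leads_step true); rewrite /= -/rho3.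
apply: (@leads_step true); rewrite /= {2}/rho3 /= ei2 modn_small; last by lia.
exact: l5.
Qed.

Lemma counting_complete rho :
  [/\ rho rg_i = 0, rho rg_c = 0, rho rg_d = 0, rho rg_v = 0 &
      rho rg_0 = 0 /\ rho rg_max = P.-1] ->
  ~~ level P P.-1 -> exists bs, (run_from rexec (0, rho) bs).1 = lab_bad.
Proof.
move=> [ei ec ed ev [e0 em]] nl.
have [||rho1 [bs e]] := @lead_levels P.-1 (set_reg rho rg_c 1) 0 nl; first by [].
  by split; rewrite //= cnt0P.
exists (true :: bs); rewrite /run_from /= -/rexec ec modn_small //.
by rewrite -/(run_from rexec (1, set_reg rho rg_c 1) bs) e.
Qed.

(** A run to P-1 is shortened below P steps and then prolonged by waiting in the absorbing
    vertex. *)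
Lemma level_max k : level k P.-1 -> level P P.-1.
Proof.
case/levelP => bs [_ e].
have [||bs' [e' sz]] := @run_from_short _ f (iota 0 P) 0 bs.
- by move=> b v; rewrite !mem_iota /=; apply: f_lt.
- by rewrite mem_iota /=; lia.
apply: (@level_max_mono (size bs')); first by move: sz; rewrite size_iota => /ltnW.
by apply/levelP; exists bs'; split=> //; rewrite -e; exact: e'.
Qed.

End InductiveCounting.

(** * Sweep machines *)

(* Work tape: a left end marker followed by a list of cells.  One macro step of a sweep machine
   consults the input head, sweeps right over the cells with output, optionally appends a cell,
   and sweeps back. *)
Record sweep_machine := SweepMachine {
  sQ : finType;
  sC : finType;
  sstart : sQ;
  sturn : sQ -> option bool -> option (sQ * mv * seq bool);
  sfwd : sQ -> sC -> sQ * sC * seq bool;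
  send : sQ -> sQ * option sC * seq bool;
  sbwd : sQ -> sC -> sQ * sC }.

Fixpoint sweep (Q C : Type) (f : Q -> C -> Q * C * seq bool) (s : Q) (l : seq C) :
    Q * seq C * seq bool :=
  if l is c :: l' then
    let: (s1, c1, o1) := f s c in
    let: (s2, l2, o2) := sweep f s1 l' in (s2, c1 :: l2, o1 ++ o2)
  else (s, [::], [::]).

Fixpoint sweep_back (Q C : Type) (g : Q -> C -> Q * C) (s : Q) (l : seq C) : Q * seq C :=
  if l is c :: l' then
    let: (s1, l1) := sweep_back g s l' in
    let: (s2, c2) := g s1 c in (s2, c2 :: l1)
  else (s, [::]).

Section SweepMachine.
Variable M : sweep_machine.

Definition scfg := (sQ M * nat * seq (sC M) * seq bool)%type.

Definition macro (x : seq bool) (k : scfg) : option scfg :=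
  let: (s, ih, l, out) := k in
  if sturn s (in_sym x ih) is Some (s1, m, o1) then
    let: (s2, l2, o2) := sweep (@sfwd M) s1 l in
    let: (s3, oc, o3) := send s2 in
    let: (s4, l4) := sweep_back (@sbwd M) s3 l2 in
    Some (s4, move_in x m ih, l4 ++ seq_of_opt oc, out ++ o1 ++ o2 ++ o3)
  else None.

Inductive shalts (x : seq bool) (B : nat) : scfg -> seq bool -> Prop :=
  | shalt s ih l out : sturn s (in_sym x ih) = None -> size l <= B -> shalts x B (s, ih, l, out) out
  | sgo k k' out : macro x k = Some k' -> size k.1.2 <= B -> shalts x B k' out -> shalts x B k out.

(* A run that starts in the middle of a macro step, right after the turn at the left end. *)
Definition mid_run (x : seq bool) (B : nat) (s : sQ M) (ih : nat) (L : seq (sC M))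
    (out res : seq bool) : Prop :=
  let: (s2, L2, o2) := sweep (@sfwd M) s L in
  let: (s3, oc, o3) := send s2 in
  let: (s4, L4) := sweep_back (@sbwd M) s3 L2 in
  shalts x B (s4, ih, L4 ++ seq_of_opt oc, out ++ o2 ++ o3) res.

Lemma turn_mid_run x B s s1 ih m L out o1 res : size L <= B ->
  sturn s (in_sym x ih) = Some (s1, m, o1) ->
  mid_run x B s1 (move_in x m ih) L (out ++ o1) res ->
  shalts x B (s, ih, L, out) res.
Proof.
move=> sz e; rewrite /mid_run.
case E1: (sweep _ _ _) => [[s2 L2] o2]; case E2: (send s2) => [[s3 oc] o3].
case E3: (sweep_back _ _ _) => [s4 L4]; rewrite -catA => h.
apply: sgo h => //.
by rewrite /macro /= e E1 E2 E3.
Qed.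

(** A [DTM] appends at most one bit per step, whereas a sweep machine emits whole strings. Pending
    bits wait in a buffer of this length, so the state set stays finite. *)
Definition out_bound : nat :=
  maxn (\max_(p : sQ M * option bool) (if sturn p.1 p.2 is Some (_, _, o) then size o else 0))
 (maxn (\max_(p : sQ M * sC M) size (sfwd p.1 p.2).2)
       (\max_(s : sQ M) size (send s).2)).

Definition buffer := out_bound.-bseq bool.
Definition mkbuf (o : seq bool) : buffer := insub_bseq out_bound o.

(* A state is (moving right?, state of the sweep machine, pending output). *)
Definition ddelta_of (q : bool * sQ M * buffer) (i : option bool) (g : option (option (sC M))) :
    option (bool * sQ M * buffer * option (option (sC M)) * mv * mv * option bool) :=
  let: (fw, s, buf) := q in
  if bseqval buf is b :: o then Some (fw, s, mkbuf o, g, MvS, MvS, Some b)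
  else if fw then
    if g is Some (Some c) then
      let: (s', c', o) := sfwd s c in
      Some (true, s', mkbuf o, Some (Some c'), MvS, MvR, None)
    else
      let: (s', oc, o) := send s in
      Some (false, s', mkbuf o, omap Some oc, MvS, MvL, None)
  else
    if g is Some (Some c) then
      let: (s', c') := sbwd s c in
      Some (false, s', mkbuf [::], Some (Some c'), MvS, MvL, None)
    else if sturn s i is Some (s', m, o) then
      Some (true, s', mkbuf o, Some None, m, MvR, None)
    else None.

Definition dtm_of : DTM :=
  @Build_DTM (bool * sQ M * buffer)%type (option (option (sC M))) None (false, sstart M, mkbuf [::])
    ddelta_of.

End SweepMachine.

(** * Simulation of sweep machines by deterministic transducers *)

Section RunDTM.
Variable D : DTM.

Inductive dhalts (x : seq bool) (B : nat) : dcfg D -> seq bool -> Prop :=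
  | dhalt k : dstep x k = None -> k.1.2 <= B -> dhalts x B k k.2
  | dgo k k' out : dstep x k = Some k' -> k.1.2 <= B -> dhalts x B k' out -> dhalts x B k out.

Fixpoint drun_from (x : seq bool) (k : dcfg D) (t : nat) : option (dcfg D) :=
  if t is t'.+1 then obind (@dstep D x) (drun_from x k t') else Some k.

Lemma drun_from0 x t : @drun D x t = drun_from x (dinit D) t.
Proof. by elim: t => //= t ->. Qed.

Lemma drun_fromS x k t :
  drun_from x k t.+1 = if dstep x k is Some k' then drun_from x k' t else None.
Proof.
elim: t => [|t IH]; first by rewrite /=; case: (dstep x k).
rewrite [LHS]/= -/(drun_from x k t.+1) IH; by case: (dstep x k).
Qed.

Lemma dhalts_run x B k out : dhalts x B k out ->
  (forall t k', drun_from x k t = Some k' -> k'.1.2 <= B) /\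
  (exists t k', [/\ drun_from x k t = Some k', dstep x k' = None & k'.2 = out]).
Proof.
elim=> {k out} [k e le|k k' out e le _ [IH1 IH2]]; split.
- by case=> [|t] k'; rewrite ?drun_fromS ?e //= => -[<-].
- by exists 0, k.
- by case=> [|t] k2; rewrite ?drun_fromS ?e //=; [move=> [<-] | apply: IH1].
- by case: IH2 => t [k2 [h1 h2 h3]]; exists t.+1, k2; rewrite drun_fromS e.
Qed.

Lemma dhalts_logspace f c :
  (forall x, dhalts x (logbound c (size x)) (dinit D) (f x)) -> logspace_computable f.
Proof.
move=> h; exists D, c => x; have [h1 [t [k [e1 e2 e3]]]] := dhalts_run (h x).
split; last by exists t, k; rewrite drun_from0.
by move=> t' k'; rewrite drun_from0; apply: h1.
Qed.
End RunDTM.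

Section Simulation.
Variable M : sweep_machine.
Let D := dtm_of M.

Lemma mkbufK o : size o <= out_bound M -> bseqval (mkbuf M o) = o.
Proof. by move=> le; rewrite /mkbuf /insub_bseq /insubd insubT. Qed.

Lemma turn_bound s i s' m o : @sturn M s i = Some (s', m, o) -> size o <= out_bound M.
Proof.
move=> e; apply: leq_trans (leq_maxl _ _).
by have := @leq_bigmax _ (fun p : sQ M * option bool =>
  if sturn p.1 p.2 is Some (_, _, o) then size o else 0) (s, i); rewrite /= e.
Qed.

Lemma fwd_bound s c : size (@sfwd M s c).2 <= out_bound M.
Proof.
apply: leq_trans (leq_maxr _ _); apply: leq_trans (leq_maxl _ _).
exact: (@leq_bigmax _ (fun p : sQ M * sC M => size (sfwd p.1 p.2).2) (s, c)).
Qed.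

Lemma send_bound s : size (@send M s).2 <= out_bound M.
Proof.
apply: leq_trans (leq_maxr _ _); apply: leq_trans (leq_maxr _ _).
exact: (@leq_bigmax _ (fun s : sQ M => size (send s).2) s).
Qed.

(** [None] is the blank, [Some None] the left end marker and [Some (Some c)] a cell. Tapes are
    compared by [nth], because the list may carry trailing blanks. *)
Definition tape_is (wt : seq (dG D)) (l : seq (sC M)) : Prop :=
  forall i, nth None wt i = nth None (Some None :: map (fun c => Some (Some c)) l) i.

Lemma tape_set wt (l l' : seq (sC M)) i g : tape_is wt l ->
  (forall j, nth None (Some None :: map (fun c => Some (Some c)) l') j =
     if j == i then g else nth None (Some None :: map (fun c => Some (Some c)) l) j) ->
  tape_is (set_nth None wt i g) l'.
Proof. by move=> h e j; rewrite nth_set_nth /= h e. Qed.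

Lemma tape_id wt (l : seq (sC M)) i : tape_is wt l ->
  tape_is (set_nth None wt i (nth None wt i)) l.
Proof. by move=> h; apply: tape_set (h) _ => j; rewrite h; case: eqP => [->|]. Qed.

Definition dcf (r : bool) (s : sQ M) (o : seq bool) ih wt wh out : dcfg D :=
  ((r, s, mkbuf M o), ih, wt, wh, out).

Lemma flush x B r s o ih l wt wh out res : tape_is wt l -> wh <= B -> size o <= out_bound M ->
  (forall wt', tape_is wt' l -> dhalts x B (dcf r s [::] ih wt' wh (out ++ o)) res) ->
  dhalts x B (dcf r s o ih wt wh out) res.
Proof.
elim: o wt out => [|b o IH] wt out tl wB sz h; first by have := h _ tl; rewrite cats0.
apply: (@dgo _ _ _ _ (dcf r s o ih (set_nth None wt wh (nth None wt wh)) wh (rcons out b))) => //.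
  by rewrite /dcf /= mkbufK.
apply: IH => //; [exact: tape_id | exact: ltnW |].
by move=> wt' tl'; rewrite cat_rcons; apply: h.
Qed.

Lemma sim_fwd x B s l1 l2 ih wt out res : size (l1 ++ l2) < B ->
  tape_is wt (l1 ++ l2) ->
  (forall wt', let: (s', l', o) := sweep (@sfwd M) s l2 in tape_is wt' (l1 ++ l') ->
     dhalts x B (dcf true s' [::] ih wt' (size (l1 ++ l2)).+1 (out ++ o)) res) ->
  dhalts x B (dcf true s [::] ih wt (size l1).+1 out) res.
Proof.
elim: l2 l1 s wt out => [|c l2 IH] l1 s wt out sz tl; rewrite /=.
  by move=> h; have := h _ tl; rewrite !cats0.
have := fwd_bound s c.
case E: (sfwd s c) => [[s1 c1] o1] /= ob.
have := IH (rcons l1 c1) s1 _ (out ++ o1).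
case: (sweep _ _ _) => [[s2 l'] o2] {}IH h.
have tl1 : tape_is (set_nth None wt (size l1).+1 (Some (Some c1))) (rcons l1 c1 ++ l2).
  apply: tape_set tl _ => -[|j] //=; rewrite cat_rcons !map_cat !nth_cat !size_map /= eqSS.
  case: ltngtP => // [lt|->]; last by rewrite subnn.
  by rewrite -(subnSK lt).
apply: (@dgo _ _ _ _ (dcf true s1 o1 ih (set_nth None wt (size l1).+1 (Some (Some c1)))
  (size l1).+2 out)).
- by rewrite /= mkbufK // tl /= map_cat nth_cat size_map ltnn subnn /= E.
- by move: sz; rewrite /dcf /= size_cat /=; lia.
apply: flush tl1 _ ob _; first by move: sz; rewrite size_cat /=; lia.
move=> wt' tl'; have := IH wt'; rewrite size_rcons; apply.
- by move: sz; rewrite !size_cat size_rcons /=; lia.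
- exact: tl'.
move=> wt2; rewrite cat_rcons -catA => tl2; have := h wt2 tl2.
by rewrite !size_cat size_rcons /= addSnnS.
Qed.

Lemma sweep_back_rcons (Q C : Type) (g : Q -> C -> Q * C) s l c :
  sweep_back g s (rcons l c) =
  let: (s1, c1) := g s c in let: (s2, l2) := sweep_back g s1 l in (s2, rcons l2 c1).
Proof.
elim: l => [|a l IH] /=; first by case: (g s c).
rewrite IH; case: (g s c) => s1 c1; case: (sweep_back g s1 l) => s2 l2.
by case: (g s2 a).
Qed.

Lemma sim_bwd x B s l1 l2 ih wt out res : size l1 <= B -> tape_is wt (l1 ++ l2) ->
  (forall wt', let: (s', l') := sweep_back (@sbwd M) s l1 in tape_is wt' (l' ++ l2) ->
     dhalts x B (dcf false s' [::] ih wt' 0 out) res) ->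
  dhalts x B (dcf false s [::] ih wt (size l1) out) res.
Proof.
elim/last_ind: l1 s l2 wt => [|l1 c IH] s l2 wt sz tl; first exact.
rewrite sweep_back_rcons; case E: (sbwd s c) => [s1 c1].
move: (IH s1 (c1 :: l2)); case: (sweep_back _ _ _) => [s2 l'] {}IH h.
have tl1 : tape_is (set_nth None wt (size l1).+1 (Some (Some c1))) (l1 ++ c1 :: l2).
  apply: tape_set tl _ => -[|j] //=; rewrite cat_rcons !map_cat !nth_cat !size_map /= eqSS.
  case: ltngtP => // [lt|->]; last by rewrite subnn.
  by rewrite -(subnSK lt).
rewrite size_rcons in sz *.
apply: (@dgo _ _ _ _ (dcf false s1 [::] ih (set_nth None wt (size l1).+1 (Some (Some c1)))
  (size l1) out)).
- by rewrite /= mkbufK // tl /= cat_rcons map_cat nth_cat size_map ltnn subnn /= E.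
- exact: sz.
apply: IH tl1 _; first exact: ltnW.
by move=> wt' tl'; apply: h; rewrite cat_rcons.
Qed.

(** The second alternative for the tape is the start: the end marker is written only by the first
    turn, and until then a blank at position 0 plays its role. *)
Lemma sim_macro x B k k' wt res : macro x k = Some k' -> size k.1.2 < B ->
  tape_is wt k.1.2 \/ k.1.2 = [::] /\ wt = [::] ->
  (forall wt', tape_is wt' k'.1.2 ->
    dhalts x B (dcf false k'.1.1.1 [::] k'.1.1.2 wt' 0 k'.2) res) ->
  dhalts x B (dcf false k.1.1.1 [::] k.1.1.2 wt 0 k.2) res.
Proof.
case: k => [[[s ih] l] out]; rewrite /macro [(_, _, l, out).1]/= [(s, ih, l).2]/=.
case E: (sturn _ _) => [[[s1 m] o1]|//].
move=> e sz tl h.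
have nth0 : nth None wt 0 = None \/ nth None wt 0 = Some None.
  by case: tl => [->|[_ ->]]; [right | left].
have tl1 : tape_is (set_nth None wt 0 (Some None)) l.
  case: tl => [tl|[-> ->]]; last by case=> [|[|]].
  by apply: tape_set tl _ => -[|j].
apply: (@dgo _ _ _ _ (dcf true s1 o1 (move_in x m ih) (set_nth None wt 0 (Some None)) 1 out)).
- by rewrite /= mkbufK //; case: nth0 => -> /=; rewrite E.
- by [].
apply: flush tl1 _ (turn_bound E) _; first by lia.
move=> wt1 tl2; apply: (@sim_fwd _ _ _ [::] l) (sz) tl2 _ => wt2.
case E2: (sweep _ _ _) e => [[s2 l2] o2].
case E3: (send s2) => [[s3 oc] o3].
case E4: (sweep_back _ _ _) => [s4 l4] [ek] tl3.
have sz2 : size l2 = size l.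
  elim: (l) s1 s2 l2 o2 E2 {E sz tl tl3 E3 E4 h ek} => [|c l' IH] s1 s2 l2 o2 /=.
    by case=> _ <-.
  case: (sfwd s1 c) => [[s' c'] o']; case E2: (sweep _ _ _) => [[s3' l3'] o3'].
  by case=> _ <- _ /=; rewrite (IH _ _ _ _ E2).
rewrite /= -sz2.
have tl4 : tape_is (set_nth None wt2 (size l2).+1 (omap Some oc)) (l2 ++ seq_of_opt oc).
  apply: tape_set tl3 _ => -[|j] //=; rewrite !map_cat !nth_cat !size_map /= eqSS.
  case: ltngtP => // [lt|->]; last first.
    by rewrite subnn; case: (oc).
  have -> : nth None [seq Some (Some i) | i <- seq_of_opt oc] (j - size l2) = None.
    by rewrite -(subnSK lt); case: (oc) => //= c; rewrite nth_nil.
  by rewrite nth_default // size_map ltnW.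
apply: (@dgo _ _ _ _ (dcf false s3 o3 (move_in x m ih)
  (set_nth None wt2 (size l2).+1 (omap Some oc)) (size l2) (out ++ o1 ++ o2))).
- rewrite /= mkbufK // tl3 /= nth_default ?size_map // E3 /= catA.
  by rewrite /dcf; case: (oc).
- by rewrite /= sz2.
apply: flush tl4 _ _ _; first by rewrite sz2; apply: ltnW.
  by have := send_bound s2; rewrite E3.
move=> wt3 tl5; apply: sim_bwd tl5 _; first by rewrite sz2; apply: ltnW.
move=> wt4; rewrite E4 => tl6.
by have := h wt4; rewrite -ek /= -!catA; apply.
Qed.

Lemma shalts_dhalts x B k out wt : shalts x B k out ->
  tape_is wt k.1.2 \/ k.1.2 = [::] /\ wt = [::] ->
  dhalts x B.+1 (dcf false k.1.1.1 [::] k.1.1.2 wt 0 k.2) out.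
Proof.
move=> h; elim: h wt => {k out} [s ih l out e le|k k' out e le _ IH] wt tl.
  apply: (@dhalt D x B.+1 (dcf false s [::] ih wt 0 out)) => //.
  rewrite /= mkbufK //.
  have [-> | ->] : nth None wt 0 = None \/ nth None wt 0 = Some None.
    by case: tl => [->|[_ ->]]; [right | left].
  - by rewrite e.
  - by rewrite e.
apply: sim_macro e _ tl _ => // wt' tl'; apply: IH; by left.
Qed.

Lemma sweep_logspace f c :
  (forall x, shalts x (c * (trunc_log 2 (size x)).+1) (sstart M, 1, [::], [::]) (f x)) ->
  logspace_computable f.
Proof.
move=> h; apply: (@dhalts_logspace D f c.+1) => x.
have := @shalts_dhalts x _ _ _ [::] (h x) (or_intror (conj erefl erefl)).
rewrite /logbound -/(dinit D).
(* The head also visits the blank behind the last cell, hence one more position than cells. *)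
have : (c * (trunc_log 2 (size x)).+1).+1 <= c.+1 * (trunc_log 2 (size x)).+1 by lia.
move: (_.+1) (c.+1 * _) => b b' le.
have mono k o : dhalts x b k o -> dhalts x b' k o.
  elim=> {k o} [k e l|k k' o e l _ IH]; first by apply: dhalt => //; apply: leq_trans le.
  by apply: dgo e _ IH; apply: leq_trans le.
exact: mono.
Qed.

End Simulation.

(** * Odometers on strings *)

Fixpoint mealy (Q C : Type) (f : Q -> C -> Q * C) (s : Q) (l : seq C) : Q * seq C :=
  if l is c :: l' then
    let: (s1, c1) := f s c in
    let: (s2, l2) := mealy f s1 l' in (s2, c1 :: l2)
  else (s, [::]).

Lemma size_mealy (Q C : Type) (f : Q -> C -> Q * C) s l : size (mealy f s l).2 = size l.
Proof.
elim: l s => //= c l IH s; case: (f s c) => s1 c1; have := IH s1.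
by case: (mealy f s1 l) => s2 l2 /= ->.
Qed.

Lemma size_sweep_back (Q C : Type) (f : Q -> C -> Q * C) s l :
  size (sweep_back f s l).2 = size l.
Proof.
elim: l => //= c l; case: (sweep_back f s l) => s1 l1 /= IH.
by case: (f s1 c) => s2 c2 /=; rewrite IH.
Qed.

Lemma chain_cat (A : eqType) (nx : A -> option A) a p b q :
  path (fun x y => nx x == Some y) a p -> nx (last a p) = Some b -> chain nx (b :: q) ->
  chain nx (a :: p ++ b :: q).
Proof.
move=> pp e /= /andP[pq lq].
by rewrite cat_path pp /= e eqxx pq last_cat /= lq.
Qed.

Lemma chain_map (A A' : eqType) (nx : A -> option A) (nx' : A' -> option A') (g : A -> A') l :
  (forall a, a \in l -> nx' (g a) = omap g (nx a)) -> chain nx l -> chain nx' (map g l).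
Proof.
case: l => [//|a p] h /= /andP[pp lp].
rewrite last_map h ?mem_last // (eqP lp) /= andbT.
elim: p a h pp {lp} => [//|b p IH] a h /= /andP[/eqP e pp].
rewrite h ?mem_head // e /= eqxx; apply: IH => // c cin.
by apply: h; rewrite inE cin orbT.
Qed.

Section ChainProduct.
Variables (A A' : eqType) (nx : A -> option A) (nx' : A' -> option A').

Definition next_pair (a0 : A) (p : A * A') : option (A * A') :=
  if nx p.1 is Some a then Some (a, p.2)
  else omap (fun b => (a0, b)) (nx' p.2).

Lemma chain_prod a0 l l' : chain nx (a0 :: l) -> chain nx' l' ->
  chain (next_pair a0) [seq (a, b) | b <- l', a <- a0 :: l].
Proof.
move=> /= /andP[pl /eqP ll]; case: l' => [//|b q].
have pin b1 : path (fun x y => next_pair a0 x == Some y) (a0, b1) [seq (a, b1) | a <- l].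
  move: {1 3}a0 pl; elim: l {ll} => [//|a1 l IH] a2 /= /andP[/eqP e pl].
  by rewrite {1}/next_pair /= e eqxx; apply: IH.
have lin b1 : next_pair a0 (last (a0, b1) [seq (a, b1) | a <- l]) =
    omap (fun b => (a0, b)) (nx' b1).
  by rewrite (last_map (fun a => (a, b1))) /next_pair /= ll.
elim: q b => [|b' q IH] b.
  by move=> /= /eqP e; rewrite cats0 pin lin e.
move=> /= /andP[/andP[/eqP e pq] lq].
apply: (@chain_cat _ (next_pair a0) (a0, b) [seq (a, b) | a <- l] (a0, b')) => //.
- by rewrite lin e.
- by apply: IH; rewrite /= pq lq.
Qed.
End ChainProduct.

Section Odometer.
Variables (D : eqType) (d0 : D) (ds : seq D).

Definition next_digit (d : D) : option D :=
  if (index d (d0 :: ds)).+1 < size (d0 :: ds) then Some (nth d0 (d0 :: ds) (index d (d0 :: ds)).+1)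
  else None.

Definition inc_digit (carry : bool) (d : D) : bool * D :=
  if carry then if next_digit d is Some d' then (false, d') else (true, d0) else (false, d).

Definition next_str (s : seq D) : option (seq D) :=
  let: (c, s') := mealy inc_digit true s in if c then None else Some s'.

(** The first digit runs fastest, so that carries travel to the right and the successor is computed
    in a forward pass. *)
Fixpoint strs (W : nat) : seq (seq D) :=
  if W is W'.+1 then [seq p.1 :: p.2 | p <- [seq (d, s) | s <- strs W', d <- d0 :: ds]]
  else [:: [::]].

Lemma strsS W : strs W.+1 = [seq p.1 :: p.2 | p <- [seq (d, s) | s <- strs W, d <- d0 :: ds]].
Proof. by []. Qed.

Lemma mealy_inc_false s : mealy inc_digit false s = (false, s).
Proof. by elim: s => //= d s ->. Qed.

Lemma mealy_inc_overflow s s' :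
  mealy inc_digit true s = (true, s') -> s' = nseq (size s) d0.
Proof.
elim: s s' => [|d s IH] s' /=; first by case=> <-.
case: (next_digit d) => [d'|]; first by rewrite mealy_inc_false.
by case: (mealy _ _ _) IH => c s1 IH [ec <-]; rewrite (IH s1) ?ec.
Qed.

Lemma head_strs W : exists r, strs W = nseq W d0 :: r.
Proof. by elim: W => [|W [r e]]; [exists [::] | rewrite /= e; eexists]. Qed.

Lemma size_strs W : size (strs W) = (size ds).+1 ^ W.
Proof. by elim: W => [//|W IH]; rewrite strsS size_map size_allpairs IH expnS mulnC. Qed.

Hypothesis ds_uniq : uniq (d0 :: ds).
Hypothesis ds_all : forall d, d \in d0 :: ds.

Lemma mem_strs W s : (s \in strs W) = (size s == W).
Proof.
elim: W s => [|W IH] s; first by rewrite inE; case: s.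
rewrite strsS.
apply/mapP/idP => [[p pin ->]|].
  by case/allpairsP: pin => -[t d] /= [tin _ ->]; rewrite /= eqSS -IH.
case: s => [//|d s]; rewrite -[size _]/(size s).+1 eqSS -IH => sin.
by exists (d, s) => //; apply/allpairsP; exists (s, d).
Qed.

Lemma uniq_strs W : uniq (strs W).
Proof.
elim: W => [//|W IH]; rewrite strsS map_inj_uniq; last by move=> [a b] [a' b'] /= [-> ->].
by apply: allpairs_uniq => // -[a b] [a' b'] _ _ /= [-> ->].
Qed.

Lemma chain_digits : chain next_digit (d0 :: ds).
Proof.
rewrite /chain; apply/andP; split.
  apply/(pathP d0) => i lt; rewrite -[nth _ (d0 :: ds) i]/(nth d0 (d0 :: ds) i).
  rewrite /next_digit index_uniq //=; last exact: ltnW.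
  by rewrite ltnS lt.
by rewrite /next_digit index_last //= ltnn.
Qed.

Lemma chain_strs W : chain next_str (strs W).
Proof.
elim: W => [//|W IH]; rewrite strsS.
have := chain_prod chain_digits IH; apply: chain_map => -[d s] /= _.
rewrite /next_str /next_pair /=; case: (next_digit d) => [d'|] /=.
  by rewrite mealy_inc_false.
by case: (mealy _ _ _) => -[] s'.
Qed.

Definition rank W s := index s (strs W).

Lemma rank_inj W s s' : size s = W -> size s' = W -> rank W s = rank W s' -> s = s'.
Proof.
move=> /eqP; rewrite -mem_strs => sin /eqP; rewrite -mem_strs => sin' e.
by rewrite -(nth_index [::] sin) -/(rank W s) e nth_index.
Qed.

Lemma rank_lt W s : size s = W -> rank W s < (size ds).+1 ^ W.
Proof. by move=> /eqP; rewrite -mem_strs -index_mem size_strs. Qed.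

Lemma unrankK W s : size s = W -> nth [::] (strs W) (rank W s) = s.
Proof. by move=> /eqP; rewrite -mem_strs => sin; apply: nth_index. Qed.

Lemma rankK W v : v < (size ds).+1 ^ W -> rank W (nth [::] (strs W) v) = v.
Proof. by move=> lt; rewrite /rank index_uniq ?uniq_strs ?size_strs. Qed.

Lemma size_unrank W v : v < (size ds).+1 ^ W -> size (nth [::] (strs W) v) = W.
Proof. by move=> lt; apply/eqP; rewrite -mem_strs mem_nth ?size_strs. Qed.

Lemma rank_zero W : rank W (nseq W d0) = 0.
Proof. by rewrite /rank; have [r ->] := head_strs W; rewrite /= eqxx. Qed.

(** Inside the enumeration the odometer moves to the next index; only the last string overflows, to
    the all-[d0] string of rank 0. This is the arithmetic modulo P of the counting registers. *)
Lemma rank_inc W s : size s = W ->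
  rank W (mealy inc_digit true s).2 = (rank W s).+1 %% (size ds).+1 ^ W.
Proof.
move=> sz; have es := unrankK sz; have lt := rank_lt sz; have := chain_strs W.
set v := rank W s in es lt *.
have szs := size_strs W; case E: (strs W) (szs) => [|s0 r] szs'.
  by move: lt; rewrite -szs'.
rewrite /chain => /andP[/(pathP [::]) pp /eqP ll].
have [lt1|ge1] := ltnP v (size r).
  have := pp v lt1; have -> : nth [::] r v = nth [::] (strs W) v.+1 by rewrite E.
  rewrite -[nth _ (s0 :: r) v]/(nth [::] (s0 :: r) v) -E es /next_str.
  case: (mealy _ _ _) => -[] // s' /eqP[->] /=.
  by rewrite rankK ?modn_small // -szs'.
have ev : v = size r by move: lt; rewrite -szs' /=; lia.
have el : s = last s0 r.
  by rewrite -es E ev -[size r]/(size (s0 :: r)).-1 nth_last.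
rewrite ev -szs' modnn; move: ll; rewrite -el /next_str.
case E2: (mealy _ _ _) => [[] s'] // _; rewrite /= (mealy_inc_overflow E2).
by rewrite sz rank_zero.
Qed.

End Odometer.

(** * Configurations as strings *)

Lemma mealy_iota (Q C : Type) (f : Q -> C -> Q * C) (st : nat -> Q) (c c' : nat -> C) a n :
  (forall j, a <= j < a + n -> f (st j) (c j) = (st j.+1, c' j)) ->
  mealy f (st a) (map c (iota a n)) = (st (a + n), map c' (iota a n)).
Proof.
elim: n a => [|n IH] a h; first by rewrite addn0.
rewrite /= h; last by lia.
rewrite IH; first by rewrite addSnnS.
by move=> j hj; apply: h; lia.
Qed.

Lemma sweep_back_iota (Q C : Type) (g : Q -> C -> Q * C) (st : nat -> Q) (c c' : nat -> C) a n :
  (forall j, a <= j < a + n -> g (st j.+1) (c j) = (st j, c' j)) ->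
  sweep_back g (st (a + n)) (map c (iota a n)) = (st a, map c' (iota a n)).
Proof.
elim: n a => [|n IH] a h; first by rewrite addn0.
rewrite /= -addSnnS IH; first by rewrite h //; lia.
by move=> j hj; apply: h; lia.
Qed.

Definition bit (m n : nat) : bool := odd (n %/ 2 ^ m).

Lemma bitS m n : bit m n.+1 = bit m n (+) (2 ^ m %| n.+1).
Proof. by rewrite /bit divnS ?expn_gt0 // oddD addbC oddb. Qed.

Lemma dvdn_exp2S m n : (2 ^ m.+1 %| n) = (2 ^ m %| n) && ~~ bit m n.
Proof.
rewrite /bit -dvdn2 expnSr; have [d|nd] := boolP (2 ^ m %| n).
  by rewrite -{1}(divnK d) mulnC dvdn_pmul2r ?expn_gt0.
apply/negP => /(dvdn_trans _) h; move: nd; rewrite h //; exact: dvdn_mulr.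
Qed.

Lemma lsb_val_bits n W : lsb_val [seq bit j n | j <- iota 0 W] = n %% 2 ^ W.
Proof.
elim: W n => [|W IH] n; first by rewrite expn0 modn1.
rewrite /= (iotaDl 1 0) -map_comp.
rewrite (@eq_map _ _ _ (fun j => bit j n./2)); last first.
  by move=> j /=; rewrite /bit add1n expnS divnMA -divn2.
rewrite IH /bit expn0 divn1.
have lt : n./2 %% 2 ^ W < 2 ^ W by rewrite ltn_pmod ?expn_gt0.
have e : n = n./2 %/ 2 ^ W * 2 ^ W.+1 + (odd n + (n./2 %% 2 ^ W).*2).
  rewrite expnS mulnCA; have := odd_double_half n; have := divn_eq n./2 (2 ^ W).
  by move: (_ %/ _ * _) (_ %% _) => u v; lia.
rewrite [in RHS]e modnMDl [RHS]modn_small //.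
by rewrite expnS; case: (odd n); lia.
Qed.

Section ConfigStrings.
Variable M : NTM.

Definition branching : nat :=
  \max_(p : nQ M * option bool * nG M) size (ndelta p.1.1 p.1.2 p.2).

(* One cell of a configuration: a bit of the input head position, the tape symbol and, under the
   work head, the state together with the index of the transition to be tried next. *)
Definition cfg_cell := (bool * nG M * option (nQ M * 'I_branching.+1))%type.

(* [None] fills the source string, [Some None] the accepting string. *)
Definition letter := option (option cfg_cell).

Definition letters : seq letter :=
  rcons (map (fun c => Some (Some c)) (enum {: cfg_cell})) (Some None).

Lemma letters_uniq : uniq (None :: letters).
Proof.
rewrite /letters /= mem_rcons inE rcons_uniq /= map_inj_uniq ?enum_uniq ?andbT.
  apply/andP; split; last by apply/mapP => -[].
  by apply/mapP => -[].
by move=> a b [].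
Qed.

Lemma mem_letters d : d \in None :: letters.
Proof.
case: d => [[c|]|]; rewrite inE // mem_rcons inE // map_f ?orbT //.
by rewrite mem_enum.
Qed.

Definition dir (m : mv) : option bool :=
  match m with MvL => Some false | MvS => None | MvR => Some true end.

(* Outcome of the right-going pass: nothing to do, accept, or move the input head in the given
   direction, the work head still having to be moved left with a new state. *)
Definition outcome := option (option (option bool * option (nQ M))).
Definition fwd_state := (bool * bool * option (nQ M) * outcome)%type.

(** Out-degree two is obtained by [skip]: true advances the index of the transition to be tried,
    false executes it. [z] tells whether all bits of the head position read so far are zero. A left
    move of the work head cannot be completed in this direction: the cell keeps its mark, and the
    new state is handed to the way back. *)
Definition step_fwd (skip : bool) (sy : option bool) (s : fwd_state) (d : letter) :
    fwd_state * letter :=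
  let: (first, z, nx, oc) := s in
  match d with
  | None => ((false, z, None, Some (Some (Some true, None))),
             Some (Some (false, nblank M, if first then Some (nstart M, ord0) else None)))
  | Some None => ((false, z, nx, oc), d)
  | Some (Some (ib, g, h)) =>
      let z' := z && ~~ ib in
      if nx is Some q then ((false, z', None, oc), Some (Some (ib, g, Some (q, ord0))))
      else if h is Some (q, k) then
        if nacc q then ((false, z', None, Some None), d)
        else if skip then ((false, z', None, oc), Some (Some (ib, g, Some (q, inord k.+1))))
        else match onth (ndelta q sy g) k with
             | None => ((false, z', None, oc), d)
             | Some (q', g', mi, mw) =>
                 match mw with
                 | MvR => ((false, z', Some q', Some (Some (dir mi, None))),
                           Some (Some (ib, g', None)))
                 | MvS => ((false, z', None, Some (Some (dir mi, None))),
                           Some (Some (ib, g', Some (q', ord0))))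
                 | MvL => if first
                          then ((false, z', None, Some (Some (dir mi, None))),
                                Some (Some (ib, g', Some (q', ord0))))
                          else ((false, z', None, Some (Some (dir mi, Some q'))),
                                Some (Some (ib, g', h)))
                 end
             end
      else ((false, z', None, oc), d)
  end.

(* State of the left-going pass: [None] writes the accepting string; otherwise carry ([Some true])
   or borrow ([Some false]) of the input head position, a state with which to leave the marked
   cell leftwards, and a state to be put into the next cell. *)
Definition bwd_state := option (option bool * option (nQ M) * option (nQ M)).

(** Both end markers read as [None]; [z] tells position 0 from the right end. Moves beyond a marker
    are cancelled here, as in [move_in]. *)
Definition step_turn (sy : option bool) (s : fwd_state) : bwd_state :=
  let: (_, z, _, oc) := s in
  match oc with
  | None => Some (None, None, None)
  | Some None => None
  | Some (Some (mi, lm)) =>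
      let c := match mi with
               | None => None
               | Some true => if ~~ z && (sy == None) then None else Some true
               | Some false => if z then None else Some false
               end in
      Some (c, lm, None)
  end.

Definition bwd_bit (cy : option bool) (ib : bool) : option bool * bool :=
  match cy with
  | None => (None, ib)
  | Some true => if ib then (Some true, false) else (None, true)
  | Some false => if ib then (None, false) else (Some false, true)
  end.

Definition bwd_head (lm pl : option (nQ M)) (h : option (nQ M * 'I_branching.+1)) :
    option (nQ M) * option (nQ M) * option (nQ M * 'I_branching.+1) :=
  match pl, lm, h with
  | Some q, _, _ => (lm, None, Some (q, ord0))
  | None, Some q, Some _ => (None, Some q, None)
  | None, _, _ => (lm, None, h)
  end.

Definition step_bwd (s : bwd_state) (d : letter) : bwd_state * letter :=
  match s, d with
  | None, _ => (None, Some None)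
  | Some (cy, lm, pl), Some (Some (ib, g, h)) =>
      let: (cy', ib') := bwd_bit cy ib in
      let: (lm', pl', h') := bwd_head lm pl h in
      (Some (cy', lm', pl'), Some (Some (ib', g, h')))
  | _, _ => (s, d)
  end.

Definition fwd_init : fwd_state := (true, true, None, None).

Definition step_str (skip : bool) (sy : option bool) (w : seq letter) : seq letter :=
  let: (s, w1) := mealy (step_fwd skip sy) fwd_init w in
  (sweep_back step_bwd (step_turn sy s) w1).2.

Lemma size_step_str skip sy w : size (step_str skip sy w) = size w.
Proof.
rewrite /step_str; have := size_mealy (step_fwd skip sy) fwd_init w.
by case: (mealy _ _ _) => s w1 /= <-; rewrite size_sweep_back.
Qed.

Definition head_bit (d : letter) : bool := if d is Some (Some (b, _, _)) then b else false.

Definition head_pos (w : seq letter) : nat := bits_val (map head_bit w).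

Variable W : nat.
Hypothesis W_gt0 : 0 < W.

Definition bot : seq letter := nseq W None.
Definition top : seq letter := nseq W (Some None).

(* The input head position has its least significant bit on the right, so that the left-going pass,
   which knows the transition, can carry or borrow. *)
Definition cfg_letter (k : ncfg M) (p : 'I_branching.+1) (j : nat) : letter :=
  let: (q, ih, wt, wh) := k in
  Some (Some (bit (W - j.+1) ih, nth (nblank M) wt j, if j == wh then Some (q, p) else None)).

Definition cfg_str (k : ncfg M) (p : 'I_branching.+1) : seq letter :=
  map (cfg_letter k p) (iota 0 W).

Lemma head_pos_cfg q ih wt wh p : ih < 2 ^ W -> head_pos (cfg_str (q, ih, wt, wh) p) = ih.
Proof.
move=> lt; rewrite /head_pos /cfg_str -map_comp /bits_val -map_rev.
have -> : rev (iota 0 W) = [seq W - j.+1 | j <- iota 0 W].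
  apply: (@eq_from_nth _ 0); first by rewrite size_rev size_map.
  move=> i; rewrite size_rev size_iota => iW.
  by rewrite nth_rev ?size_iota // (nth_map 0) ?size_iota // !nth_iota //; lia.
rewrite -map_comp (@eq_in_map _ _ _ (fun j => bit j ih) _).1 ?lsb_val_bits ?modn_small //.
by move=> j; rewrite mem_iota /= => jW; congr bit; lia.
Qed.

Lemma zero_prefix ih j : j < W -> ih < 2 ^ W ->
  (ih %/ 2 ^ (W - j) == 0) && ~~ bit (W - j.+1) ih = (ih %/ 2 ^ (W - j.+1) == 0).
Proof.
move=> jW lt; have e : W - j = (W - j.+1).+1 by lia.
rewrite e expnSr divnMA divn2 /bit.
by case: (ih %/ _) => [|[|m]]; rewrite //= ?negbK // andbF.
Qed.

Definition move_pos (c : option bool) (ih : nat) : nat :=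
  match c with None => ih | Some true => ih.+1 | Some false => ih.-1 end.

(** A carry arrives at bit m iff the m lower bits of [ih] are ones, that is 2^m divides ih + 1; a
    borrow arrives iff they are zeros. *)
Definition carry_at (c : option bool) (ih m : nat) : option bool :=
  match c with
  | None => None
  | Some true => if 2 ^ m %| ih.+1 then Some true else None
  | Some false => if 2 ^ m %| ih then Some false else None
  end.

Lemma bwd_bitE c ih m : (c = Some false -> 0 < ih) ->
  bwd_bit (carry_at c ih m) (bit m ih) = (carry_at c ih m.+1, bit m (move_pos c ih)).
Proof.
case: c => [[]|] //= h.
  rewrite dvdn_exp2S bitS; case: (2 ^ m %| ih.+1); case: (bit m ih) => //.
case: ih h => [/(_ erefl) //|ih _] /=.
by rewrite dvdn_exp2S bitS; case: (2 ^ m %| ih.+1); case: (bit m ih).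
Qed.

(** [hs j] holds the two pending states at the boundary left of position j. Input head and work head
    are treated independently. *)
Lemma bwd_cfg c ih g (hs : nat -> option (nQ M) * option (nQ M)) h1 h2 :
  (c = Some false -> 0 < ih) ->
  (forall j, j < W -> bwd_head (hs j.+1).1 (hs j.+1).2 (h1 j) = (hs j, h2 j)) ->
  (sweep_back step_bwd (Some (c, (hs W).1, (hs W).2))
     [seq Some (Some (bit (W - j.+1) ih, g j, h1 j)) | j <- iota 0 W]).2 =
  [seq Some (Some (bit (W - j.+1) (move_pos c ih), g j, h2 j)) | j <- iota 0 W].
Proof.
move=> cpos hh.
pose st j : bwd_state := Some (carry_at c ih (W - j), (hs j).1, (hs j).2).
have -> : Some (c, (hs W).1, (hs W).2) = st (0 + W).
  by rewrite /st /carry_at add0n subnn !expn0 !dvd1n; case: (c) => [[]|].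
rewrite (@sweep_back_iota _ _ step_bwd st _
  (fun j => Some (Some (bit (W - j.+1) (move_pos c ih), g j, h2 j)))) // => j.
rewrite add0n => /andP[_ jW]; rewrite /st /=.
have -> : W - j = (W - j.+1).+1 by lia.
by rewrite bwd_bitE // hh //; case: (hs j).
Qed.

(** Only the marked cell and, on a right move, its right neighbour change, so the whole pass is
    determined by the local computation at [wh]. *)
Lemma fwd_cfg skip sy q ih wt wh p g' h' (nx : option (nQ M)) (oc : outcome) :
  wh < W -> ih < 2 ^ W -> (nx -> wh.+1 < W) ->
  step_fwd skip sy (wh == 0, ih %/ 2 ^ (W - wh) == 0, None, None) (cfg_letter (q, ih, wt, wh) p wh)
   = ((false, ih %/ 2 ^ (W - wh.+1) == 0, nx, oc), Some (Some (bit (W - wh.+1) ih, g', h'))) ->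
  mealy (step_fwd skip sy) fwd_init (cfg_str (q, ih, wt, wh) p) =
   ((false, ih == 0, None, oc),
    [seq Some (Some (bit (W - j.+1) ih, if j == wh then g' else nth (nblank M) wt j,
        if j == wh then h' else if j == wh.+1 then omap (fun q => (q, ord0)) nx else None))
      | j <- iota 0 W]).
Proof.
move=> whW ihW nxW e.
pose st j : fwd_state := (j == 0, ih %/ 2 ^ (W - j) == 0, if j == wh.+1 then nx else None,
   if wh < j then oc else None).
have -> : fwd_init = st 0 by rewrite /st /= subn0 divn_small.
rewrite /cfg_str (@mealy_iota _ _ _ st _
  (fun j => Some (Some (bit (W - j.+1) ih, if j == wh then g' else nth (nblank M) wt j,
        if j == wh then h' else if j == wh.+1 then omap (fun q => (q, ord0)) nx else None)))).
  rewrite /st add0n subnn expn0 divn1 whW.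
  have -> : (W == 0) = false by lia.
  case: (W =P wh.+1) => // eW; case: (nx) nxW => // q' /(_ isT); lia.
move=> j; rewrite add0n => /andP[_ jW].
case: (ltngtP j wh) => [lt|gt|->].
- rewrite /st /= (ltn_eqF lt) /= ; have -> : (j == wh.+1) = false by lia.
  have -> : (wh < j) = false by lia.
  have -> : (j.+1 == wh.+1) = false by lia.
  have -> : (wh < j.+1) = false by lia.
  by rewrite zero_prefix // eqn_leq leqNgt lt andbF.
- rewrite {1}/st /= gt; have -> : (j == wh) = false by lia.
  rewrite zero_prefix //.
  have -> : st j.+1 = (false, ih %/ 2 ^ (W - j.+1) == 0, None, oc).
    by rewrite /st /= eqSS (gtn_eqF gt) ltnS (ltnW gt).
  by case: eqP => // _; case: (nx).
- rewrite /st (ltn_eqF (ltnSn wh)) ltnn e eqxx.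
  by rewrite ltnSn.
Qed.

Lemma step_str_top skip sy : step_str skip sy top = top.
Proof.
have fwd first n : exists first', mealy (step_fwd skip sy) (first, true, None, None)
    (nseq n (Some None)) = ((first', true, None, None), nseq n (Some None)).
  elim: n first => [|n IH] first; first by exists first.
  by have [f e] := IH false; exists f; rewrite /= e.
have bwd n : sweep_back step_bwd (Some (None, None, None)) (nseq n (Some None)) =
    (Some (None, None, None), nseq n (Some None)).
  by elim: n => //= n ->.
by rewrite /step_str /top; have [f ->] := fwd true W; rewrite /= bwd.
Qed.

Lemma sweep_back_top w : size w = W -> (sweep_back step_bwd None w).2 = top.
Proof.
rewrite /top => <-.
suff -> : sweep_back step_bwd None w = (None, nseq (size w) (Some None)) by [].
by elim: w => //= d w ->.
Qed.

Lemma step_str_acc skip sy q ih wt wh p : wh < W -> ih < 2 ^ W -> nacc q ->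
  step_str skip sy (cfg_str (q, ih, wt, wh) p) = top.
Proof.
move=> whW ihW acc; rewrite /step_str.
have := @fwd_cfg skip sy q ih wt wh p (nth (nblank M) wt wh) (Some (q, p)) None (Some None) whW ihW.
move=> -> //; first by rewrite /= sweep_back_top // size_map size_iota.
by rewrite /= eqxx /= acc zero_prefix.
Qed.

Lemma step_str_id skip sy q ih wt wh p p' : wh < W -> ih < 2 ^ W ->
  step_fwd skip sy (wh == 0, ih %/ 2 ^ (W - wh) == 0, None, None) (cfg_letter (q, ih, wt, wh) p wh)
   = ((false, ih %/ 2 ^ (W - wh.+1) == 0, None, None),
      Some (Some (bit (W - wh.+1) ih, nth (nblank M) wt wh, Some (q, p')))) ->
  step_str skip sy (cfg_str (q, ih, wt, wh) p) = cfg_str (q, ih, wt, wh) p'.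
Proof.
move=> whW ihW e; rewrite /step_str (fwd_cfg whW ihW _ e) //=.
rewrite (@bwd_cfg None ih _ (fun=> (None, None)) _
  (fun j => if j == wh then Some (q, p') else None)) //.
  by apply: eq_map => j /=; case: eqP => // ->.
by move=> j _; case: eqP => // _; case: eqP.
Qed.

Lemma step_str_skip sy q ih wt wh (p : 'I_branching.+1) : wh < W -> ih < 2 ^ W -> ~~ nacc q ->
  step_str true sy (cfg_str (q, ih, wt, wh) p) = cfg_str (q, ih, wt, wh) (inord p.+1).
Proof.
move=> whW ihW /negPf nac; apply: step_str_id => //.
by rewrite /= eqxx /= nac zero_prefix.
Qed.

Lemma step_str_none sy q ih wt wh (p : 'I_branching.+1) : wh < W -> ih < 2 ^ W -> ~~ nacc q ->
  onth (ndelta q sy (nth (nblank M) wt wh)) p = None ->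
  step_str false sy (cfg_str (q, ih, wt, wh) p) = cfg_str (q, ih, wt, wh) p.
Proof.
move=> whW ihW /negPf nac e; apply: step_str_id => //.
by rewrite /= eqxx /= nac e zero_prefix.
Qed.

Lemma step_str_move x q ih wt wh (p : 'I_branching.+1) q' g' mi mw : wh < W -> move_w mw wh < W ->
  ih <= (size x).+1 -> (size x).+1 < 2 ^ W -> ~~ nacc q ->
  onth (ndelta q (in_sym x ih) (nth (nblank M) wt wh)) p = Some (q', g', mi, mw) ->
  step_str false (in_sym x ih) (cfg_str (q, ih, wt, wh) p) =
  cfg_str (q', move_in x mi ih, set_nth (nblank M) wt wh g', move_w mw wh) ord0.
Proof.
move=> whW mwW ihx xW /negPf nac e.
have ihW : ih < 2 ^ W by lia.
pose lm := if mw is MvL then if wh == 0 then None else Some q' else None.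
pose nx := if mw is MvR then Some q' else None.
pose h' := match mw with MvR => None | MvS => Some (q', ord0)
  | MvL => if wh == 0 then Some (q', ord0) else Some (q, p) end.
rewrite /step_str.
have := @fwd_cfg false (in_sym x ih) q ih wt wh p g' h' nx (Some (Some (dir mi, lm))) whW ihW.
move=> -> //; first last.
- rewrite /= eqxx /= nac e zero_prefix // /h' /nx /lm.
  by case: (mw) => //; case: ifP.
- by rewrite /nx; case: (mw) mwW.
pose c := match dir mi with
   | None => None
   | Some true => if ih == (size x).+1 then None else Some true
   | Some false => if ih == 0 then None else Some false
   end.
have -> : step_turn (in_sym x ih) (false, ih == 0, None, Some (Some (dir mi, lm))) =
    Some (c, lm, None).
  rewrite /step_turn /c; case: (dir mi) => [[]|] //.
  rewrite /in_sym; case: (ih =P 0) => [->|/eqP ih0] //=.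
  by rewrite lt0n ih0 /=; case: (leqP ih (size x)) => h; case: (ih =P _) => //; lia.
have -> : move_in x mi ih = move_pos c ih.
  rewrite /c; case: (mi) => //=; first by case: eqP => [->|].
  by case: eqP => [->|ne] /=; lia.
(* Coming from the right, the new state waits in the first component up to the marked cell, and in
   the second for the one boundary before its left neighbour. *)
pose hs j : option (nQ M) * option (nQ M) :=
  (if wh < j then lm else None, if j == wh then lm else None).
have -> : Some (c, lm, None) = Some (c, (hs W).1, (hs W).2).
  by rewrite /hs whW gtn_eqF.
rewrite (@bwd_cfg c ih _ hs _ (fun j => if j == move_w mw wh then Some (q', ord0) else None)).
- by apply: eq_map => j /=; rewrite nth_set_nth.
- by rewrite /c; case: (dir mi) => [[]|] //; case: eqP => // ih0 _; lia.
move=> j jW; rewrite /hs ltnS.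
case: (ltngtP j wh) => [lt|gt|->].
- have -> : (j.+1 == wh) = (j == wh.-1) by lia.

  rewrite /bwd_head /lm /nx; have -> : (j == wh.+1) = false by lia.
  have -> : (wh == 0) = false by lia.
  by case: (mw) => /=; case: eqP => //; case: eqP => //; lia.
- have -> : (j.+1 == wh) = false by lia.
  have e1 : (j == wh.-1) = false by lia.
  have e2 : (j == wh) = false by lia.
  by rewrite /bwd_head /lm /nx; case: (mw); rewrite /= ?e1 ?e2; case: (wh == 0); case: (j == wh.+1).
- rewrite (gtn_eqF (ltnSn wh)) /bwd_head /lm /nx /h'.
  by case: (mw) => /=; rewrite ?eqxx //; case: (wh) => [|m] //=; rewrite ?eqxx //;
    case: eqP => //; lia.
Qed.

End ConfigStrings.

Lemma nseq_map (A : Type) (a : A) n : nseq n a = map (fun=> a) (iota 0 n).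
Proof. by elim: n 0 => //= n IH m; rewrite (IH m.+1). Qed.

Lemma head_pos_nseq M n : @head_pos M (nseq n None) = 0.
Proof.
rewrite /head_pos map_nseq /bits_val rev_nseq.
by elim: n => //= n ->.
Qed.

Lemma step_str_bot M W skip : 0 < W ->
  step_str skip None (bot M W) = cfg_str W (ninit M) ord0.
Proof.
move=> W0; rewrite /step_str /bot nseq_map.
pose st j : fwd_state M :=
  (j == 0, true, None, if 0 < j then Some (Some (Some true, None)) else None).
rewrite -[fwd_init M]/(st 0).
rewrite (@mealy_iota _ _ _ st _ (fun j => Some (Some (bit (W - j.+1) 0, nblank M,
   if j == 0 then Some (nstart M, ord0) else None)))); last first.
  by move=> j _; rewrite /st /bit /= div0n.
rewrite add0n /st W0 (gtn_eqF W0) /step_turn /=.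
(* The all-zero position is raised by a carry to 1, where [ninit] puts the input head. *)
rewrite (@bwd_cfg M W W0 (Some true) 0 (fun=> nblank M) (fun=> (None, None)) _
  (fun j => if j == 0 then Some (nstart M, ord0) else None)) //.
  by apply: eq_map => j /=; rewrite nth_nil.
Qed.

Lemma onthP (T : Type) (a : T) s : List.In a s <-> exists2 i, i < size s & onth s i = Some a.
Proof.
elim: s => [|b s IH] /=; first by split=> // -[].
split.
  case=> [->|/IH[i lt e]]; first by exists 0.
  by exists i.+1.
by case=> -[|i] lt /= e; [left; case: e | right; apply/IH; exists i].
Qed.

(** * Acceptance as reachability of the top string from the bottom string *)

Section Acceptance.
Variables (M : NTM) (x : seq bool) (W : nat).
Hypothesis W_gt0 : 0 < W.
Hypothesis reach_lt : forall k : ncfg M, nreach x k -> k.2 < W.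
Hypothesis size_lt : (size x).+1 < 2 ^ W.

Definition str_step (b : bool) (w : seq (letter M)) : seq (letter M) :=
  step_str b (in_sym x (head_pos w)) w.

Definition accepts : Prop := exists k : ncfg M, nreach x k /\ nacc k.1.1.1.

Definition reachable_str (w : seq (letter M)) : Prop :=
  (w = top M W /\ accepts) \/ exists k p, nreach x k /\ w = cfg_str W k p.

Lemma reach_ih (k : ncfg M) : nreach x k -> k.1.1.2 <= (size x).+1.
Proof.
elim=> {k} [//|[[[q ih] wt] wh] k' _ /= ihx [q' [g [mi [mw [_ ->]]]]]] /=.
by case: mi => //=; [lia | rewrite geq_minr].
Qed.

Lemma str_step_cfg q ih wt wh p : nreach x (q, ih, wt, wh) ->
  str_step^~ (cfg_str W (q, ih, wt, wh) p) =1
  (fun b => step_str b (in_sym x ih) (cfg_str W (q, ih, wt, wh) p)).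
Proof.
move=> r b; rewrite /str_step head_pos_cfg //.
by have := reach_ih r; rewrite /=; lia.
Qed.

Lemma str_step_reachable b w : w = bot M W \/ reachable_str w -> reachable_str (str_step b w).
Proof.
case=> [->|[[-> acc]|[[[[q ih] wt] wh] [p [r ->]]]]].
- right; exists (ninit M), ord0; split; first exact: nreach0.
  by rewrite /str_step head_pos_nseq step_str_bot.
- by left; rewrite /str_step step_str_top.
have whW := reach_lt r; rewrite /= in whW.
have ihx := reach_ih r; rewrite /= in ihx.
have ihW : ih < 2 ^ W by lia.
rewrite (str_step_cfg p r).
have [acc|nac] := boolP (nacc q).
  by left; rewrite step_str_acc //; split=> //; exists (q, ih, wt, wh).
case: b; first by right; exists (q, ih, wt, wh), (inord p.+1); rewrite step_str_skip.
case e: (onth (ndelta q (in_sym x ih) (nth (nblank M) wt wh)) p)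
  => [[[[q' g'] mi] mw]|]; last first.
  by right; exists (q, ih, wt, wh), p; rewrite step_str_none.
have r' : nreach x (q', move_in x mi ih, set_nth (nblank M) wt wh g', move_w mw wh).
  apply: nreachS r _; exists q', g', mi, mw; split=> //.
  apply/onthP; exists p => //; rewrite ltnNge; apply/negP => le.
  by move: e; rewrite onth_default.
right; eexists; exists ord0; split; first exact: r'.
by apply: step_str_move => //; exact: (reach_lt r').
Qed.

Lemma run_reachable b bs : reachable_str (foldl (fun w b => str_step b w) (bot M W) (b :: bs)).
Proof.
elim/last_ind: bs => [|bs b' IH]; first by apply: str_step_reachable; left.
by rewrite -rcons_cons foldl_rcons; apply: str_step_reachable; right.
Qed.

Lemma bot_not_reachable : ~ reachable_str (bot M W).
Proof.
by case=> [[]|[[[[q ih] wt] wh] [p [_]]]]; rewrite /bot /top /cfg_str; case: (W) W_gt0.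
Qed.

Lemma top_reachable : reachable_str (top M W) -> accepts.
Proof.
case=> [[] //|[[[[q ih] wt] wh] [p [_]]]]; rewrite /top /cfg_str; case: (W) W_gt0 => //.
Qed.

Lemma skip_run q ih wt wh p : nreach x (q, ih, wt, wh) -> ~~ nacc q -> p <= branching M ->
  foldl (fun w b => str_step b w) (cfg_str W (q, ih, wt, wh) ord0) (nseq p true) =
  cfg_str W (q, ih, wt, wh) (inord p).
Proof.
move=> r nac; have whW := reach_lt r; rewrite /= in whW.
have ihx := reach_ih r; rewrite /= in ihx.
have ihW : ih < 2 ^ W by lia.
elim: p => [_|p IH le].
  by congr cfg_str; apply: val_inj; rewrite /= inordK.
have -> : nseq p.+1 true = nseq p true ++ [:: true] by rewrite -[in LHS]addn1 nseqD.
rewrite foldl_cat IH; last exact: ltnW.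
by rewrite /= (str_step_cfg _ r) step_str_skip // inordK // ltnS ltnW.
Qed.

(** An accepting configuration steps to [top] and no longer follows M; hence the first alternative
    in [main], for computations that continue after acceptance. *)
Lemma accepts_run : accepts -> exists bs,
  foldl (fun w b => str_step b w) (bot M W) bs = top M W.
Proof.
have main k : nreach x k -> (exists bs, foldl (fun w b => str_step b w) (bot M W) bs = top M W) \/
    exists bs, foldl (fun w b => str_step b w) (bot M W) bs = cfg_str W k ord0.
  elim=> {k} [|[[[q ih] wt] wh] k' r [IH|[bs e]] st].
  - right; exists [:: true]; rewrite /= /str_step head_pos_nseq step_str_bot //.
  - by left.
  have whW := reach_lt r; rewrite /= in whW.
  have ihx := reach_ih r; rewrite /= in ihx.
  have ihW : ih < 2 ^ W by lia.
  have [acc|nac] := boolP (nacc q).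
    by left; exists (rcons bs true); rewrite foldl_rcons e (str_step_cfg _ r) step_str_acc.
  right; have r' := nreachS r st; case: st => q' [g' [mi [mw [/onthP[p lt ep] ek]]]].
  have le : p <= branching M.
    apply: leq_trans (ltnW lt) _.
    exact: (@leq_bigmax _ (fun p : nQ M * option bool * nG M => size (ndelta p.1.1 p.1.2 p.2))
       (q, in_sym x ih, nth (nblank M) wt wh)).
  (* Transition number p is taken by skipping p times and then executing. *)
  exists (rcons (bs ++ nseq p true) false); rewrite foldl_rcons foldl_cat e skip_run //.
  rewrite (str_step_cfg _ r) ek (@step_str_move M W W_gt0 x q ih wt wh _ q' g' mi mw) //.
    by rewrite ek in r'; exact: (reach_lt r').
  by rewrite inordK.
case=> -[[[q ih] wt] wh] [r acc].
case: (main _ r) => [//|[bs e]]; exists (rcons bs true).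
have ihx := reach_ih r; rewrite /= in ihx.
rewrite foldl_rcons e (str_step_cfg _ r) step_str_acc //; first exact: (reach_lt r).
lia.
Qed.

Let D0 : letter M := None.
Definition num_strs : nat := (size (letters M)).+1 ^ W.
Definition num_step (b : bool) (v : nat) : nat :=
  rank D0 (letters M) W (str_step b (nth [::] (strs D0 (letters M) W) v)).

Lemma size_str_step b w : size (str_step b w) = size w.
Proof. exact: size_step_str. Qed.

Lemma num_strs_gt1 : 1 < num_strs.
Proof.
clear reach_lt size_lt.
rewrite /num_strs /letters size_rcons; case: (W) W_gt0 => // m _.
by rewrite expnS; have := expn_gt0 (size [seq Some (Some c) | c <- enum {: cfg_cell M}]).+2 m; lia.
Qed.

Lemma num_step_lt b v : v < num_strs -> num_step b v < num_strs.
Proof.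
move=> lt; apply: (rank_lt (@mem_letters M)).
by rewrite size_str_step; apply: (size_unrank (@mem_letters M)).
Qed.

(** [Some None] was placed last in [letters], so [top] is the string on which the odometer
    overflows, and its rank is the largest. *)
Lemma rank_top : rank D0 (letters M) W (top M W) = num_strs.-1.
Proof.
clear reach_lt size_lt.
have e : mealy (inc_digit D0 (letters M)) true (top M W) = (true, bot M W).
  rewrite /top /bot; elim: (W) => //= m IH.
  have -> : next_digit D0 (letters M) (Some None) = None.
    rewrite /next_digit.
    have -> : Some None = last D0 (letters M) by rewrite /letters last_rcons.
    by rewrite index_last ?letters_uniq //= ltnn.
  by rewrite IH.
have szt : size (top M W) = W by rewrite size_nseq.
have := rank_inc (letters_uniq M) (@mem_letters M) szt.
rewrite e /= rank_zero; have := rank_lt (@mem_letters M) szt.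
rewrite -/num_strs; move: (rank _ _ _ _) => r lt e0.
have := num_strs_gt1; case: (ltnP r.+1 num_strs) => h; last by lia.
by rewrite modn_small in e0.
Qed.

Lemma num_run bs : foldl (fun v b => num_step b v) 0 bs =
  rank D0 (letters M) W (foldl (fun w b => str_step b w) (bot M W) bs) /\
  size (foldl (fun w b => str_step b w) (bot M W) bs) = W.
Proof.
elim/last_ind: bs => [|bs b [IH1 IH2]]; first by rewrite /= /bot rank_zero size_nseq.
rewrite !foldl_rcons size_str_step IH1 IH2; split=> //.
by rewrite /num_step (unrankK (@mem_letters M)).
Qed.

Lemma num_step_max b : num_step b num_strs.-1 = num_strs.-1.
Proof.
by rewrite -rank_top /num_step (unrankK (@mem_letters M)) ?size_nseq // /str_step step_str_top.
Qed.

(** After at least one step the string is [top] or a configuration, never the source string. This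
    discharges the hypothesis that keeps level sizes below P. *)
Lemma level_num_0 k : ~~ level num_strs num_step k.+1 0.
Proof.
apply/negP => /(levelP num_strs_gt1 num_step_lt)[[|b bs] [// sz]].
have [-> sz2] := num_run (b :: bs).
have -> : 0 = rank D0 (letters M) W (bot M W) by rewrite /bot rank_zero.
move/(rank_inj (@mem_letters M) sz2); rewrite size_nseq => /(_ erefl) e.
by apply: bot_not_reachable; rewrite -e; apply: run_reachable.
Qed.

Lemma level_accepts : level num_strs num_step num_strs num_strs.-1 <-> accepts.
Proof.
split.
  move=> /(levelP num_strs_gt1 num_step_lt)[bs [sz]]; have [-> sz2] := num_run bs.
  rewrite -rank_top => /(rank_inj (@mem_letters M) sz2); rewrite size_nseq => /(_ erefl).
  case: bs {sz sz2} => [|b bs] e.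
    by move: e; rewrite /= /bot /top; case: (W) W_gt0.
  by apply: top_reachable; rewrite -e; apply: run_reachable.
move=> /accepts_run[bs e].
apply: (@level_max _ _ num_strs_gt1 num_step_lt num_step_max (size bs)).
apply/(levelP num_strs_gt1 num_step_lt); exists bs; split=> //.
by have [-> _] := num_run bs; rewrite e rank_top.
Qed.

End Acceptance.

(** * Nodes of the counting graph *)

Lemma mealy_embed (Q Q' C : Type) (e : Q -> Q') (f : Q -> C -> Q * C) (f' : Q' -> C -> Q' * C) :
  (forall q c, f' (e q) c = (e (f q c).1, (f q c).2)) ->
  forall q l, mealy f' (e q) l = (e (mealy f q l).1, (mealy f q l).2).
Proof.
move=> h q l; elim: l q => //= c l IH q; rewrite h; case: (f q c) => q1 c1 /=.
by rewrite IH; case: (mealy f q1 l).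
Qed.

Lemma mealy_id (Q C : Type) (q : Q) (l : seq C) : mealy (fun q c => (q, c)) q l = (q, l).
Proof. by elim: l => //= c l ->. Qed.

Lemma mealy_map (Q C : Type) (g : C -> C) (q : Q) (l : seq C) :
  mealy (fun q c => (q, g c)) q l = (q, map g l).
Proof. by elim: l => //= c l ->. Qed.

Lemma sweep_back_id (Q C : Type) (q : Q) (l : seq C) : sweep_back (fun q c => (q, c)) q l = (q, l).
Proof. by elim: l => //= c l ->. Qed.

Section Columns.
Variable M : NTM.

(* The contents of all registers at one position: the registers are stored as parallel tracks. *)
Definition column := (nregs.-tuple (letter M)).
Definition col_get (r : nat) (c : column) : letter M := nth None c r.
Definition col_set (c : column) (r : nat) (a : letter M) : column :=
  [tuple if (k : nat) == r then a else tnth c k | k < nregs].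
Definition col_move (g : nat -> nat) (c : column) : column :=
  [tuple col_get (g k) c | k < nregs].
Definition track (r : nat) (cols : seq column) : seq (letter M) := map (col_get r) cols.

Lemma col_getE (f : 'I_nregs -> letter M) r (lt : r < nregs) :
  col_get r [tuple f k | k < nregs] = f (Ordinal lt).
Proof. by rewrite /col_get -[r]/(val (Ordinal lt)) -tnth_nth tnth_mktuple. Qed.

Lemma col_get_set c r s a : s < nregs ->
  col_get s (col_set c r a) = if s == r then a else col_get s c.
Proof. by move=> lt; rewrite (col_getE _ lt) /= /col_get (tnth_nth None). Qed.

Lemma col_get_move g c r : r < nregs -> col_get r (col_move g c) = col_get (g r) c.
Proof. by move=> lt; rewrite (col_getE _ lt). Qed.

Definition on_reg (Q : Type) (h : Q -> letter M -> Q * letter M) (r : nat) (q : Q) (c : column) :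
    Q * column :=
  let: (q', a) := h q (col_get r c) in (q', col_set c r a).

Lemma mealy_on_reg (Q : Type) (h : Q -> letter M -> Q * letter M) r q cols : r < nregs ->
  (mealy (on_reg h r) q cols).1 = (mealy h q (track r cols)).1 /\
  forall s, s < nregs -> track s (mealy (on_reg h r) q cols).2 =
    if s == r then (mealy h q (track r cols)).2 else track s cols.
Proof.
move=> rlt; elim: cols q => [|c cols IH] q /=; first by split=> // s _; case: eqP.
have -> : on_reg h r q c = let: (q', a) := h q (col_get r c) in (q', col_set c r a) by [].
case: (h q (col_get r c)) => q1 a.
have [e1 e2] := IH q1; move: e1 e2; case: (mealy _ _ cols) => q2 l2 /=.
case: (mealy h _ _) => q3 l3 /= -> e2; split=> // s slt.
by rewrite /= e2 // col_get_set //; case: eqP.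
Qed.

Lemma sweep_back_on_reg (Q : Type) (h : Q -> letter M -> Q * letter M) r q cols : r < nregs ->
  (sweep_back (on_reg h r) q cols).1 = (sweep_back h q (track r cols)).1 /\
  forall s, s < nregs -> track s (sweep_back (on_reg h r) q cols).2 =
    if s == r then (sweep_back h q (track r cols)).2 else track s cols.
Proof.
move=> rlt; elim: cols => [|c cols [e1 e2]] /=; first by split=> // s _; case: eqP.
move: e1 e2; case: (sweep_back _ _ cols) => q2 l2 /=.
case: (sweep_back h _ _) => q3 l3 /= -> e2.
have -> : on_reg h r q3 c = let: (q', a) := h q3 (col_get r c) in (q', col_set c r a) by [].
case: (h q3 (col_get r c)) => q1 a; split=> // s slt.
by rewrite /= e2 // col_get_set //; case: eqP.
Qed.

(** The Boolean is the equality flag of [IfEq] and the carry of [Inc]; both start as true. *)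
Definition instr_state := (bool * fwd_state M)%type.
Definition instr_init : instr_state := (true, fwd_init M).

Definition inc_state (q : instr_state) (a : letter M) : instr_state * letter M :=
  let: (cy, a') := inc_digit None (letters M) q.1 a in ((cy, q.2), a').

Definition step_state (b : bool) (sy : option bool) (q : instr_state) (a : letter M) :
    instr_state * letter M :=
  let: (s, a') := step_fwd b sy q.2 a in ((q.1, s), a').

Definition instr_fwd (I : instr) (sy : option bool) (q : instr_state) (c : column) :
    instr_state * column :=
  match I with
  | IfEq r s _ _ => ((q.1 && (col_get r c == col_get s c), q.2), c)
  | Inc r _ => on_reg inc_state r q c
  | Move g _ => (q, col_move g c)
  | Step b _ => on_reg (step_state b sy) rg_w q c
  | _ => (q, c)
  end.

Definition instr_turn (I : instr) (sy : option bool) (q : instr_state) : bwd_state M :=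
  if I is Step _ _ then step_turn sy q.2 else None.

Definition instr_bwd (I : instr) (s : bwd_state M) (c : column) : bwd_state M * column :=
  if I is Step _ _ then on_reg (@step_bwd M) rg_w s c else (s, c).

Definition instr_exec (I : instr) (sy : option bool) (cols : seq column) : bool * seq column :=
  let: (q, c1) := mealy (instr_fwd I sy) instr_init cols in
  (q.1, (sweep_back (instr_bwd I) (instr_turn I sy q) c1).2).

Definition next_lab (I : instr) (b : bool) (l : nat) (flag : bool) : nat :=
  match I with
  | Fork l1 l2 => if b then l1 else l2
  | IfEq _ _ l1 l2 => if flag then l1 else l2
  | Inc _ l' | Move _ l' | Step _ l' => l'
  | Stuck => l
  end.

Lemma next_lab_lt b l flag : l < nlabs -> next_lab (prog l) b l flag < nlabs.
Proof. by do 38 (case: l => [|l]; first by case: b; case: flag); case: l. Qed.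

Definition instr_sym (x : seq bool) (I : instr) (cols : seq column) : option bool :=
  if I is Step _ _ then in_sym x (head_pos (track rg_w cols)) else None.

Definition node := ('I_nlabs * seq column)%type.

Definition node_step (x : seq bool) (b : bool) (st : node) : node :=
  let: (l, cols) := st in
  let I := prog l in
  let: (flag, cols') := instr_exec I (instr_sym x I cols) cols in
  (inord (next_lab I b l flag), cols').

Definition wf_instr (I : instr) : bool :=
  match I with
  | IfEq r s _ _ => (r < nregs) && (s < nregs)
  | Inc r _ => r < nregs
  | Move g _ => all (fun r => g r < nregs) (iota 0 nregs)
  | _ => true
  end.

Lemma wf_prog l : wf_instr (prog l).
Proof. by do 36 (case: l => [|l]; first by []). Qed.

Lemma size_instr_exec I sy cols : size (instr_exec I sy cols).2 = size cols.
Proof.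
rewrite /instr_exec; have := size_mealy (instr_fwd I sy) instr_init cols.
by case: (mealy _ _ _) => q c1 /= <-; rewrite size_sweep_back.
Qed.

Lemma track_ifeq r s l1 l2 sy q cols :
  mealy (instr_fwd (IfEq r s l1 l2) sy) q cols =
  ((q.1 && (track r cols == track s cols), q.2), cols).
Proof.
elim: cols q => [|c cols IH] [q1 q2] /=; first by rewrite andbT.
by rewrite IH /= eqseq_cons andbA.
Qed.

(** * The string flowchart simulates the numerical one *)

Section Counting.
Variables (x : seq bool) (W : nat).
Hypothesis W_gt0 : 0 < W.
Hypothesis reach_lt : forall k : ncfg M, nreach x k -> k.2 < W.
Hypothesis size_lt : (size x).+1 < 2 ^ W.

Let rk := rank (None : letter M) (letters M) W.
Let P := num_strs M W.
Let f := @num_step M x W.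

Definition node_sim (st : node) (s : rstate) : Prop :=
  [/\ s.1 = st.1, size st.2 = W & forall r, r < nregs -> s.2 r = rk (track r st.2)].

(** Equality tests agree because [rank] is injective on strings of length W, increments agree by
    [rank_inc], and [Step] agrees because [num_step] is [str_step] conjugated by [rank]. *)
Lemma node_sim_step b st s : node_sim st s -> node_sim (node_step x b st) (rexec P f b s).
Proof.
case: st s => [l cols] [l' rho] [/= -> sz er].
have szt r : size (track r cols) = W by rewrite size_map.
have := size_instr_exec (prog l) (instr_sym x (prog l) cols) cols.
have := wf_prog l; have lt := next_lab_lt b _ (ltn_ord l).
case eI: (prog l) lt => [l1 l2|r s l1 l2|r l1|g l1|b' l1|] lt /=.
- rewrite /instr_exec /= mealy_id sweep_back_id /= => _ _; split=> //=.
  by rewrite inordK // lt.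
- case/andP=> rlt slt; rewrite /instr_exec track_ifeq sweep_back_id /= => _; split=> //=.
  rewrite inordK; last by apply: (lt _).
  rewrite !er //; case: eqP => [/(rank_inj (@mem_letters M) (szt _) (szt _)) ->|ne].
    by rewrite eqxx.
  by case: eqP => // e; case: ne; rewrite e.
- move=> rlt; rewrite /instr_exec.
  have [e1 e2] := mealy_on_reg inc_state instr_init cols rlt.
  have e3 : mealy inc_state instr_init (track r cols) =
     (((mealy (inc_digit None (letters M)) true (track r cols)).1, fwd_init M),
      (mealy (inc_digit None (letters M)) true (track r cols)).2).
    apply: (@mealy_embed _ _ _ (fun c => (c, fwd_init M))) => q c.
    by rewrite /inc_state /=; case: (inc_digit _ _ _ _).
  have -> : instr_fwd (Inc r l1) (instr_sym x (Inc r l1) cols) = on_reg inc_state r by [].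
  move: e1 e2; rewrite e3 /=.
  case: (mealy (on_reg inc_state r) _ _) => q c1 /= _ e2.
  rewrite sweep_back_id /= => szc; split=> //=; first by rewrite inordK // (lt true).
    by rewrite szc.
  move=> s slt; rewrite e2 // /set_reg; case: eqP => [_|_]; last exact: er.
  by rewrite er // /rk (rank_inc (letters_uniq M) (@mem_letters M)).
- move=> _; rewrite /instr_exec /= mealy_map sweep_back_id /= => szc; split=> //=.
  + by rewrite inordK // (lt true).
  + by rewrite szc.
  move=> r rlt; rewrite er; last first.
    by have := wf_prog l; rewrite eI => /allP; apply; rewrite mem_iota.
  congr rk; rewrite /track -map_comp; apply: eq_map => c /=.
  by rewrite col_get_move.
- rewrite /instr_exec /=.
  set sy := in_sym _ _.
  have wlt : rg_w < nregs by [].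
  have [e1 e2] := mealy_on_reg (step_state b' sy) instr_init cols wlt.
  have e3 : mealy (step_state b' sy) instr_init (track rg_w cols) =
     ((true, (mealy (step_fwd b' sy) (fwd_init M) (track rg_w cols)).1),
      (mealy (step_fwd b' sy) (fwd_init M) (track rg_w cols)).2).
    apply: (@mealy_embed _ _ _ (fun c => (true, c))) => q c.
    by rewrite /step_state /=; case: (step_fwd _ _ _ _).
  have -> : instr_fwd (Step b' l1) sy = on_reg (step_state b' sy) rg_w by [].
  have -> : instr_bwd (Step b' l1) = on_reg (@step_bwd M) rg_w by [].
  move: e1 e2; rewrite e3 /=.
  case: (mealy (on_reg (step_state b' sy) rg_w) _ _) => q c1 /= -> e2.
  have [e4 e5] := sweep_back_on_reg (@step_bwd M)
    (step_turn sy (mealy (step_fwd b' sy) (fwd_init M) (track rg_w cols)).1) c1 wlt.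
  move=> _; case: (sweep_back _ _ _) e5 => q2 c2 /= e5 szc.
  split=> //=; first by rewrite inordK // (lt true).
    by rewrite szc.
  move=> s slt; rewrite e5 // /set_reg; case: eqP => [_|ns]; last first.
    by rewrite e2 //; case: eqP => // _; apply: er.
  rewrite e2 // eqxx er // /f /num_step (unrankK (@mem_letters M)) //; congr rk.
  by rewrite /str_step /step_str -/sy; case: (mealy _ _ _).
- rewrite /instr_exec /= mealy_id sweep_back_id /= => _ _; split=> //=.
  by rewrite inord_val.
Qed.

(** Track [rg_max] spells [top], of rank P-1; every other track spells [bot], of rank 0. *)
Definition col_init : column := [tuple if (k : nat) == rg_max then Some None else None | k < nregs].
Definition node_init : node := (ord0, nseq W col_init).
Definition is_bad (st : node) : bool := st.1 == lab_bad :> nat.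

Lemma node_sim_run bs st s : node_sim st s ->
  node_sim (run_from (node_step x) st bs) (run_from (rexec P f) s bs).
Proof. by elim: bs st s => [//|b bs IH] st s h /=; apply: IH; apply: node_sim_step. Qed.

Lemma bad_iff_rejects : (exists bs, is_bad (run_from (node_step x) node_init bs)) <-> ~ accepts M x.
Proof.
pose rho r := rk (track r (nseq W col_init)).
have sim0 : node_sim node_init (0, rho) by split=> //; rewrite size_nseq.
have r0 r : r < rg_max -> rho r = 0.
  move=> lt; rewrite /rho /rk /track map_nseq.
  by rewrite (col_getE _ (ltn_trans lt (ltnSn rg_max))) (ltn_eqF lt) rank_zero.
have rmax : rho rg_max = P.-1.
  rewrite /rho /rk /track map_nseq (col_getE _ (isT : rg_max < nregs)) /=.
  exact: (rank_top M W_gt0).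
rewrite -(level_accepts W_gt0 reach_lt size_lt).
split=> [[bs bad]|nl].
  have [e _ _] := node_sim_run bs sim0.
  apply/negP; apply: (@counting_sound P f (num_strs_gt1 M W_gt0) (@num_step_lt M x W)
    (level_num_0 W_gt0 reach_lt size_lt) rho bs).
    by split; [exact: r0 | exact: rmax | split; apply: r0].
  by rewrite e; apply/eqP.
have [||bs bad] := @counting_complete P f (num_strs_gt1 M W_gt0) (@num_step_lt M x W)
  (@num_step_max M x W W_gt0) (level_num_0 W_gt0 reach_lt size_lt) rho.
- by do !split; try exact: rmax; apply: r0.
- exact/negP.
exists bs; have [e _ _] := node_sim_run bs sim0.
by rewrite /is_bad -e bad.
Qed.

End Counting.
End Columns.

(** * The circuit *)

(** All codes have the same length, so concatenations decode uniquely. *)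
Definition onehot (T : finType) (a : T) : seq bool := [seq a == b | b <- enum T].

Lemma onehot_inj (T : finType) : injective (@onehot T).
Proof.
move=> a b /eq_in_map/(_ a); rewrite mem_enum => /(_ isT).
by rewrite eqxx => /esym/eqP.
Qed.

Lemma size_onehot (T : finType) (a : T) : size (onehot a) = #|T|.
Proof. by rewrite size_map -cardE. Qed.

Lemma flatten_onehot_inj (T : finType) (s t : seq T) : size s = size t ->
  flatten (map (@onehot T) s) = flatten (map (@onehot T) t) -> s = t.
Proof.
elim: s t => [|a s IH] [|b t] //= [sz] /eqP; rewrite eqseq_cat ?size_onehot //.
by case/andP=> /eqP/onehot_inj -> /eqP/(IH _ sz) ->.
Qed.

Section EnumDigits.
Variables (T : finType) (a : T).
Definition digit0 : T := head a (enum T).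
Definition digits : seq T := behead (enum T).

Lemma digitsE : digit0 :: digits = enum T.
Proof.
rewrite /digit0 /digits; have : a \in enum T by rewrite mem_enum.
by case: (enum T).
Qed.

Lemma digits_uniq : uniq (digit0 :: digits).
Proof. by rewrite digitsE enum_uniq. Qed.

Lemma mem_digits d : d \in digit0 :: digits.
Proof. by rewrite digitsE mem_enum. Qed.

Lemma size_digits : (size digits).+1 = #|T|.
Proof. by rewrite -[LHS]/(size (digit0 :: digits)) digitsE -cardE. Qed.
End EnumDigits.

Section ReductionCircuit.
Variables (M : NTM) (x : seq bool) (W : nat).
Hypothesis W_gt0 : 0 < W.
Hypothesis reach_lt : forall k : ncfg M, nreach x k -> k.2 < W.
Hypothesis size_lt : (size x).+1 < 2 ^ W.

(* Letters of the time stamps; a layer count of [#|tick| ^ W] exceeds the number of nodes. *)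
Definition tick := ('I_nlabs * column M)%type.

Definition col0 : column M := digit0 (col_init M).
Definition cols1 : seq (column M) := digits (column M).
Definition tick0 : tick := @digit0 tick (ord0, col_init M).
Definition ticks1 : seq tick := digits tick.

Definition nodes : seq (node M) :=
  [seq (l, s) | s <- strs col0 cols1 W, l <- enum 'I_nlabs].
Definition times : seq (seq tick) := strs tick0 ticks1 W.
Definition next_time : seq tick -> option (seq tick) := next_str tick0 ticks1.

(** Node and time stamp are interleaved cell by cell, so that one sweep over a tape carrying both
    prints the name. *)
Definition cells_bits (t : seq tick) (s : seq (column M)) : seq bool :=
  flatten [seq onehot p | p <- zip s t].
(** The leading [true] makes the string a canonical binary numeral. *)
Definition name_bits (t : seq tick) (st : node M) : seq bool :=
  true :: onehot st.1 ++ cells_bits t st.2.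
Definition name (t : seq tick) (st : node M) : nat := bits_val (name_bits t st).

Definition reduction_gates : seq gate :=
  layer_gates (node_step x) (@is_bad M) nodes next_time name times.
Definition reduction_circuit : circuit :=
  Circuit (name (nseq W tick0) (node_init M W)) reduction_gates.

Lemma mem_nodes st : (st \in nodes) = (size st.2 == W).
Proof.
rewrite /nodes; apply/allpairsP/idP => [[[s l] /= [sin _ ->]]|].
  by rewrite -(mem_strs (mem_digits (col_init M))).
case: st => l s; rewrite -(mem_strs (mem_digits (col_init M))) => sin.
by exists (s, l); rewrite mem_enum.
Qed.

Lemma mem_times t : (t \in times) = (size t == W).
Proof. exact: (mem_strs (@mem_digits tick (ord0, col_init M))). Qed.

Lemma uniq_nodes : uniq nodes.
Proof.
apply: allpairs_uniq; [exact: (uniq_strs (digits_uniq (col_init M))) |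
  exact: enum_uniq |].
by move=> [a b] [a' b'] _ _ /= [-> ->].
Qed.

Lemma node_step_closed b st : st \in nodes -> node_step x b st \in nodes.
Proof.
rewrite !mem_nodes; case: st => l s /= /eqP sz.
have := size_instr_exec (prog l) (instr_sym x (prog l) s) s.
by case: (instr_exec _ _ _) => fl s' /= ->; rewrite sz.
Qed.

Lemma name_bits_inj t t' st st' : t \in times -> t' \in times -> st \in nodes -> st' \in nodes ->
  name_bits t st = name_bits t' st' -> t = t' /\ st = st'.
Proof.
rewrite !mem_times !mem_nodes => /eqP st1 /eqP st2.
case: st st' => [l s] [l' s'] /= /eqP ss1 /eqP ss2 [] /eqP.
rewrite eqseq_cat ?size_onehot // => /andP[/eqP/onehot_inj -> /eqP].
move/flatten_onehot_inj; rewrite !size_zip ss1 ss2 st1 st2 => /(_ erefl) e.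
have := congr1 unzip1 e; have := congr1 unzip2 e.
by rewrite !unzip1_zip ?unzip2_zip ?ss1 ?ss2 ?st1 ?st2 // => -> ->.
Qed.

Lemma binary_name t st : binary (name t st) = name_bits t st.
Proof. exact: binary_bits_val. Qed.

Lemma name_injective : name_inj nodes name times.
Proof.
move=> t t' s s' tT t'T sS s'S /(congr1 binary); rewrite !binary_name.
exact: name_bits_inj.
Qed.

Lemma name_above1 : name_gt1 nodes name times.
Proof.
move=> t st _ _; rewrite ltnNge; apply/negP => le.
have : 1 < size (binary (name t st)).
  by rewrite binary_name /= size_cat size_onehot card_ord.
by move: le; case: (name t st) => [|[|]].
Qed.

(** The label alphabet is repeated in each of the W > 0 letters of a time stamp, which outweighs the
    single label of a node. *)
Lemma size_nodes_le : size nodes <= size times.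
Proof.
rewrite /nodes /times size_allpairs !size_strs.
rewrite /cols1 (size_digits (col_init M)) /ticks1 (@size_digits tick (ord0, col_init M)).
rewrite card_prod expnMn -cardE mulnC leq_mul2r; apply/orP; right.
by rewrite -[X in X <= _]expn1 leq_exp2l // card_ord.
Qed.

Lemma reduction_correct :
  MC (fun o => o = ODiv) (to_bits (enc_instance reduction_circuit 1)) <-> accepts M x.
Proof.
have ch : chain next_time times.
  exact: (chain_strs (@digits_uniq tick (ord0, col_init M))).
have un : uniq times by exact: (uniq_strs (@digits_uniq tick (ord0, col_init M))).
have val := layer_gates_valid (@is_bad M) uniq_nodes node_step_closed ch un
  name_injective name_above1.
have [p et] := head_strs tick0 ticks1 W.
have n0 : node_init M W \in nodes by rewrite mem_nodes size_nseq.
have sem : circ_val reduction_circuit 1 <->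
    ~ exists bs, is_bad (run_from (node_step x) (node_init M W) bs).
  rewrite /circ_val /= /reduction_gates.
  rewrite (layer_gates_val (@is_bad M) uniq_nodes node_step_closed ch un
    name_injective name_above1 et n0).
  split=> [[_ h] [bs bad]|h].
    have [bs' [e sz]] := run_from_short bs node_step_closed n0.
    have : size bs' <= size p.
      rewrite -ltnS -[(size p).+1]/(size (nseq W tick0 :: p)) -et.
      exact: leq_trans size_nodes_le.
    by move/h; rewrite e bad.
  by split=> // bs _; apply/negP => bad; apply: h; exists bs.
(* [bad_iff_rejects] characterises the negation of acceptance; the double negation is removed
   because acceptance is equivalent to the Boolean [level]. *)
have cor : accepts M x <-> ~ exists bs, is_bad (run_from (node_step x) (node_init M W) bs).
  rewrite (bad_iff_rejects W_gt0 reach_lt size_lt) -(level_accepts W_gt0 reach_lt size_lt).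
  by case: (level _ _ _ _); split=> h; [move=> nh; apply: nh | | | case: h].
rewrite cor -sem; split.
  by case=> C [b [_ [/to_bits_inj/enc_instance_inj[<- <-]]]].
move=> cv; exists reduction_circuit, 1; split=> //; split=> //.
rewrite /= /reduction_gates layer_names mem_cat; apply/orP; left.
by apply: allpairs_f n0; rewrite mem_times size_nseq.
Qed.

End ReductionCircuit.

(** * The transducer *)

Arguments node_step : simpl never.
Opaque to_bits.

Section Transducer.
Variables (M : NTM) (kk : nat).

(** [PApp] and [PInc] measure the input; [PReset] and [PHdr] print the output gate; [PGate] prints a
    gate name. For each successor, [PCopy] copies the node and increments the time stamp, [PRew] and
    [PPos] fetch the input symbol, [PExec] runs the instruction and [PPrint] prints the result;
    their first Boolean is the guessed bit. [PIncC] and [PIncT] advance the enumeration. The label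
    of the current node is kept in the state. *)
Inductive phase :=
  | PStart
  | PApp of 'I_kk.+1
  | PInc of bool
  | PReset
  | PHdr
  | PGate of 'I_nlabs
  | PCopy of bool & 'I_nlabs & bool
  | PRew of bool & 'I_nlabs
  | PPos of bool & 'I_nlabs & bool
  | PPosB of bool & 'I_nlabs & bool & option bool
  | PExec of bool & 'I_nlabs & option bool & instr_state M
  | PExecB of bool & 'I_nlabs & 'I_nlabs & bwd_state M
  | PPrint of bool & 'I_nlabs
  | PIncC of bool
  | PIncT of bool
  | PEnd.

Definition phase_code : Type :=
  'I_kk.+1 + bool + 'I_nlabs + (bool * 'I_nlabs * bool) + (bool * 'I_nlabs) +
  (bool * 'I_nlabs * bool) + (bool * 'I_nlabs * bool * option bool) +
  (bool * 'I_nlabs * option bool * instr_state M) + (bool * 'I_nlabs * 'I_nlabs * bwd_state M) +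
  (bool * 'I_nlabs) + bool + bool + 'I_4.

Definition phase_encode (p : phase) : phase_code :=
  match p with
  | PStart => inr (@Ordinal 4 0 isT)
  | PReset => inr (@Ordinal 4 1 isT)
  | PHdr => inr (@Ordinal 4 2 isT)
  | PEnd => inr (@Ordinal 4 3 isT)
  | PIncT c => inl (inr c)
  | PIncC c => inl (inl (inr c))
  | PPrint b l => inl (inl (inl (inr (b, l))))
  | PExecB b l l' w => inl (inl (inl (inl (inr (b, l, l', w)))))
  | PExec b l sy q => inl (inl (inl (inl (inl (inr (b, l, sy, q))))))
  | PPosB b l z bo => inl (inl (inl (inl (inl (inl (inr (b, l, z, bo)))))))
  | PPos b l z => inl (inl (inl (inl (inl (inl (inl (inr (b, l, z))))))))
  | PRew b l => inl (inl (inl (inl (inl (inl (inl (inl (inr (b, l)))))))))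
  | PCopy b l c => inl (inl (inl (inl (inl (inl (inl (inl (inl (inr (b, l, c))))))))))
  | PGate l => inl (inl (inl (inl (inl (inl (inl (inl (inl (inl (inr l))))))))))
  | PInc c => inl (inl (inl (inl (inl (inl (inl (inl (inl (inl (inl (inr c)))))))))))
  | PApp j => inl (inl (inl (inl (inl (inl (inl (inl (inl (inl (inl (inl j)))))))))))
  end.

Definition phase_decode (c : phase_code) : phase :=
  match c with
  | inr i => nth PStart [:: PStart; PReset; PHdr; PEnd] i
  | inl (inr c) => PIncT c
  | inl (inl (inr c)) => PIncC c
  | inl (inl (inl (inr (b, l)))) => PPrint b l
  | inl (inl (inl (inl (inr (b, l, l', w))))) => PExecB b l l' w
  | inl (inl (inl (inl (inl (inr (b, l, sy, q)))))) => PExec b l sy q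
  | inl (inl (inl (inl (inl (inl (inr (b, l, z, bo))))))) => PPosB b l z bo
  | inl (inl (inl (inl (inl (inl (inl (inr (b, l, z)))))))) => PPos b l z
  | inl (inl (inl (inl (inl (inl (inl (inl (inr (b, l))))))))) => PRew b l
  | inl (inl (inl (inl (inl (inl (inl (inl (inl (inr (b, l, c)))))))))) => PCopy b l c
  | inl (inl (inl (inl (inl (inl (inl (inl (inl (inl (inr l)))))))))) => PGate l
  | inl (inl (inl (inl (inl (inl (inl (inl (inl (inl (inl (inr c))))))))))) => PInc c
  | inl (inl (inl (inl (inl (inl (inl (inl (inl (inl (inl (inl j))))))))))) => PApp j
  end.

Lemma phase_encodeK : cancel phase_encode phase_decode.
Proof. by case. Qed.

HB.instance Definition _ := Finite.copy phase (can_type phase_encodeK).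

(* A digit of the counter that measures the input ([None] on the cells padding its digits), the
   current gate, the successor gate under construction, and a scratch copy of its input head. *)
Definition tcell := (option bool * (column M * tick M) * (column M * tick M) * bool)%type.

Definition bit_syms (l : seq bool) : seq sym := map (fun b => if b then S1 else S0) l.
Definition pair_bits (p : column M * tick M) : seq bool := to_bits (bit_syms (onehot p)).

Definition label0 : 'I_nlabs := @digit0 'I_nlabs ord0.
Definition labels1 : seq 'I_nlabs := digits 'I_nlabs.

Definition name_open (l : 'I_nlabs) : seq sym := S1 :: bit_syms (onehot l).
Definition gate_open (l : 'I_nlabs) : seq sym := SLpar :: name_open l.

Definition final_syms : seq sym :=
  sepby (map enc_gate const_gates) ++ SRpar :: SComma :: enc_num 1 ++ [:: SRpar].

(** Labels run fastest in [nodes]; when they are exhausted, the columns advance. A comma is always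
    due, since the constant gates end the list. *)
Definition after_gate (l : 'I_nlabs) (pre : seq sym) : option (phase * mv * seq bool) :=
  if next_digit label0 labels1 l is Some l' then
    Some (PGate l', MvS, to_bits (pre ++ SComma :: gate_open l'))
  else Some (PIncC true, MvS, to_bits (pre ++ [:: SComma])).

Definition count_turn (sy : option bool) : option (phase * mv * seq bool) :=
  if sy is Some _ then Some (PInc true, MvR, [::]) else Some (PReset, MvS, [::]).

Definition is_step (I : instr) : bool := if I is Step _ _ then true else false.

(** A carry left over in [PCopy] means that the time stamp is the last one, whose good gates are 1 /
    1. [PPos] and [PExec] do not occur at the left end, as [tr_end] replaces them by [PPosB] and
    [PExecB]. *)
Definition tr_turn (s : phase) (sy : option bool) : option (phase * mv * seq bool) :=
  match s with
  | PStart => Some (PApp ord0, MvS, [::])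
  | PApp j => if j < kk then Some (PApp (inord j.+1), MvS, [::]) else count_turn sy
  | PInc c => if c then Some (PApp ord0, MvS, [::]) else count_turn sy
  | PReset => Some (PHdr, MvS, to_bits (SLpar :: name_open ord0))
  | PHdr => Some (PGate label0, MvS, to_bits (gate_open label0))
  | PGate l =>
      if l == lab_bad :> nat then after_gate l [:: S0; SComma; S0; SRpar; SRpar]
      else Some (PCopy true l true, MvS, [::])
  | PCopy b l c =>
      if c then after_gate l [:: S1; SComma; S1; SRpar; SRpar]
      else if is_step (prog l) then Some (PRew b l, MvL, [::])
      else Some (PExec b l None (instr_init M), MvS, [::])
  | PRew b l => if sy is Some _ then Some (PRew b l, MvL, [::]) else Some (PPos b l true, MvS, [::])
  | PPosB b l z _ =>
      if z then Some (PExec b l sy (instr_init M), MvS, [::]) else Some (PPos b l true, MvR, [::])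
  | PExecB b l l' _ => Some (PPrint b l, MvS, to_bits (name_open l'))
  | PPrint b l =>
      if b then Some (PCopy false l true, MvS, to_bits [:: SComma])
      else after_gate l [:: SRpar; SRpar]
  | PIncC c =>
      if c then Some (PIncT true, MvS, [::])
      else Some (PGate label0, MvS, to_bits (gate_open label0))
  | PIncT c =>
      if c then Some (PEnd, MvS, to_bits final_syms)
      else Some (PGate label0, MvS, to_bits (gate_open label0))
  | PEnd | PPos _ _ _ | PExec _ _ _ _ => None
  end.

Definition tr_fwd (s : phase) (c : tcell) : phase * tcell * seq bool :=
  let: (dg, cu, nw, sc) := c in
  match s with
  | PInc cy => if dg is Some d then (PInc (cy && d), (Some (cy (+) d), cu, nw, sc), [::])
               else (s, c, [::])
  | PReset => (s, (dg, (col_init M, tick0 M), nw, sc), [::])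
  | PHdr => (s, (dg, (col0 M, tick0 M), nw, sc), pair_bits cu)
  | PGate _ => (s, c, pair_bits cu)
  | PCopy b l cy =>
      let: (cy', t) := inc_digit (tick0 M) (ticks1 M) cy cu.2 in
      (PCopy b l cy', (dg, cu, (cu.1, t), sc), [::])
  | PRew _ _ => (s, (dg, cu, nw, head_bit (col_get rg_w cu.1)), [::])
  | PPos b l z => (PPos b l (z && ~~ sc), c, [::])
  | PExec b l sy q =>
      let: (q', a) := instr_fwd (prog l) sy q nw.1 in
      (PExec b l sy q', (dg, cu, (a, nw.2), sc), [::])
  | PPrint _ _ => (s, c, pair_bits nw)
  | PIncC cy =>
      let: (cy', a) := inc_digit (col0 M) (cols1 M) cy cu.1 in
      (PIncC cy', (dg, (a, cu.2), nw, sc), [::])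
  | PIncT cy =>
      let: (cy', t) := inc_digit (tick0 M) (ticks1 M) cy cu.2 in
      (PIncT cy', (dg, (cu.1, t), nw, sc), [::])
  | _ => (s, c, [::])
  end.

(** Each counter digit owns a block of [kk.+1] cells, of which only the first carries it; so the
    tape length becomes a fixed multiple of the number of digits. *)
Definition pad_cell (j : nat) : tcell :=
  (if j == 0 then Some true else None, (col_init M, tick0 M), (col_init M, tick0 M), false).

Definition tr_end (s : phase) : phase * option tcell * seq bool :=
  match s with
  | PApp j => (s, Some (pad_cell j), [::])
  | PHdr => (s, None, to_bits [:: SComma; SLpar])
  | PGate _ => (s, None, to_bits [:: SComma; SOp ODiv; SComma; SLpar])
  | PPos b l z => (PPosB b l z (if z then None else Some false), None, [::])
  | PExec b l sy q =>
      (PExecB b l (inord (next_lab (prog l) b l q.1)) (instr_turn (prog l) sy q), None, [::])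
  | _ => (s, None, [::])
  end.

Definition tr_bwd (s : phase) (c : tcell) : phase * tcell :=
  let: (dg, cu, nw, sc) := c in
  match s with
  | PPosB b l z bo => let: (bo', sc') := bwd_bit bo sc in (PPosB b l z bo', (dg, cu, nw, sc'))
  | PExecB b l l' w => let: (w', a) := instr_bwd (prog l) w nw.1 in
                       (PExecB b l l' w', (dg, cu, (a, nw.2), sc))
  | _ => (s, c)
  end.

Definition transducer : sweep_machine :=
  @SweepMachine phase tcell PStart tr_turn tr_fwd tr_end tr_bwd.

(** * Effect of the individual sweeps *)

Section Run.
Variables (x : seq bool) (B : nat).

Definition mid : phase -> nat -> seq tcell -> seq bool -> seq bool -> Prop :=
  @mid_run transducer x B.

Lemma turn_mid s s1 ih m L out o1 res : size L <= B ->
  tr_turn s (in_sym x ih) = Some (s1, m, o1) ->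
  mid s1 (move_in x m ih) L (out ++ o1) res ->
  @shalts transducer x B (s, ih, L, out) res.
Proof.
exact: (@turn_mid_run transducer).
Qed.

Lemma sweep_const s L : (forall c, tr_fwd s c = (s, c, [::])) -> sweep tr_fwd s L = (s, L, [::]).
Proof. by move=> h; elim: L => //= c L IH; rewrite h IH. Qed.

Lemma sweep_back_const s L : (forall c, tr_bwd s c = (s, c)) -> sweep_back tr_bwd s L = (s, L).
Proof. by move=> h; elim: L => //= c L IH; rewrite IH h. Qed.

Definition cu_c (L : seq tcell) : seq (column M) := [seq c.1.1.2.1 | c <- L].
Definition cu_t (L : seq tcell) : seq (tick M) := [seq c.1.1.2.2 | c <- L].
Definition nw_c (L : seq tcell) : seq (column M) := [seq c.1.2.1 | c <- L].
Definition nw_t (L : seq tcell) : seq (tick M) := [seq c.1.2.2 | c <- L].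
Definition scratch (L : seq tcell) : seq bool := [seq c.2 | c <- L].

Definition cells_syms (t : seq (tick M)) (s : seq (column M)) : seq sym :=
  bit_syms (cells_bits t s).

Lemma to_bits_cu L :
  flatten [seq pair_bits c.1.1.2 | c <- L] = to_bits (cells_syms (cu_t L) (cu_c L)).
Proof.
elim: L => //= -[[[dg [a t]] nw] sc] L /= ->.
by rewrite /cells_syms /cells_bits /= /bit_syms map_cat to_bits_cat.
Qed.

Lemma to_bits_nw L :
  flatten [seq pair_bits c.1.2 | c <- L] = to_bits (cells_syms (nw_t L) (nw_c L)).
Proof.
elim: L => //= -[[[dg cu] [a t]] sc] L /= ->.
by rewrite /cells_syms /cells_bits /= /bit_syms map_cat to_bits_cat.
Qed.

Definition mid_after (l : 'I_nlabs) ih L out pre res :=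
  if next_digit label0 labels1 l is Some l' then
    mid (PGate l') ih L (out ++ to_bits (pre ++ SComma :: gate_open l')) res
  else mid (PIncC true) ih L (out ++ to_bits (pre ++ [:: SComma])) res.

Lemma turn_after s l ih L out pre res : size L <= B ->
  (forall sy, tr_turn s sy = after_gate l pre) -> mid_after l ih L out pre res ->
  @shalts transducer x B (s, ih, L, out) res.
Proof.
move=> sz e; rewrite /mid_after; move: (e (in_sym x ih)); rewrite /after_gate.
by case: (next_digit _ _ _) => [l'|] e'; apply: turn_mid e'.
Qed.

Lemma midE s ih L out res s2 L2 o2 : sweep tr_fwd s L = (s2, L2, o2) ->
  (let: (s3, oc, o3) := tr_end s2 in
   let: (s4, L4) := sweep_back tr_bwd s3 L2 in
   @shalts transducer x B (s4, ih, L4 ++ seq_of_opt oc, out ++ o2 ++ o3) res) ->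
  mid s ih L out res.
Proof. by move=> e; rewrite /mid /mid_run [sweep _ _ _]e. Qed.

Lemma mid_gate (l : 'I_nlabs) ih L out res : size L <= B ->
  (let out1 := out ++ to_bits (cells_syms (cu_t L) (cu_c L)
     ++ [:: SComma; SOp ODiv; SComma; SLpar]) in
   if l == lab_bad :> nat then mid_after l ih L out1 [:: S0; SComma; S0; SRpar; SRpar] res
   else mid (PCopy true l true) ih L out1 res) ->
  mid (PGate l) ih L out res.
Proof.
move=> sz h.
have e : sweep tr_fwd (PGate l) L = (PGate l, L, flatten [seq pair_bits c.1.1.2 | c <- L]).
  by elim: (L) => //= -[[[dg cu] nw] sc] L' /= ->.
apply: midE e _; rewrite /= sweep_back_const; last by case=> [[[]]].
rewrite cats0 to_bits_cu -to_bits_cat; move: h => /=; case: ifP => eb h.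
  by apply: turn_after h => // sy /=; rewrite eb.
apply: turn_mid => //; first by rewrite /= eb.
by rewrite cats0.
Qed.

Lemma sweep_copy b l cy L :
  let: (cy', t) := mealy (inc_digit (tick0 M) (ticks1 M)) cy (cu_t L) in
  exists L', [/\ sweep tr_fwd (PCopy b l cy) L = (PCopy b l cy', L', [::]),
    size L' = size L, cu_c L' = cu_c L, cu_t L' = cu_t L & nw_c L' = cu_c L /\ nw_t L' = t].
Proof.
elim: L cy => [|[[[dg [a t]] nw] sc] L IH] cy /=; first by exists [::].
case: (inc_digit _ _ cy t) => cy1 t1; move: (IH cy1).
case: (mealy _ _ _) => cy2 t2 [L' [-> sz e1 e2 [e3 e4]]].
by eexists; split; [by [] | rewrite /= sz | rewrite /= e1 | rewrite /= e2 | rewrite /= e3 e4].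
Qed.

Lemma mid_copy b (l : 'I_nlabs) ih L out res : size L <= B ->
  (forall L', size L' = size L -> cu_c L' = cu_c L -> cu_t L' = cu_t L -> nw_c L' = cu_c L ->
     if next_time (cu_t L) is Some t then nw_t L' = t ->
       if is_step (prog l) then mid (PRew b l) ih.-1 L' out res
       else mid (PExec b l None (instr_init M)) ih L' out res
     else mid_after l ih L' out [:: S1; SComma; S1; SRpar; SRpar] res) ->
  mid (PCopy b l true) ih L out res.
Proof.
move=> sz h; have := sweep_copy b l true L; rewrite /next_time /next_str in h.
case: (mealy _ _ _) h => cy t h [L' [e sz' e1 e2 [e3 e4]]].
apply: midE e _; rewrite /= sweep_back_const; last by case=> [[[]]].
rewrite !cats0; have := h L' sz' e1 e2 e3; case: cy {h} => h.
  by apply: turn_after h; rewrite ?sz'.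
move/(_ e4): h; case: ifP => is_st h.
  by apply: turn_mid; rewrite ?sz' //= ?is_st // cats0.
by apply: turn_mid; rewrite ?sz' //= ?is_st // cats0.
Qed.

Lemma mid_print b l ih L out res : size L <= B ->
  (let out1 := out ++ to_bits (cells_syms (nw_t L) (nw_c L)) in
   if b then mid (PCopy false l true) ih L (out1 ++ to_bits [:: SComma]) res
   else mid_after l ih L out1 [:: SRpar; SRpar] res) ->
  mid (PPrint b l) ih L out res.
Proof.
move=> sz h.
have e : sweep tr_fwd (PPrint b l) L = (PPrint b l, L, flatten [seq pair_bits c.1.2 | c <- L]).
  by elim: (L) => //= -[[[dg cu] nw] sc] L' /= ->.
apply: midE e _; rewrite /= sweep_back_const; last by case=> [[[]]].
rewrite !cats0 to_bits_nw; move: h => /=; case: b => h.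
  by apply: turn_mid.
by apply: turn_after h.
Qed.

Lemma sweep_exec b (l : 'I_nlabs) sy q L :
  let: (q', cs) := mealy (instr_fwd (prog l) sy) q (nw_c L) in
  exists L', [/\ sweep tr_fwd (PExec b l sy q) L = (PExec b l sy q', L', [::]),
    size L' = size L, cu_c L' = cu_c L, cu_t L' = cu_t L & nw_c L' = cs /\ nw_t L' = nw_t L].
Proof.
elim: L q => [|[[[dg cu] [a t]] sc] L IH] q /=; first by exists [::].
case: (instr_fwd _ _ q a) => q1 a1; move: (IH q1).
case: (mealy _ _ _) => q2 t2 [L' [-> sz e1 e2 [e3 e4]]].
by eexists; split; [by [] | rewrite /= sz | rewrite /= e1 | rewrite /= e2 | rewrite /= e3 e4].
Qed.

Lemma sweep_back_exec b (l : 'I_nlabs) l' w L :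
  let: (w', cs) := sweep_back (instr_bwd (prog l)) w (nw_c L) in
  exists L', [/\ sweep_back tr_bwd (PExecB b l l' w) L = (PExecB b l l' w', L'),
    size L' = size L, cu_c L' = cu_c L, cu_t L' = cu_t L & nw_c L' = cs /\ nw_t L' = nw_t L].
Proof.
elim: L => [|[[[dg cu] [a t]] sc] L IH] /=; first by exists [::].
move: IH; case: (sweep_back _ _ _) => w1 t1 [L' [-> sz e1 e2 [e3 e4]]] /=.
case: (instr_bwd _ w1 a) => w2 t2.
by eexists; split; [by [] | rewrite /= sz | rewrite /= e1 | rewrite /= e2 | rewrite /= e3 e4].
Qed.

Lemma mid_exec b (l : 'I_nlabs) sy ih L out res : size L <= B ->
  (forall L', size L' = size L -> cu_c L' = cu_c L -> cu_t L' = cu_t L -> nw_t L' = nw_t L ->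
     let: (flag, cs) := instr_exec (prog l) sy (nw_c L) in nw_c L' = cs ->
     mid (PPrint b l) ih L'
       (out ++ to_bits (name_open (inord (next_lab (prog l) b l flag)))) res) ->
  mid (PExec b l sy (instr_init M)) ih L out res.
Proof.
move=> sz; rewrite /instr_exec; have := sweep_exec b l sy (instr_init M) L.
case: (mealy _ _ _) => q cs [L1 [e sz1 e1 e2 [e3 e4]]] h.
apply: midE e _; rewrite /=.
set l' := inord _ in h *; have := sweep_back_exec b l l' (instr_turn (prog l) sy q) L1.
move: h; rewrite -e3.
case: (sweep_back (instr_bwd _) _ _) => w cs2 h [L2 [-> sz2 f1 f2 [f3 f4]]].
rewrite !cats0; apply: turn_mid; rewrite ?sz2 ?sz1 //=.
by apply: h; rewrite ?sz2 ?f1 ?f2 ?f4.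
Qed.

Definition same_tracks (L L' : seq tcell) : Prop :=
  [/\ size L' = size L, cu_c L' = cu_c L, cu_t L' = cu_t L, nw_c L' = nw_c L & nw_t L' = nw_t L].

Lemma same_trans L1 L2 L3 : same_tracks L1 L2 -> same_tracks L2 L3 -> same_tracks L1 L3.
Proof. by case=> ? ? ? ? ? [*]; split; congruence. Qed.

(** The turn into this phase already moves left once, so the head is not on the right marker, and
    the first [None] it reads is the left one. *)
Lemma mid_rew b (l : 'I_nlabs) ih L out res : size L <= B -> ih <= size x ->
  (forall L', same_tracks L L' -> scratch L' = map (@head_bit M) (track rg_w (cu_c L)) ->
     mid (PPos b l true) 0 L' out res) ->
  mid (PRew b l) ih L out res.
Proof.
elim: ih L => [|ih IH] L sz ihx h.
all: have [L1 [e same e1]] : exists L', [/\ sweep tr_fwd (PRew b l) L = (PRew b l, L', [::]),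
     same_tracks L L' & scratch L' = map (@head_bit M) (track rg_w (cu_c L))].
1,3: elim: (L) => [|[[[dg [a t]] [a' t']] sc] L0 [L' [/= -> [s0 s1 s2 s3 s4] e1]]];
  [by exists [::] | eexists; split=> //=;
    [split; rewrite /= ?s0 ?s1 ?s2 ?s3 ?s4 | rewrite /= e1]] => //.
all: have [sz1 ec _ _ _] := same.
all: apply: midE e _; rewrite /= sweep_back_const; last by case=> [[[]]].
all: rewrite !cats0.
  apply: (@turn_mid _ (PPos b l true) 0 MvS _ _ [::]); rewrite ?sz1 //.
  by rewrite cats0; apply: h.
apply: (@turn_mid _ (PRew b l) ih.+1 MvL _ _ [::]); rewrite ?sz1 //.
  by rewrite /in_sym /= ihx.
rewrite cats0; apply: IH; rewrite ?sz1 //; first exact: ltnW.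
by move=> L' same'; rewrite ec; apply: h; apply: same_trans same same'.
Qed.

Lemma bits_val_cons b s : bits_val (b :: s) = b * 2 ^ size s + bits_val s.
Proof.
rewrite /bits_val rev_cons -(size_rev s); elim: (rev s) => [|a u IH] /=.
  by rewrite muln1; lia.
by rewrite IH expnS; lia.
Qed.

Lemma bits_val0 s : all negb s = (bits_val s == 0).
Proof.
elim: s => //= b s IH; rewrite bits_val_cons IH addn_eq0 muln_eq0 expn_eq0 /=.
by case: b.
Qed.

Lemma borrow_bits s :
  let: (bo, s') := sweep_back bwd_bit (Some false) s in
  [/\ size s' = size s, bo = (if bits_val s == 0 then Some false else None) &
   (bits_val s').+1 = bits_val s + (bits_val s == 0) * 2 ^ size s].
Proof.
elim: s => [|b s] //=; case: (sweep_back _ _ s) => bo s' [sz -> h].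
rewrite bits_val_cons; case: eqP h => [e0|ne] h.
  have p0 : (2 ^ size s == 0) = false by rewrite expn_eq0.
  by case: b; rewrite e0 /= ?addn0 ?mul1n ?mul0n ?p0 ?eqxx bits_val_cons sz; split=> //;
     rewrite ?expnS; lia.
have -> : (b * 2 ^ size s + bits_val s == 0) = false by lia.
by rewrite /= bits_val_cons sz; split=> //; lia.
Qed.

(** Each double sweep lowers the scratch number by one and moves the head one to the right, so their
    sum determines the symbol finally read. *)
Lemma mid_pos b (l : 'I_nlabs) ih L out res : size L <= B -> ih <= (size x).+1 ->
  (forall L' ih', same_tracks L L' -> ih' <= (size x).+1 ->
     mid (PExec b l (in_sym x (ih + bits_val (scratch L))) (instr_init M)) ih' L' out res) ->
  mid (PPos b l true) ih L out res.
Proof.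
move ev: (bits_val (scratch L)) => v; elim: v ih L ev => [|v IH] ih L ev sz ihx h.
all: have e z : sweep tr_fwd (PPos b l z) L = (PPos b l (z && all negb (scratch L)), L, [::])
  by elim: (L) z => [|[[[dg cu] nw] sc] L' IHL] z /=; rewrite ?andbT // IHL andbA.
all: have back z bo : exists L', [/\ sweep_back tr_bwd (PPosB b l z bo) L =
       (PPosB b l z (sweep_back bwd_bit bo (scratch L)).1, L'),
      same_tracks L L' & scratch L' = (sweep_back bwd_bit bo (scratch L)).2].
1,3: elim: (L) => [|[[[dg [a t]] [a' t']] sc] L0 [L' [/= -> [s0 s1 s2 s3 s4] ]]] /=;
  [by exists [::] |
   case: (sweep_back bwd_bit bo _) => bo1 s' /= e1; case: (bwd_bit bo1 sc) => bo2 sc'];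
  eexists; split=> /=; [by [] | by split; rewrite /= ?s0 ?s1 ?s2 ?s3 ?s4 | by rewrite /= e1].
all: apply: midE (e true) _; rewrite bits_val0 ev /=.
  have [L1 [-> same _]] := back true None; have [sz1 _ _ _ _] := same.
  rewrite !cats0.
  apply: (@turn_mid _ (PExec b l (in_sym x ih) (instr_init M)) ih MvS _ _ [::]); rewrite ?sz1 //.
  by rewrite cats0; have := h _ _ same ihx; rewrite addn0.
have [L1 [-> same e1]] := back false (Some false); have [sz1 _ _ _ _] := same.
rewrite !cats0; apply: (@turn_mid _ (PPos b l true) ih MvR _ _ [::]); rewrite ?sz1 // cats0.
apply: IH; rewrite ?sz1 //.
- rewrite e1; have := borrow_bits (scratch L).
  by case: (sweep_back _ _ _) => bo s' [_ _]; rewrite ev /= mul0n; lia.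
- by rewrite /= geq_minr.
move=> L' ih' same' ihx'; have := h _ _ (same_trans same same') ihx'.
(* The enumeration also contains strings whose stored position lies beyond the right marker. The
   head then stays on the marker, and both positions read [None]. *)
suff -> : in_sym x (move_in x MvR ih + v) = in_sym x (ih + v.+1) by [].
rewrite /= /minn; case: ltnP => lt; first by rewrite addSnnS.
have beyond m : size x < m -> in_sym x m = None.
  by rewrite /in_sym => lt'; case: ifP => // /andP[_ le]; lia.
by rewrite !beyond //; lia.
Qed.

Lemma sweep_inc_c cy L :
  let: (cy', s) := mealy (inc_digit (col0 M) (cols1 M)) cy (cu_c L) in
  exists L', [/\ sweep tr_fwd (PIncC cy) L = (PIncC cy', L', [::]),
    size L' = size L, cu_c L' = s & cu_t L' = cu_t L].
Proof.
elim: L cy => [|[[[dg [a t]] nw] sc] L IH] cy /=; first by exists [::].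
case: (inc_digit _ _ cy a) => cy1 a1; move: (IH cy1).
case: (mealy _ _ _) => cy2 t2 [L' [-> sz e1 e2]].
by eexists; split; [by [] | rewrite /= sz | rewrite /= e1 | rewrite /= e2].
Qed.

Lemma sweep_inc_t cy L :
  let: (cy', t) := mealy (inc_digit (tick0 M) (ticks1 M)) cy (cu_t L) in
  exists L', [/\ sweep tr_fwd (PIncT cy) L = (PIncT cy', L', [::]),
    size L' = size L, cu_c L' = cu_c L & cu_t L' = t].
Proof.
elim: L cy => [|[[[dg [a t]] nw] sc] L IH] cy /=; first by exists [::].
case: (inc_digit _ _ cy t) => cy1 a1; move: (IH cy1).
case: (mealy _ _ _) => cy2 t2 [L' [-> sz e1 e2]].
by eexists; split; [by [] | rewrite /= sz | rewrite /= e1 | rewrite /= e2].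
Qed.

Lemma mid_inc_t ih L out res : size L <= B ->
  (forall L', size L' = size L -> cu_c L' = cu_c L ->
     if next_time (cu_t L) is Some t then cu_t L' = t ->
       mid (PGate label0) ih L' (out ++ to_bits (gate_open label0)) res
     else res = out ++ to_bits final_syms) ->
  mid (PIncT true) ih L out res.
Proof.
move=> sz; have := sweep_inc_t true L; rewrite /next_time /next_str.
case: (mealy _ _ _) => cy t [L' [e sz' e1 e2]] h.
apply: midE e _; rewrite /= sweep_back_const; last by case=> [[[]]].
rewrite !cats0; move: (h L' sz' e1); case: cy {h} => h.
  apply: turn_mid; rewrite ?sz' //=.
  rewrite -h; apply: (@midE _ _ _ _ _ PEnd L' [::]).
    by apply: sweep_const => -[[[]]].
  rewrite /= sweep_back_const; last by case=> [[[]]].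
  by rewrite !cats0; apply: shalt; rewrite ?sz'.
by apply: turn_mid; rewrite ?sz' //=; apply: h.
Qed.

Lemma mid_inc_c ih L out res : size L <= B ->
  (forall L', size L' = size L -> cu_t L' = cu_t L ->
     if next_str (col0 M) (cols1 M) (cu_c L) is Some s then cu_c L' = s ->
       mid (PGate label0) ih L' (out ++ to_bits (gate_open label0)) res
     else cu_c L' = nseq (size L) (col0 M) -> mid (PIncT true) ih L' out res) ->
  mid (PIncC true) ih L out res.
Proof.
move=> sz; have := sweep_inc_c true L; rewrite /next_str.
case E: (mealy _ _ _) => [cy t] [L' [e sz' e1 e2]] h.
apply: midE e _; rewrite /= sweep_back_const; last by case=> [[[]]].
rewrite !cats0; move: (h L' sz' e2); case: cy {h} E => E h.
  apply: turn_mid; rewrite ?sz' //= cats0; apply: h.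
  by rewrite e1 (mealy_inc_overflow E) size_map.
by apply: turn_mid; rewrite ?sz' //=; apply: h.
Qed.

Definition mid_next (l : 'I_nlabs) ih L out res :=
  if next_digit label0 labels1 l is Some l' then
    mid (PGate l') ih L (out ++ to_bits (gate_open l')) res
  else mid (PIncC true) ih L out res.

Lemma to_bits_outcat out a b : (out ++ to_bits a) ++ to_bits b = out ++ to_bits (a ++ b).
Proof. by rewrite -catA -to_bits_cat. Qed.

Lemma mid_afterE l ih L out pre res :
  mid_next l ih L (out ++ to_bits (pre ++ [:: SComma])) res -> mid_after l ih L out pre res.
Proof.
rewrite /mid_next /mid_after; case: (next_digit _ _ _) => [l'|] //.
by rewrite -catA -to_bits_cat -catA.
Qed.

Lemma enc_name t (st : node M) : enc_num (name t st) = name_open st.1 ++ cells_syms t st.2.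
Proof. by rewrite /enc_num binary_name /name_bits /cells_syms /bit_syms /= map_cat. Qed.

(** The successor is built on the [nw] tracks, so the current node survives for its other successor
    and for the odometer. *)
Lemma mid_branch b (l : 'I_nlabs) t' ih L out res : size L <= B -> ih <= (size x).+1 ->
  next_time (cu_t L) = Some t' ->
  (forall L' ih', size L' = size L -> ih' <= (size x).+1 -> cu_c L' = cu_c L -> cu_t L' = cu_t L ->
     let out1 := out ++ to_bits (enc_num (name t' (node_step x b (l, cu_c L)))) in
     if b then mid (PCopy false l true) ih' L' (out1 ++ to_bits [:: SComma]) res
     else mid_after l ih' L' out1 [:: SRpar; SRpar] res) ->
  mid (PCopy b l true) ih L out res.
Proof.
move=> sz ihx et h; apply: mid_copy => // L1 sz1 c1 t1 n1; rewrite et => m1.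
have exec L2 ih2 : same_tracks L1 L2 -> ih2 <= (size x).+1 ->
    mid (PExec b l (instr_sym x (prog l) (cu_c L)) (instr_init M)) ih2 L2 out res.
  case=> sz2 c2 t2 n2 m2 ihx2; apply: mid_exec; first by rewrite sz2 sz1.
  move=> L3 sz3 c3 t3 m3; rewrite n2 n1.
  case E: (instr_exec _ _ _) => [flag cs] n3.
  apply: mid_print; first by rewrite sz3 sz2 sz1.
  have := h L3 ih2; rewrite sz3 sz2 sz1 c3 c2 c1 t3 t2 t1 => /(_ erefl ihx2 erefl erefl).
  rewrite enc_name /node_step E [(_, _).1]/= [(_, _).2]/= n3 m3 m2 m1 => h1.
  by rewrite -(catA out (to_bits (name_open _))) -to_bits_cat.
have same1 : same_tracks L1 L1 by [].
case eI: (is_step (prog l)); last first.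
  have -> : None = instr_sym x (prog l) (cu_c L) by move: eI; rewrite /instr_sym; case: (prog l).
  exact: exec.
apply: mid_rew; [by rewrite sz1 | by case: (ih) ihx => // i; rewrite /= => /ltnW |].
move=> L2 same2 e2; have [sz2 c2 t2 n2 m2] := same2.
apply: mid_pos; [by rewrite sz2 sz1 | by [] |].
move=> L3 ih3 same3 ihx3; rewrite e2 add0n c1.
have -> : in_sym x (bits_val [seq head_bit i | i <- track rg_w (cu_c L)]) =
    instr_sym x (prog l) (cu_c L) by move: eI; rewrite /instr_sym; case: (prog l).
by apply: exec => //; apply: same_trans same2 same3.
Qed.

Lemma mid_gate_step (l : 'I_nlabs) ih L out res : size L <= B -> ih <= (size x).+1 ->
  (forall L' ih', size L' = size L -> ih' <= (size x).+1 -> cu_c L' = cu_c L -> cu_t L' = cu_t L ->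
     mid_next l ih' L' (out ++ to_bits (enc_gate (layer_gate (node_step x) (@is_bad M)
       (@next_time M) (@name M) (cu_t L) (l, cu_c L)) ++ [:: SComma])) res) ->
  mid (PGate l) ih L (out ++ to_bits (gate_open l)) res.
Proof.
move=> sz ihx h; apply: mid_gate => //=.
have eg ps : enc_gate (Gate (name (cu_t L) (l, cu_c L)) (LOp ODiv) ps) =
    gate_open l ++ cells_syms (cu_t L) (cu_c L) ++ [:: SComma; SOp ODiv; SComma; SLpar] ++
    sepby (map enc_num ps) ++ [:: SRpar; SRpar].
  by rewrite /enc_gate /= enc_name /= -!catA.
rewrite /layer_gate eg /is_bad /= in h.
case: ifP h => _ h.
  apply: mid_afterE; have := h L ih erefl ihx erefl erefl.
  by rewrite -!catA -!to_bits_cat -!catA.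
case et: (next_time (cu_t L)) h => [t'|] h; last first.
  apply: mid_copy => // L' sz' c' t1 n'; rewrite et.
  apply: mid_afterE; have := h L' ih sz' ihx c' t1.
  by rewrite -!catA -!to_bits_cat -!catA.
apply: (mid_branch sz ihx et) => L1 ih1 sz1 ihx1 c1 t1 /=.
apply: (@mid_branch false l t'); rewrite ?sz1 ?t1 // => L2 ih2 sz2 ihx2 c2 t2 /=.
rewrite c1 in c2 *; apply: mid_afterE; have := h L2 ih2 sz2 ihx2 c2 t2.
have sep a a' : sepby (map enc_num [:: a; a']) = enc_num a ++ SComma :: enc_num a' by [].
by rewrite !to_bits_outcat sep -!catA !cat_cons -!catA !cat_cons -!catA.
Qed.

(** * Nested loops over labels, columns and time stamps *)

Definition gate_syms t (st : node M) : seq sym :=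
  enc_gate (layer_gate (node_step x) (@is_bad M) (@next_time M) (@name M) t st) ++ [:: SComma].

Definition string_syms t s : seq sym := flatten [seq gate_syms t (l, s) | l <- label0 :: labels1].
Definition layer_syms W t : seq sym :=
  flatten [seq string_syms t s | s <- strs (col0 M) (cols1 M) W].

Lemma mid_labels l p ih L out res : size L <= B -> ih <= (size x).+1 ->
  chain (next_digit label0 labels1) (l :: p) ->
  (forall L' ih', size L' = size L -> ih' <= (size x).+1 -> cu_c L' = cu_c L -> cu_t L' = cu_t L ->
     mid (PIncC true) ih' L'
       (out ++ to_bits (flatten [seq gate_syms (cu_t L) (l, cu_c L) | l <- l :: p])) res) ->
  mid (PGate l) ih L (out ++ to_bits (gate_open l)) res.
Proof.
elim: p l ih L out => [|l' p IH] l ih L out sz ihx ch h;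
  apply: mid_gate_step => // L1 ih1 sz1 ihx1 c1 t1.
  move: ch => /= /eqP ch; rewrite /mid_next ch.
  by have := h L1 ih1 sz1 ihx1 c1 t1; rewrite /= cats0.
move: ch => /= /andP[/andP[/eqP e pp] lp]; rewrite /mid_next e.
apply: IH; rewrite ?sz1 //; first by rewrite /= pp.
move=> L2 ih2 sz2 ihx2 c2 t2; rewrite c1 t1 to_bits_outcat.
by apply: h; rewrite ?sz2 ?c2 ?t2.
Qed.

Lemma mid_strings s q ih L out res : size L <= B -> ih <= (size x).+1 ->
  chain (next_str (col0 M) (cols1 M)) (s :: q) -> cu_c L = s ->
  (forall L' ih', size L' = size L -> ih' <= (size x).+1 ->
     cu_c L' = nseq (size L) (col0 M) -> cu_t L' = cu_t L ->
     mid (PIncT true) ih' L'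
       (out ++ to_bits (flatten [seq string_syms (cu_t L) s | s <- s :: q])) res) ->
  mid (PGate label0) ih L (out ++ to_bits (gate_open label0)) res.
Proof.
elim: q s ih L out => [|s' q IH] s ih L out sz ihx ch es h.
all: apply: (@mid_labels label0 labels1) => //; first exact: (chain_digits (@digits_uniq _ ord0)).
all: move=> L1 ih1 sz1 ihx1 c1 t1; apply: mid_inc_c; first by rewrite sz1.
all: move=> L2 sz2 t2; rewrite c1 es.
  move: ch => /= /eqP ->; rewrite sz1 => c2.
  by have := h L2 ih1; rewrite sz2 sz1 c2 t2 t1 /= cats0; apply.
move: ch => /= /andP[/andP[/eqP -> pp] lp] c2.
apply: (IH s'); rewrite ?sz2 ?sz1 //; first by rewrite /= pp.
move=> L3 ih3 sz3 ihx3 c3 t3; rewrite t2 t1 to_bits_outcat.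
by apply: h; rewrite ?t3 ?t2.
Qed.

(** The overflow of the column odometer leaves the all-[col0] string, from which the next layer
    starts. Successor layers are printed later, as the reverse topological order demands. *)
Lemma mid_layers t r ih L out res : size L <= B -> ih <= (size x).+1 ->
  chain (@next_time M) (t :: r) -> cu_t L = t -> cu_c L = nseq (size L) (col0 M) ->
  res = out ++ to_bits (flatten [seq layer_syms (size L) t | t <- t :: r] ++ final_syms) ->
  mid (PGate label0) ih L (out ++ to_bits (gate_open label0)) res.
Proof.
have [q eq] := head_strs (col0 M) (cols1 M) (size L).
have chs : chain (next_str (col0 M) (cols1 M)) (nseq (size L) (col0 M) :: q).
  by rewrite -eq; apply: (chain_strs (digits_uniq (col_init M))).
elim: r t ih L out q eq chs => [|t' r IH] t ih L out q eq chs sz ihx ch et es eres.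
all: apply: (mid_strings sz ihx chs es); rewrite -eq -/(layer_syms (size L) (cu_t L)) et.
all: move=> L1 ih1 sz1 ihx1 c1 t1; apply: mid_inc_t; first by rewrite sz1.
all: move=> L2 sz2 c2; rewrite t1.
  by move: ch => /= /eqP ->; rewrite eres /= cats0 to_bits_outcat.
move: ch => /= /andP[/andP[/eqP -> pp] lp] t2.
have szL : size L2 = size L by rewrite sz2.
apply: (IH t' _ _ _ q); rewrite ?szL ?t2 ?c2 //; first by rewrite /= pp.
by rewrite eres to_bits_outcat catA.
Qed.


Lemma flatten_map_allpairs (S T R U : Type) (h : R -> seq U) (f : S -> T -> R) s t :
  flatten (map h [seq f a b | a <- s, b <- t]) =
  flatten [seq flatten [seq h (f a b) | b <- t] | a <- s].
Proof. by elim: s => //= a s IH; rewrite map_cat flatten_cat IH -map_comp. Qed.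

Definition header_syms W : seq sym :=
  SLpar :: enc_num (name (nseq W (tick0 M)) (node_init M W)) ++ [:: SComma; SLpar].

Lemma layers_circuit W :
  to_bits (header_syms W) ++
    to_bits (flatten [seq layer_syms W t | t <- times M W] ++ final_syms) =
  to_bits (enc_instance (reduction_circuit M x W) 1).
Proof.
rewrite -to_bits_cat /header_syms /enc_instance /= /reduction_gates /layer_gates.
rewrite map_cat sepby_rcat //.
have -> : flatten [seq layer_syms W t | t <- times M W] =
   flatten [seq a ++ [:: SComma] | a <- [seq enc_gate i | i <-
     [seq layer_gate (node_step x) (@is_bad M) (@next_time M) (@name M) t s
       | t <- times M W, s <- nodes M W]]].
  rewrite -map_comp flatten_map_allpairs; congr flatten; apply: eq_map => t.
  rewrite /layer_syms /nodes flatten_map_allpairs; congr flatten; apply: eq_map => s.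
  by rewrite /string_syms digitsE.
by rewrite -!catA.
Qed.

(** The output gate is not the first gate listed: [PReset] writes the initial node, and [PHdr]
    prints it while replacing it by the first node of the enumeration. *)
Lemma mid_reset ih L res : size L <= B -> ih <= (size x).+1 ->
  res = to_bits (enc_instance (reduction_circuit M x (size L)) 1) ->
  mid PReset ih L [::] res.
Proof.
move=> sz ihx eres.
have [L1 [e1 sz1 cu1]] : exists L1, [/\ sweep tr_fwd PReset L = (PReset, L1, [::]),
    size L1 = size L & [seq c.1.1.2 | c <- L1] = nseq (size L) (col_init M, tick0 M)].
  elim: (L) => [|[[[dg cu] nw] sc] L0 [L' /= [-> s0 e0]]]; first by exists [::].
  by eexists; split; [by [] | rewrite /= s0 | rewrite /= e0].
have [L2 [e2 sz2 cu2]] : exists L2, [/\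
    sweep tr_fwd PHdr L1 = (PHdr, L2, flatten [seq pair_bits c.1.1.2 | c <- L1]),
    size L2 = size L1 & [seq c.1.1.2 | c <- L2] = nseq (size L1) (col0 M, tick0 M)].
  elim: (L1) => [|[[[dg cu] nw] sc] L0 [L' /= [-> s0 e0]]]; first by exists [::].
  by eexists; split; [by [] | rewrite /= s0 | rewrite /= e0].
have proj (L' : seq tcell) n a b : [seq c.1.1.2 | c <- L'] = nseq n (a, b) ->
    cu_c L' = nseq n a /\ cu_t L' = nseq n b.
  have -> : cu_c L' = unzip1 [seq c.1.1.2 | c <- L'] by rewrite /unzip1 -map_comp.
  have -> : cu_t L' = unzip2 [seq c.1.1.2 | c <- L'] by rewrite /unzip2 -map_comp.
  by move=> ->; rewrite /unzip1 /unzip2 !map_nseq.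
have [c1 t1] := proj _ _ _ _ cu1; have [c2 t2] := proj _ _ _ _ cu2.
apply: midE e1 _; rewrite /= sweep_back_const; last by case=> [[[]]].
rewrite !cats0.
apply: (@turn_mid _ PHdr ih MvS _ _ (to_bits (SLpar :: name_open ord0))); rewrite ?sz1 //.
apply: midE e2 _; rewrite /= sweep_back_const; last by case=> [[[]]].
rewrite cats0 to_bits_cu c1 t1.
apply: (@turn_mid _ (PGate label0) ih MvS _ _ (to_bits (gate_open label0))); rewrite ?sz2 ?sz1 //.
have [r er] := head_strs (tick0 M) (ticks1 M) (size L).
have szL : size L2 = size L by rewrite sz2 sz1.
have := @mid_layers (nseq (size L) (tick0 M)) r ih L2 (to_bits (header_syms (size L))) res.
rewrite szL -er t2 c2 sz1 -[strs _ _ _]/(times M (size L)) layers_circuit.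
move=> /(_ sz ihx _ erefl erefl eres) h.
have -> : to_bits (SLpar :: name_open ord0) ++
    to_bits (cells_syms (nseq (size L) (tick0 M)) (nseq (size L) (col_init M))) ++
    to_bits [:: SComma; SLpar] = to_bits (header_syms (size L)).
  by rewrite -to_bits_cat -to_bits_cat /header_syms enc_name -catA.
apply: h; exact: (chain_strs (@digits_uniq (tick M) (ord0, col_init M))).
Qed.

(** * Measuring the input length *)

Definition counter (L : seq tcell) : seq bool := pmap (fun c => c.1.1.1) L.

Definition counted ih L out res :=
  if in_sym x ih is Some _ then mid (PInc true) (move_in x MvR ih) L out res
  else mid PReset ih L out res.

Lemma turn_counted s ih L out res : size L <= B -> (forall sy, tr_turn s sy = count_turn sy) ->
  counted ih L out res -> @shalts transducer x B (s, ih, L, out) res.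
Proof.
move=> sz e; rewrite /counted; case E: (in_sym x ih) => [c|] h.
  by apply: (@turn_mid s (PInc true) ih MvR _ _ [::]); rewrite ?e ?E ?cats0.
by apply: (@turn_mid s PReset ih MvS _ _ [::]); rewrite ?e ?E ?cats0.
Qed.

Lemma mid_app i j ih L out res : j + i = kk -> size L + i.+1 <= B ->
  counted ih (L ++ map pad_cell (iota j i.+1)) out res ->
  mid (PApp (inord j)) ih L out res.
Proof.
elim: i j L => [|i IH] j L ej sz h.
all: apply: midE (sweep_const _ _) _ => [[[[]]]|] //=.
all: rewrite sweep_back_const; last by case=> [[[]]].
all: have jk : j < kk.+1 by lia.
all: rewrite !cats0 /= inordK //.
  apply: turn_counted => //; first by rewrite size_cat /=; lia.
  by move=> sy /=; rewrite inordK //; have -> : (j < kk) = false by lia.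
apply: (@turn_mid _ (PApp (inord j.+1)) ih MvS _ _ [::]).
- by rewrite size_cat /=; lia.
- by rewrite /= inordK //; have -> : (j < kk) = true by lia.
rewrite cats0; apply: IH; rewrite ?size_cat -?catA //=; lia.
Qed.

Lemma sweep_inc_counter cy L : exists cy' L', [/\ sweep tr_fwd (PInc cy) L = (PInc cy', L', [::]),
  size L' = size L, size (counter L') = size (counter L) &
  lsb_val (counter L') + cy' * 2 ^ size (counter L) = lsb_val (counter L) + cy].
Proof.
elim: L cy => [|[[[[d|] cu] nw] sc] L IH] cy /=.
- by exists cy, [::]; split=> //=; lia.
- have [cy' [L' [-> sz1 sz2 e]]] := IH (cy && d).
  eexists cy', _; split; [by [] | by rewrite /= sz1 | by rewrite /= sz2 |].
  by rewrite /= expnS; move: e; case: (cy); case: d; rewrite /=; lia.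
- have [cy' [L' [-> sz1 sz2 e]]] := IH cy.
  by eexists cy', _; split; [by [] | by rewrite /= sz1 | by rewrite /= sz2 |].
Qed.

Lemma counter_pad : counter (map pad_cell (iota 0 kk.+1)) = [:: true].
Proof.
suff pad n m : 0 < m -> counter (map pad_cell (iota m n)) = [::] by rewrite /= -/(counter _) pad.
by elim: n m => [|n IH] [|m] //= _; apply: IH.
Qed.

Definition width : nat := kk.+1 * (trunc_log 2 (size x).+1).+1.

(** The counter holds the head position without leading zeros. At the right marker that position is
    [(size x).+1], so the number of digits is its logarithm plus one. *)
Lemma counted_loop r ih L out res : ih + r = (size x).+1 -> 0 < ih -> width <= B ->
  lsb_val (counter L) = ih -> 2 ^ (size (counter L)).-1 <= ih -> 0 < size (counter L) ->
  size L = kk.+1 * size (counter L) ->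
  (forall L', size L' = width -> mid PReset (size x).+1 L' out res) ->
  counted ih L out res.
Proof.
have lsb_lt s : lsb_val s < 2 ^ size s by elim: s => //= b s; rewrite expnS; case: b; lia.
elim: r ih L => [|r IH] ih L er ih0 wB ev lo dg sz h; rewrite /counted /in_sym.
  have -> : ih = (size x).+1 by lia.
  rewrite ltnn andbF; apply: h; rewrite sz /width.
  have := lsb_lt (counter L); rewrite ev; case: (size (counter L)) dg lo => [|d] // _ /= lo hi.
  by congr (_ * _.+1); apply: esym; apply: trunc_log_eq => //; apply/andP; split; lia.
have -> : (0 < ih) && (ih <= size x) by lia.
have Dle m : 2 ^ m <= (size x).+1 -> kk.+1 * m.+1 <= B.
  move=> lem; apply: leq_trans wB; rewrite leq_mul2l ltnS; apply/orP; right.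
  by apply: trunc_log_max.
have szB : size L <= B by rewrite sz -(prednK dg); apply: Dle; lia.
have emv : move_in x MvR ih = ih.+1 by rewrite /= /minn; case: ifP => //; lia.
have [cy [L1 [e1 sz1 szc ev1]]] := sweep_inc_counter true L.
rewrite emv; apply: midE e1 _; rewrite /= sweep_back_const; last by case=> [[[]]].
rewrite !cats0; case: cy ev1 => ev1.
  (* Overflow leaves all digits zero; the appended block contributes a new top digit 1, which
     restores the value. *)
  have lo1 : 2 ^ size (counter L) <= ih.+1 by lia.
  apply: (@turn_mid _ (PApp ord0) ih.+1 MvS _ _ [::]); rewrite ?sz1 //.
  have -> : ord0 = inord 0 :> 'I_kk.+1 by apply: val_inj; rewrite /= inordK.
  rewrite cats0 [move_in _ _ _]/=; apply: (@mid_app kk 0) => //.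
    by rewrite sz1 sz addnC -mulnS; apply: Dle; lia.
  have ec : counter (L1 ++ [seq pad_cell i | i <- iota 0 kk.+1]) = rcons (counter L1) true.
    have counter_cat L2 L3 : counter (L2 ++ L3) = counter L2 ++ counter L3 by apply: pmap_cat.
    by rewrite counter_cat counter_pad cats1.
  apply: IH; rewrite ?ec ?size_rcons ?szc //; try lia.
  - have lv s : lsb_val (rcons s true) = lsb_val s + 2 ^ size s.
      by elim: s => //= b s ->; rewrite expnS; lia.
    by rewrite lv szc; lia.
  - by rewrite size_cat sz1 sz size_map size_iota; lia.
apply: turn_counted; rewrite ?sz1 //.
by apply: IH; rewrite ?szc ?sz1 //; lia.
Qed.

Lemma transducer_halts : width <= B ->
  @shalts transducer x B (PStart, 1, [::], [::])
    (to_bits (enc_instance (reduction_circuit M x width) 1)).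
Proof.
move=> wB; apply: (@turn_mid _ (PApp ord0) 1 MvS _ _ [::]) => //.
have -> : ord0 = inord 0 :> 'I_kk.+1 by apply: val_inj; rewrite /= inordK.
have kB : kk.+1 <= B by apply: leq_trans wB; rewrite /width leq_pmulr.
apply: (@mid_app kk 0) => //; rewrite cat0s.
apply: (@counted_loop (size x)); rewrite ?counter_pad ?size_map ?size_iota ?muln1 //.
by move=> L sz; apply: mid_reset; rewrite ?sz.
Qed.

End Run.
End Transducer.

Theorem theorem10 : NL_hard (MC (fun o => o = ODiv)).
Proof.
move=> L [M [c [space accL]]].
exists (fun x => to_bits (enc_instance (reduction_circuit M x (width c x)) 1)); split.
  (* The factor 2 absorbs the passage from the logarithm of [(size x).+1] to that of [size x], which
     costs at most one. *)
  apply: (@sweep_logspace (transducer M c) _ (2 * c.+1)) => x.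
  apply: transducer_halts; rewrite /width -mulnA mulnCA leq_mul2l /=.
  have := trunc_logP (isT : 1 < 2) (isT : 0 < (size x).+1).
  have := trunc_log_ltn (size x) (isT : 1 < 2).
  move=> h1 h2; suff : trunc_log 2 (size x).+1 <= (trunc_log 2 (size x)).+1 by lia.
  by rewrite -(leq_exp2l _ _ (isT : 1 < 2)); apply: leq_trans h2 _.
move=> x; rewrite accL.
have h1 := trunc_log_ltn (size x).+1 (isT : 1 < 2).
have h2 : trunc_log 2 (size x) <= trunc_log 2 (size x).+1 by apply: leq_trunc_log.
rewrite reduction_correct.
- by [].
- by rewrite muln_gt0.
(* Blocks of [c.+1] cells instead of [c] make the bound on the work head strict. *)
- move=> k /space; rewrite /logbound /width => le.
  apply: leq_ltn_trans le _; rewrite mulSn.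
  have : c * (trunc_log 2 (size x)).+1 <= c * (trunc_log 2 (size x).+1).+1.
    by rewrite leq_mul2l ltnS h2 orbT.
  by lia.
- apply: leq_trans h1 _; rewrite leq_exp2l // /width.
  by rewrite leq_pmull.
Qed.
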